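(* Consider an exact symplectic twist map on the cylinder $\mathbb{T}\times\mathbb{R}$ of the form $$x' = x + a(y) + \varepsilon f(x,y),\qquad y' = y+\varepsilon g(x,y),$$ with $a'(y)>0$ and with $a,f,g$ analytic and $f,g$ $2\pi$-periodic in $x$. Let $\omega\in\mathbb{R}$ be such that $2\pi\omega=a(y_0)$ for some $y_0$ in the real interval on which the map is considered. If $\omega$ satisfies the Bryuno condition, then there exists $\varepsilon_0>0$ such that the map admits an analytic invariant curve with rotation number $\omega$, analytic in $\varepsilon$ for $|\varepsilon|<\varepsilon_0$.
   Context: Setting: $\mathbb{T}=\mathbb{R}/2\pi\mathbb{Z}$; $\varepsilon\in\mathbb{R}$ is the perturbation parameter. The functions $a,f,g$ extend analytically to a complex domain $\mathcal{D}=\mathbb{T}_{\xi_0}\times\mathcal{A}$, where $\xi_0>0$, $\mathbb{T}_{\xi_0}=\{x\in\mathbb{C}/2\pi\mathbb{Z}:|\mathrm{Im}\,x|\le\xi_0\}$ and $\mathcal{A}\subset\mathbb{C}$ is a complex neighbourhood of an interval of the real axis; $a$ depends on $y$ only and $a'(y)>0$ on the real interval (twist condition). The normalisation $\max\{|f|,|g|\}=1$ for the supremum norms in $\mathcal{D}$ is used. Exact symplectic: the map (for each small $\varepsilon$) is area-preserving with zero flux; equivalently there is a generating function $S_\varepsilon(x,x')=S_0(x'-x)+\varepsilon\sigma_\varepsilon(x,x')$, with $S_0$ a primitive of the inverse function of $a$ and $\sigma_\varepsilon(x,x')$ analytic in $x,x',\varepsilon$ with $\sigma_\varepsilon(x+2\pi,x'+2\pi)=\sigma_\varepsilon(x,x')$,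 such that the map is written implicitly as $y=-\partial S_\varepsilon(x,x')/\partial x$, $y'=\partial S_\varepsilon(x,x')/\partial x'$. Invariant curve with rotation number $\omega$: there exist two $2\pi$-periodic functions $h,H$ such that the curve is $x=\psi+h(\psi)$, $y=y_0+H(\psi)$, where $a(y_0)=2\pi\omega$, and the dynamics induced by the map on the curve is $\psi'=\psi+2\pi\omega$. The invariant curve is analytic if $h,H$ are analytic in $\psi$, and it is analytic in $\varepsilon$ if $h,H$ (which depend on $\varepsilon$) are analytic in $\varepsilon$. Bryuno condition: $\omega$ is irrational and $\mathfrak{B}(\omega):=\sum_{k=0}^{\infty}\frac{1}{q_k}\log q_{k+1}<\infty$, where $\{q_k\}$ are the denominators of the convergents of the continued fraction expansion of $\omega$. *)

(* Defs.v *)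
From Stdlib Require Export Reals.
From Coquelicot Require Export Coquelicot.

Open Scope R_scope.

Definition analytic_at {K : AbsRing} (F : K -> K) (x0 : K) : Prop :=
  exists (c : nat -> AbsRing_NormedModule K) (r : R),
    0 < r /\
    forall x : K, abs (minus x x0) < r -> is_pseries c (minus x x0) (F x).

(* The double family [u] is absolutely summable, with sum [l].  Because of the
   absolute convergence, grouping by diagonals j + k = n loses no generality. *)
Definition is_double_series {K : AbsRing} (u : nat -> nat -> K) (l : K) : Prop :=
  ex_series (fun n => sum_n (fun j => abs (u j (n - j)%nat)) n) /\
  is_series (V := AbsRing_NormedModule K)
    (fun n => sum_n (fun j => u j (n - j)%nat) n) l.

(* Joint analyticity: an absolutely convergent power series in both variables
   on a polydisc around the point. *)
Definition analytic2_at {K : AbsRing} (F : K -> K -> K) (x0 y0 : K) : Prop :=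
  exists (c : nat -> nat -> K) (r : R),
    0 < r /\
    forall x y : K, abs (minus x x0) < r -> abs (minus y y0) < r ->
      is_double_series
        (fun j k => mult (c j k)
                      (mult (pow_n (minus x x0) j) (pow_n (minus y y0) k)))
        (F x y).

Definition open_interval (alpha beta : Rbar) (y : R) : Prop :=
  Rbar_lt alpha y /\ Rbar_lt y beta.

Definition strip (xi : R) (x : C) : Prop := Rabs (Im x) <= xi.

Definition complex_neighbourhood (A : C -> Prop) (I : R -> Prop) : Prop :=
  forall y, I y -> locally (RtoC y) A.

Definition extends_analytically (A : C -> Prop) (I : R -> Prop) (a : R -> R) : Prop :=
  exists ac : C -> C,
    (forall y, A y -> analytic_at (K := C_AbsRing) ac y) /\
    (forall y : R, I y -> ac (RtoC y) = RtoC (a y)).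

(* A function on (C / 2 pi Z) x A is represented by its 2 pi-periodic lift. *)
Definition extends_analytically2 (xi : R) (A : C -> Prop) (I : R -> Prop)
    (f : R -> R -> R) : Prop :=
  exists fc : C -> C -> C,
    (forall x y, strip xi x -> A y -> analytic2_at (K := C_AbsRing) fc x y) /\
    (forall x y, strip xi x -> A y -> fc (Cplus x (RtoC (2 * PI))) y = fc x y) /\
    (forall x y : R, I y -> fc (RtoC x) (RtoC y) = RtoC (f x y)).

(* Maps of the cylinder are represented by their lifts to R x R. *)
Definition twist_map (a : R -> R) (f g : R -> R -> R) (eps : R) (p : R * R) : R * R :=
  (fst p + a (snd p) + eps * f (fst p) (snd p), snd p + eps * g (fst p) (snd p)).

(* dx' /\ dy' = dx /\ dy, written with the Jacobian determinant. *)
Definition area_preserving (I : R -> Prop) (T : R * R -> R * R) : Prop :=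
  forall x y, I y ->
    Derive (fun t => fst (T (t, y))) x * Derive (fun t => snd (T (x, t))) y
    - Derive (fun t => fst (T (x, t))) y * Derive (fun t => snd (T (t, y))) x = 1.

Definition C1 (u : R -> R) : Prop :=
  forall t, ex_derive u t /\ continuous (Derive u) t.

(* The net area between a loop (u, v) winding once around the cylinder and its
   image, i.e. the integral of y dx on the image minus the one on the loop,
   vanishes. *)
Definition zero_flux (I : R -> Prop) (T : R * R -> R * R) : Prop :=
  forall u v : R -> R,
    C1 u -> C1 v ->
    (forall t, u (t + 2 * PI) = u t + 2 * PI) ->
    (forall t, v (t + 2 * PI) = v t) ->
    (forall t, I (v t)) ->
    RInt (fun t => snd (T (u t, v t)) * Derive (fun s => fst (T (u s, v s))) t
                   - v t * Derive u t) 0 (2 * PI) = 0.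

Definition exact_symplectic (I : R -> Prop) (T : R * R -> R * R) : Prop :=
  area_preserving I T /\ zero_flux I T.

Definition irrational (w : R) : Prop :=
  forall p q : Z, q <> 0%Z -> w <> IZR p / IZR q.

(* Complete quotients of the continued fraction; [Int_part] is the floor. *)
Fixpoint cf_rem (w : R) (n : nat) : R :=
  match n with
  | O => w
  | S m => / frac_part (cf_rem w m)
  end.

Definition cf_quot (w : R) (n : nat) : Z := Int_part (cf_rem w n).

(* Denominators of the convergents: q_0 = 1, q_1 = a_1,
   q_(n+2) = a_(n+2) q_(n+1) + q_n. *)
Fixpoint cf_den (w : R) (n : nat) : Z :=
  match n with
  | O => 1%Z
  | S m =>
      match m with
      | O => cf_quot w 1
      | S p => (cf_quot w n * cf_den w m + cf_den w p)%Z
      end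
  end.

Definition bryuno (w : R) : Prop :=
  irrational w /\
  ex_series (fun k => / IZR (cf_den w k) * ln (IZR (cf_den w (S k)))).

(* The curve is psi |-> (psi + h psi, y0 + H psi); the equality of lifts makes
   the rotation number exactly w, not only w modulo 1. *)
Definition invariant_curve (I : R -> Prop) (T : R * R -> R * R) (y0 w : R)
    (h H : R -> R) : Prop :=
  (forall psi, h (psi + 2 * PI) = h psi) /\
  (forall psi, H (psi + 2 * PI) = H psi) /\
  (forall psi, I (y0 + H psi)) /\
  (forall psi,
     T (psi + h psi, y0 + H psi) =
     (let psi' := psi + 2 * PI * w in (psi' + h psi', y0 + H psi'))).

(* Main.v *)
Require Import Defs.
From Stdlib Require Import Lra Lia Factorial ZArith List FinFun Cantor Classical
  ClassicalEpsilon ClassicalChoice.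

(** The curve is found by a Newton iteration on its parametrisation, carried out entirely
    with real functions.

    Write [X = psi + h] and [Y = y0 + H], and let a superscript [+] denote the shift of the
    angle by [2 PI w].  The unknowns are [h], [H] and a counterterm [lam], which depends on
    [eps] only, and the equations are
      [X + a(Y) + eps f(X, Y) = X+]   and   [Y + eps g(X, Y) + lam = Y+]:
    the map sends the curve to its rotated copy, translated in the action.  With the
    counterterm no mean value has to vanish for the equations to be solvable.  For an exact
    solution the area between the curve and its image is [2 PI lam] up to sign, so zero flux
    forces [lam = 0] ([zero_flux_counterterm]).

    In the moving frame [xi = X' p], [eta = Y' p + q / X'] the derivative of the map is, up to
    the error of the approximate solution, a unipotent triangular matrix, because its
    determinant is one ([newton_identity_1], [newton_identity_2]).  The linearised equations
    thus reduce to two equations [v+ - v = u], one for [q] and then one for [p].  The correction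
    of the counterterm absorbs the mean value in the first, and the mean value of [q], thanks to
    the twist, the one in the second.  The new error is quadratic in the old one
    ([newton_step]).

    The functions used are sums of terms [r eps^n cos(k psi + phi)] for which the sum of
    [|r| rho^n exp(sigma k)] is at most [M].  This is a property of a function ([W], [V]), stable
    under sums, products, shifts and composition; algebraic identities are then identities
    between real numbers.  Derivatives and small divisors act on single terms.  Since [eps] is
    one of the variables, joint analyticity of the solution comes for free ([V_analytic2]).
    Taylor remainders come from an auxiliary variable [t]: a function with a large weight on [t]
    has, at [t = 1], a small part of degree at least two ([W_taylor2]).

    At step [m] the frequencies below [(5/4)^m] are solved exactly, which costs the largest
    inverse small divisor, and the others are neglected, which costs some width [d] of the strip
    ([W_cohomological]).  By best approximation by convergents ([cf_best_approximation]) the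
    condition of Bryuno says that the logarithms of these costs, divided by [(5/4)^m], are
    summable ([bryuno_scales]).  They are dominated by a sequence [Lam m] with the same property
    which grows at most by the factor [3/2] at each step ([newton_scales]).  As [3/2 < 2], the
    quadratic convergence allows the error [exp(- Lam m)] at step [m]; the loss [d] is then taken
    proportional to [Lam m / (5/4)^m], and the strip does not shrink to nothing
    ([translated_curve]).

    Finally [f] and [g] belong to the algebra ([V_of_analytic]): the coefficients of their
    expansions in the action are periodic functions of the angle with the derivative bounds of
    analytic functions, uniformly over a period by compactness.  Repeated integration by parts
    gives the exponential decay of the Fourier coefficients ([fcoef_decay]), and a continuous
    periodic function is determined by these coefficients ([fourier_uniqueness]). *)

(** * Double series *)

Lemma functional_choice {X Y : Type} (Q : X -> Y -> Prop) :
  (forall x, exists y, Q x y) -> exists F : X -> Y, forall x, Q x (F x).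
Proof.
  intros H. exists (fun x => proj1_sig (constructive_indefinite_description _ (H x))).
  intros x. apply proj2_sig.
Qed.

Lemma is_series_Rplus (a b : nat -> R) (la lb : R) :
  is_series a la -> is_series b lb -> is_series (fun n => a n + b n) (la + lb).
Proof. exact (is_series_plus a b la lb). Qed.

Lemma is_series_Rmult (c : R) (a : nat -> R) (l : R) :
  is_series a l -> is_series (fun n => c * a n) (c * l).
Proof. exact (is_series_scal c a l). Qed.

Lemma is_series_Rminus (a b : nat -> R) (la lb : R) :
  is_series a la -> is_series b lb -> is_series (fun n => a n - b n) (la - lb).
Proof. exact (is_series_minus a b la lb). Qed.

Lemma is_series_eq (a b : nat -> R) (la lb : R) :
  is_series a la -> (forall n, a n = b n) -> la = lb -> is_series b lb.
Proof. intros Ha E <-. now apply (is_series_ext a). Qed.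

Lemma is_series_inj (a : nat -> R) (l l' : R) :
  is_series a l -> is_series a l' -> l = l'.
Proof.
  intros H1 H2. now rewrite <- (is_series_unique _ _ H1), (is_series_unique _ _ H2).
Qed.

Lemma is_series_zero : is_series (fun _ : nat => 0) 0.
Proof.
  apply (is_series_eq (fun n => 0 * (/ 2) ^ n) _ (0 * / (1 - / 2)) _).
  - apply is_series_Rmult, is_series_geom. rewrite Rabs_pos_eq; lra.
  - intros n; ring.
  - ring.
Qed.

Lemma is_series_le (a b : nat -> R) (la lb : R) :
  is_series a la -> is_series b lb -> (forall n, a n <= b n) -> la <= lb.
Proof.
  intros Ha Hb Hle.
  change (Rbar_le la lb).
  apply (is_lim_seq_le (sum_n a) (sum_n b)); [|exact Ha|exact Hb].
  intros n. induction n as [|n IH].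
  - rewrite !sum_O. apply Hle.
  - rewrite !sum_Sn. unfold plus; simpl. specialize (Hle (S n)). lra.
Qed.

Lemma is_series_ge0 (a : nat -> R) (l : R) :
  is_series a l -> (forall n, 0 <= a n) -> 0 <= l.
Proof. intros Ha Hp. exact (is_series_le _ _ _ _ is_series_zero Ha Hp). Qed.

Lemma sum_n_le_series (a : nat -> R) (l : R) (N : nat) :
  is_series a l -> (forall n, 0 <= a n) -> sum_n a N <= l.
Proof.
  intros Ha Hp. change (Rbar_le (sum_n a N) l).
  apply (is_lim_seq_le_loc (fun _ => sum_n a N) (sum_n a));
    [|apply is_lim_seq_const|exact Ha].
  exists N. intros n Hn. induction Hn as [|n Hn IH]; [lra|].
  rewrite sum_Sn. unfold plus; simpl. specialize (Hp (S n)). lra.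
Qed.

Lemma term_le_series (a : nat -> R) (l : R) (N : nat) :
  is_series a l -> (forall n, 0 <= a n) -> a N <= l.
Proof.
  intros Ha Hp. apply Rle_trans with (sum_n a N); [|now apply sum_n_le_series].
  assert (Hs : forall n, 0 <= sum_n a n).
  { intros n; induction n as [|n IH]; [rewrite sum_O; auto|].
    rewrite sum_Sn; unfold plus; simpl. specialize (Hp (S n)); lra. }
  destruct N as [|N]; [rewrite sum_O; lra|].
  rewrite sum_Sn; unfold plus; simpl. specialize (Hs N); lra.
Qed.

Lemma is_series_bounded (a : nat -> R) (M : R) :
  (forall n, 0 <= a n) -> (forall N, sum_n a N <= M) ->
  exists l : R, is_series a l /\ l <= M.
Proof.
  intros Hp Hb.
  assert (Hex : ex_finite_lim_seq (sum_n a)).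
  { apply ex_finite_lim_seq_incr with M; [|exact Hb].
    intros n. rewrite sum_Sn; unfold plus; simpl. specialize (Hp (S n)); lra. }
  destruct Hex as [l Hl]. exists l. split; [exact Hl|].
  change (Rbar_le l M).
  apply (is_lim_seq_le (sum_n a) (fun _ => M)); auto. apply is_lim_seq_const.
Qed.

Lemma is_series_dominated (a b : nat -> R) (lb : R) :
  is_series b lb -> (forall n, Rabs (a n) <= b n) ->
  exists l : R, is_series a l /\ Rabs l <= lb.
Proof.
  intros Hb Hle.
  assert (Hex : ex_series a).
  { apply (ex_series_le (V := R_CompleteNormedModule) a b); [exact Hle|now exists lb]. }
  destruct Hex as [l Hl]. exists l; split; [exact Hl|].
  apply Rabs_le; split.
  - apply (is_series_le (fun n => - b n) a); [|exact Hl|].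
    + exact (is_series_opp b lb Hb).
    + intros n. generalize (Hle n); unfold Rabs; destruct Rcase_abs; lra.
  - apply (is_series_le a b); auto.
    intros n. generalize (Hle n); unfold Rabs; destruct Rcase_abs; lra.
Qed.

Lemma is_series_nonneg_dominated (a b : nat -> R) (lb : R) :
  is_series b lb -> (forall n, 0 <= a n <= b n) ->
  exists l : R, is_series a l /\ 0 <= l <= lb.
Proof.
  intros Hb Hle. destruct (is_series_dominated a b lb Hb) as [l [Hl Hl2]].
  - intros n; rewrite Rabs_pos_eq; apply Hle.
  - exists l; split; auto. split.
    + apply (is_series_ge0 a); auto. apply Hle.
    + apply (is_series_le a b); auto. apply Hle.
Qed.

(** Unordered sums of nonnegative families; every way of arranging a double
    family into a series is compared with this one. *)
Section Unordered.
Context {I : Type}.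

Fixpoint lsum (f : I -> R) (l : list I) : R :=
  match l with
  | nil => 0
  | i :: l' => f i + lsum f l'
  end.

Lemma lsum_app (f : I -> R) l l' : lsum f (l ++ l') = lsum f l + lsum f l'.
Proof. induction l as [|i l IH]; simpl; [ring|rewrite IH; ring]. Qed.

Lemma lsum_ge0 (f : I -> R) l : (forall i, 0 <= f i) -> 0 <= lsum f l.
Proof. intros Hf; induction l as [|i l IH]; simpl; [lra|specialize (Hf i); lra]. Qed.

Lemma lsum_incl (f : I -> R) l l' :
  (forall i, 0 <= f i) -> NoDup l -> incl l l' -> lsum f l <= lsum f l'.
Proof.
  intros Hf Hnd. revert l'. induction Hnd as [|i l Hi Hnd IH]; intros l' Hincl; simpl.
  - now apply lsum_ge0.
  - destruct (in_split i l') as [l1 [l2 E]]; [apply Hincl; now left|].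
    rewrite E, lsum_app. simpl.
    assert (lsum f l <= lsum f (l1 ++ l2)).
    { apply IH. intros j Hj. assert (Hj' : In j l') by (apply Hincl; now right).
      rewrite E in Hj'. apply in_app_or in Hj'. apply in_or_app.
      destruct Hj' as [H|[H|H]]; auto. subst j. contradiction. }
    rewrite lsum_app in H. lra.
Qed.

Definition usum (f : I -> R) (S : R) : Prop :=
  (forall l, NoDup l -> lsum f l <= S) /\
  (forall M, (forall l, NoDup l -> lsum f l <= M) -> S <= M).

Definition exhausts (L : nat -> list I) : Prop :=
  (forall n, NoDup (L n)) /\ (forall n, incl (L n) (L (S n))) /\
  (forall i, exists n, In i (L n)).

Lemma exhausts_mono L n m : exhausts L -> (n <= m)%nat -> incl (L n) (L m).
Proof.
  intros [_ [H _]] Hnm. induction Hnm as [|m Hnm IH]; [apply incl_refl|].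
  eapply incl_tran; [exact IH|apply H].
Qed.

Lemma exhausts_incl L l : exhausts L -> exists n, incl l (L n).
Proof.
  intros HL. induction l as [|i l [n Hn]].
  - exists 0%nat. intros i Hi; destruct Hi.
  - destruct HL as [H1 [H2 H3]]. destruct (H3 i) as [k Hk].
    exists (max n k). intros j [<-|Hj].
    + apply (exhausts_mono L k (max n k)); [repeat split; auto|lia|auto].
    + apply (exhausts_mono L n (max n k)); [repeat split; auto|lia|auto].
Qed.

Lemma usum_lim (f : I -> R) (S : R) L :
  (forall i, 0 <= f i) -> exhausts L -> usum f S ->
  is_lim_seq (fun n => lsum f (L n)) S.
Proof.
  intros Hf HL [Hub Hlub]. apply is_lim_seq_spec. intros eps.
  assert (Hex : exists l, NoDup l /\ S - eps < lsum f l).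
  { apply NNPP; intros Hn. assert (S <= S - eps); [|destruct eps; simpl in *; lra].
    apply Hlub. intros l Hl. apply Rnot_lt_le. intros Hlt. apply Hn. now exists l. }
  destruct Hex as [l [Hnd Hl]].
  destruct (exhausts_incl L l HL) as [n0 Hn0].
  exists n0. intros n Hn.
  assert (lsum f l <= lsum f (L n)).
  { apply lsum_incl; auto. eapply incl_tran; [exact Hn0|now apply exhausts_mono]. }
  assert (lsum f (L n) <= S) by (apply Hub, HL).
  apply Rabs_def1; lra.
Qed.

End Unordered.

Lemma lsum_map {I J : Type} (g : I -> J) (f : J -> R) l :
  lsum f (map g l) = lsum (fun i => f (g i)) l.
Proof. induction l as [|i l IH]; simpl; [reflexivity|now rewrite IH]. Qed.

Lemma lsum_seq (f : nat -> R) N : lsum f (seq 0 (S N)) = sum_n f N.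
Proof.
  induction N as [|N IH]; [simpl; rewrite sum_O; ring|].
  rewrite seq_S, lsum_app, IH, sum_Sn. simpl. unfold plus; simpl. ring.
Qed.

Lemma lsum_prod (f : nat * nat -> R) l l' :
  lsum f (list_prod l l') = lsum (fun j => lsum (fun i => f (j, i)) l') l.
Proof.
  induction l as [|j l IH]; simpl; [reflexivity|].
  now rewrite lsum_app, IH, lsum_map.
Qed.

Lemma NoDup_list_prod {I J : Type} (l : list I) (l' : list J) :
  NoDup l -> NoDup l' -> NoDup (list_prod l l').
Proof.
  intros Hl Hl'. induction Hl as [|x l Hx Hl IH]; simpl; [constructor|].
  apply NoDup_app; auto.
  - apply FinFun.Injective_map_NoDup; auto. intros y z E. now injection E.
  - intros [u v] H1 H2. apply in_map_iff in H1. destruct H1 as [y [E _]].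
    injection E as <- <-. apply in_prod_iff in H2. tauto.
Qed.

(** Tonelli: the iterated sum is the unordered one, because every finite set of
    pairs lies in a rectangle and every rectangle sum is below the iterated sum. *)
Lemma usum_of_iterated (a : nat -> nat -> R) (A : nat -> R) (S : R) :
  (forall j i, 0 <= a j i) -> (forall j, is_series (a j) (A j)) -> is_series A S ->
  usum (fun p => a (fst p) (snd p)) S.
Proof.
  intros Hp HA HS.
  assert (HA0 : forall j, 0 <= A j).
  { intros j. apply (is_series_ge0 (a j)); auto. }
  assert (Hrect : forall J N,
    lsum (fun p => a (fst p) (snd p)) (list_prod (seq 0 (1 + J)) (seq 0 (1 + N))) =
    sum_n (fun j => sum_n (a j) N) J).
  { intros J N. rewrite lsum_prod, lsum_seq. apply sum_n_ext. intros j. now rewrite lsum_seq. }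
  assert (Hbox : forall l : list (nat * nat), exists K,
    incl l (list_prod (seq 0 (1 + K)) (seq 0 (1 + K)))).
  { induction l as [|[j i] l [K HK]]; [exists 0%nat; intros x Hx; destruct Hx|].
    exists (K + j + i)%nat. intros [j' i'] [E|Hin].
    - injection E as <- <-. apply in_prod; apply in_seq; lia.
    - specialize (HK _ Hin). apply in_prod_iff in HK. destruct HK as [H1 H2].
      apply in_seq in H1. apply in_seq in H2. apply in_prod; apply in_seq; lia. }
  split.
  - intros l Hl. destruct (Hbox l) as [K HK].
    apply Rle_trans with (sum_n A K); [|now apply sum_n_le_series].
    eapply Rle_trans; [apply (lsum_incl _ l _ (fun p => Hp _ _) Hl HK)|].
    rewrite Hrect.
    assert (Hgen : forall N J, sum_n (fun j => sum_n (a j) N) J <= sum_n A J); [|apply Hgen].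
    clear -HA Hp. intros N J. induction J as [|J IH].
    + rewrite !sum_O. now apply sum_n_le_series.
    + rewrite !sum_Sn. unfold plus; simpl. apply Rplus_le_compat; auto.
      now apply sum_n_le_series.
  - intros M HM. change (Rbar_le S M).
    apply (is_lim_seq_le (sum_n A) (fun _ => M)); [|exact HS|apply is_lim_seq_const].
    intros J. change (Rbar_le (sum_n A J) M).
    apply (is_lim_seq_le (fun N => sum_n (fun j => sum_n (a j) N) J) (fun _ => M));
      [| |apply is_lim_seq_const].
    + intros N. rewrite <- Hrect. apply HM.
      clear. generalize (seq_NoDup (1 + J) 0) (seq_NoDup (1 + N) 0).
      generalize (seq 0 (1 + J)) (seq 0 (1 + N)). intros l l' Hl Hl'.
      now apply NoDup_list_prod.
    + induction J as [|J IH].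
      * rewrite sum_O. eapply is_lim_seq_ext; [|exact (HA 0%nat)].
        intros n; simpl; now rewrite sum_O.
      * rewrite sum_Sn. eapply is_lim_seq_ext.
        { intros n. symmetry. apply sum_Sn. }
        apply (is_lim_seq_plus' _ _ _ _ IH (HA (Datatypes.S J))).
Qed.

Lemma exhausts_cantor :
  exhausts (fun n => map of_nat (seq 0 (1 + n))).
Proof.
  repeat split.
  - intros n. apply FinFun.Injective_map_NoDup; [|apply seq_NoDup].
    intros x y. apply of_nat_inj.
  - intros n p Hp. apply in_map_iff in Hp. destruct Hp as [k [<- Hk]].
    apply in_map. apply in_seq in Hk. apply in_seq. lia.
  - intros p. exists (to_nat p). rewrite <- (cancel_of_to p) at 1.
    apply in_map, in_seq. lia.
Qed.

Lemma is_series_cantor_pos (f : nat * nat -> R) (S : R) :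
  (forall p, 0 <= f p) -> usum f S -> is_series (fun n => f (of_nat n)) S.
Proof.
  intros Hf HS.
  assert (H := usum_lim f S _ Hf exhausts_cantor HS).
  unfold is_series. eapply filterlim_ext; [|exact H].
  intros n. cbv beta. now rewrite lsum_map, lsum_seq.
Qed.

Lemma iterated_of_usum (a : nat -> nat -> R) (S : R) :
  (forall j i, 0 <= a j i) -> usum (fun p => a (fst p) (snd p)) S ->
  exists A : nat -> R, (forall j, is_series (a j) (A j)) /\ is_series A S.
Proof.
  intros Hp HS.
  assert (Hrow : forall j, exists l : R, is_series (a j) l /\ l <= S).
  { intros j. apply is_series_bounded; auto. intros N.
    destruct HS as [H _].
    specialize (H (map (fun i => (j, i)) (seq 0 (1 + N)))).
    rewrite lsum_map, lsum_seq in H. apply H.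
    apply FinFun.Injective_map_NoDup; [|apply seq_NoDup].
    intros x y E. now injection E. }
  destruct (functional_choice _ Hrow) as [A HA].
  exists A. split; [apply HA|].
  assert (Hex : exists S', is_series A S' /\ S' <= S).
  { apply is_series_bounded.
    - intros j. apply (is_series_ge0 (a j)); auto. apply HA.
    - intros J. change (Rbar_le (sum_n A J) S).
      apply (is_lim_seq_le (fun N => sum_n (fun j => sum_n (a j) N) J) (fun _ => S));
        [| |apply is_lim_seq_const].
      + intros N.
        replace (sum_n (fun j => sum_n (a j) N) J) with
          (lsum (fun p => a (fst p) (snd p)) (list_prod (seq 0 (1 + J)) (seq 0 (1 + N)))).
        * apply HS. apply NoDup_list_prod; apply seq_NoDup.
        * rewrite lsum_prod, lsum_seq. apply sum_n_ext. intros j. now rewrite lsum_seq.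
      + induction J as [|J IH].
        * rewrite sum_O. eapply is_lim_seq_ext; [|exact (proj1 (HA 0%nat))].
          intros n; simpl; now rewrite sum_O.
        * rewrite sum_Sn. eapply is_lim_seq_ext.
          { intros n. symmetry. apply sum_Sn. }
          apply (is_lim_seq_plus' _ _ _ _ IH (proj1 (HA (Datatypes.S J)))). }
  destruct Hex as [S' [HS' _]].
  assert (HU := usum_of_iterated a A S' Hp (fun j => proj1 (HA j)) HS').
  replace S with S'; auto.
  apply Rle_antisym; [apply HU; apply HS|apply HS; apply HU].
Qed.

Lemma usum_swap (a : nat -> nat -> R) (S : R) :
  usum (fun p => a (fst p) (snd p)) S -> usum (fun p => a (snd p) (fst p)) S.
Proof.
  set (sw := fun p : nat * nat => (snd p, fst p)).
  assert (Hsw : forall (a : nat -> nat -> R) l,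
    lsum (fun p => a (snd p) (fst p)) l = lsum (fun p => a (fst p) (snd p)) (map sw l)).
  { intros b l. now rewrite lsum_map. }
  assert (Hnd : forall l, NoDup l -> NoDup (map sw l)).
  { intros l. apply FinFun.Injective_map_NoDup. intros [x y] [x' y'] E.
    unfold sw in E; simpl in E. injection E as -> ->. reflexivity. }
  intros [H1 H2]. split.
  - intros l Hl. rewrite Hsw. auto.
  - intros M HM. apply H2. intros l Hl.
    specialize (HM (map sw l) (Hnd _ Hl)). rewrite Hsw, map_map in HM.
    replace (map (fun x => sw (sw x)) l) with l in HM; auto.
    clear. induction l as [|[x y] l IH]; simpl; [reflexivity|now rewrite <- IH].
Qed.

Definition pos_part (x : R) := Rmax x 0.
Definition neg_part (x : R) := Rmax (- x) 0.

Lemma pos_neg_part x :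
  x = pos_part x - neg_part x /\ 0 <= pos_part x <= Rabs x /\ 0 <= neg_part x <= Rabs x.
Proof.
  unfold pos_part, neg_part, Rmax, Rabs.
  destruct Rle_dec, Rle_dec, Rcase_abs; lra.
Qed.

Section Absolute.
Context (a N : nat -> nat -> R) (A B : nat -> R) (S T : R).
Context (Hdom : forall j i, Rabs (a j i) <= N j i).
Context (HB : forall j, is_series (N j) (B j)) (HT : is_series B T).
Context (HA : forall j, is_series (a j) (A j)) (HS : is_series A S).

Let part_sum (part : R -> R) :
  (forall x, 0 <= part x <= Rabs x) ->
  exists (P : nat -> R) (SP : R),
    (forall j, is_series (fun i => part (a j i)) (P j)) /\ is_series P SP.
Proof.
  intros Hpart.
  assert (Hrow : forall j, exists l : R, is_series (fun i => part (a j i)) l /\ 0 <= l <= B j).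
  { intros j. apply (is_series_nonneg_dominated _ (N j)); auto.
    intros i. specialize (Hpart (a j i)). specialize (Hdom j i). lra. }
  destruct (functional_choice _ Hrow) as [P HP].
  destruct (is_series_nonneg_dominated P B T HT) as [SP [HSP _]]; [apply HP|].
  exists P, SP. split; auto. apply HP.
Qed.

Let signed_usum :
  exists SP SQ, usum (fun p => pos_part (a (fst p) (snd p))) SP /\
    usum (fun p => neg_part (a (fst p) (snd p))) SQ /\ SP - SQ = S.
Proof.
  destruct (part_sum pos_part (fun x => proj1 (proj2 (pos_neg_part x)))) as [P [SP [HP HSP]]].
  destruct (part_sum neg_part (fun x => proj2 (proj2 (pos_neg_part x)))) as [Q [SQ [HQ HSQ]]].
  exists SP, SQ. split; [|split].
  - apply (usum_of_iterated (fun j i => pos_part (a j i)) P); auto. intros; apply pos_neg_part.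
  - apply (usum_of_iterated (fun j i => neg_part (a j i)) Q); auto. intros; apply pos_neg_part.
  - apply (is_series_inj A); auto.
    apply (is_series_eq (fun j => P j - Q j) _ (SP - SQ)); auto; [now apply is_series_Rminus|].
    intros j. apply (is_series_inj (a j)); auto.
    apply (is_series_eq (fun i => pos_part (a j i) - neg_part (a j i)) _ (P j - Q j)); auto.
    + now apply is_series_Rminus.
    + intros i. symmetry. apply pos_neg_part.
Qed.

(** Fubini for absolutely summable double families, enumerated along the Cantor pairing. *)
Lemma is_series_cantor :
  is_series (fun n => a (fst (of_nat n)) (snd (of_nat n))) S.
Proof.
  destruct signed_usum as (SP & SQ & HP & HQ & E).
  apply (is_series_eq _ _ _ _ (is_series_Rminus _ _ _ _
    (is_series_cantor_pos _ _ (fun p => proj1 (proj1 (proj2 (pos_neg_part _)))) HP)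
    (is_series_cantor_pos _ _ (fun p => proj1 (proj2 (proj2 (pos_neg_part _)))) HQ))); auto.
  intros n. symmetry. apply pos_neg_part.
Qed.

Lemma is_series_swap :
  exists C : nat -> R, (forall i, is_series (fun j => a j i) (C i)) /\ is_series C S.
Proof.
  destruct signed_usum as (SP & SQ & HP & HQ & E).
  destruct (iterated_of_usum (fun i j => pos_part (a j i)) SP) as [P [HP1 HP2]];
    [intros; apply pos_neg_part|exact (usum_swap (fun j i => pos_part (a j i)) SP HP)|].
  destruct (iterated_of_usum (fun i j => neg_part (a j i)) SQ) as [Q [HQ1 HQ2]];
    [intros; apply pos_neg_part|exact (usum_swap (fun j i => neg_part (a j i)) SQ HQ)|].
  exists (fun i => P i - Q i). split.
  - intros i. apply (is_series_eq _ _ _ _ (is_series_Rminus _ _ _ _ (HP1 i) (HQ1 i))); auto.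
    intros j. symmetry. apply pos_neg_part.
  - rewrite <- E. now apply is_series_Rminus.
Qed.

End Absolute.

(** Diagonal grouping, the arrangement used for power series in two variables. *)
Definition diag (a : nat -> nat -> R) (n i : nat) : R :=
  if Nat.leb i n then a i (n - i)%nat else 0.

Lemma is_series_finite (b : nat -> R) (N : nat) :
  (forall n, (N < n)%nat -> b n = 0) -> is_series b (sum_n b N).
Proof.
  intros Hb. unfold is_series.
  apply (filterlim_ext_loc (fun _ => sum_n b N)); [|apply filterlim_const].
  exists N. intros n Hn. induction Hn as [|n Hn IH]; [reflexivity|].
  rewrite sum_Sn, <- IH, (Hb (S n)) by lia. symmetry. exact (Rplus_0_r _).
Qed.

Lemma diag_row (a : nat -> nat -> R) n :
  is_series (diag a n) (sum_n (fun j => a j (n - j)%nat) n).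
Proof.
  replace (sum_n (fun j => a j (n - j)%nat) n) with (sum_n (diag a n) n).
  - apply is_series_finite. intros k Hk. unfold diag.
    destruct (Nat.leb_spec k n); [lia|reflexivity].
  - apply sum_n_ext_loc. intros k Hk. unfold diag.
    destruct (Nat.leb_spec k n); [reflexivity|lia].
Qed.

(** * The algebra of absolutely convergent trigonometric series *)

Record atom := Atom { amp : R; tdeg : nat; edeg : nat; freq : nat; phase : R }.

(** One frequency and one phase, rather than a sine and a cosine or a complex exponential, make
    products, shifts and derivatives of atoms real atoms again. *)
Definition ev (a : atom) (t e x : R) : R :=
  amp a * (t ^ tdeg a * e ^ edeg a * cos (INR (freq a) * x + phase a)).

Definition wt (tau rho sigma : R) (a : atom) : R :=
  Rabs (amp a) * (tau ^ tdeg a * rho ^ edeg a * exp (sigma * INR (freq a))).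

(** [W tau rho sigma M u] says that [u] has weighted norm at most [M].  Atoms may be
    repeated in the decomposition, so that the product of two decompositions, or a
    countable sum of decompositions, is again a decomposition after listing pairs. *)
Definition W (tau rho sigma M : R) (u : R -> R -> R -> R) : Prop :=
  0 <= tau /\ 0 <= rho /\ 0 <= sigma /\
  exists (s : nat -> atom) (l : R),
    is_series (fun i => wt tau rho sigma (s i)) l /\ l <= M /\
    forall t e x, Rabs t <= tau -> Rabs e <= rho ->
      is_series (fun i => ev (s i) t e x) (u t e x).

Lemma exp_ge1 x : 0 <= x -> 1 <= exp x.
Proof.
  intros [Hx|<-]; [left; rewrite <- exp_0; now apply exp_increasing|rewrite exp_0; lra].
Qed.

Lemma exp_le x y : x <= y -> exp x <= exp y.
Proof. intros [H|<-]; [left; now apply exp_increasing|lra]. Qed.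

Lemma Rmult_le_compat3 a b c a' b' c' :
  0 <= a <= a' -> 0 <= b <= b' -> 0 <= c <= c' -> 0 <= a * b * c <= a' * b' * c'.
Proof.
  intros Ha Hb Hc.
  assert (0 <= a * b <= a' * b').
  { split; [apply Rmult_le_pos; lra|apply Rmult_le_compat; lra]. }
  split; [apply Rmult_le_pos; lra|apply Rmult_le_compat; lra].
Qed.

Lemma wt_ge0 tau rho sigma a : 0 <= tau -> 0 <= rho -> 0 <= wt tau rho sigma a.
Proof.
  intros Ht Hr. unfold wt.
  repeat apply Rmult_le_pos; try apply pow_le; auto using Rabs_pos.
  left; apply exp_pos.
Qed.

Lemma wt_mono tau rho sigma tau' rho' sigma' a :
  0 <= tau' <= tau -> 0 <= rho' <= rho -> sigma' <= sigma ->
  wt tau' rho' sigma' a <= wt tau rho sigma a.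
Proof.
  intros Ht Hr Hs. unfold wt. apply Rmult_le_compat_l; [apply Rabs_pos|].
  apply Rmult_le_compat3.
  - split; [apply pow_le; lra|apply pow_incr; lra].
  - split; [apply pow_le; lra|apply pow_incr; lra].
  - split; [left; apply exp_pos|]. apply exp_le, Rmult_le_compat_r; auto using pos_INR.
Qed.

Lemma ev_le_wt tau rho sigma a t e x :
  0 <= sigma -> Rabs t <= tau -> Rabs e <= rho -> Rabs (ev a t e x) <= wt tau rho sigma a.
Proof.
  intros Hs Ht He. unfold ev, wt. rewrite Rabs_mult.
  apply Rmult_le_compat_l; [apply Rabs_pos|].
  rewrite !Rabs_mult, <- !RPow_abs.
  apply Rmult_le_compat3.
  - split; [apply pow_le, Rabs_pos|apply pow_incr; split; auto using Rabs_pos].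
  - split; [apply pow_le, Rabs_pos|apply pow_incr; split; auto using Rabs_pos].
  - split; [apply Rabs_pos|]. apply Rle_trans with 1.
    + apply Rabs_le, COS_bound.
    + apply exp_ge1, Rmult_le_pos; auto using pos_INR.
Qed.

Lemma W_pos tau rho sigma M u :
  W tau rho sigma M u -> 0 <= tau /\ 0 <= rho /\ 0 <= sigma /\ 0 <= M.
Proof.
  intros (Ht & Hr & Hs & s & l & Hl & HlM & _). repeat split; auto.
  apply Rle_trans with l; auto.
  apply (is_series_ge0 _ _ Hl). intros; now apply wt_ge0.
Qed.

Lemma W_le tau rho sigma M M' u : W tau rho sigma M u -> M <= M' -> W tau rho sigma M' u.
Proof.
  intros (Ht & Hr & Hs & s & l & Hl & HlM & Hu) HM.
  repeat split; auto. exists s, l. repeat split; auto; lra.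
Qed.

Lemma W_ext tau rho sigma M u v :
  W tau rho sigma M u ->
  (forall t e x, Rabs t <= tau -> Rabs e <= rho -> u t e x = v t e x) ->
  W tau rho sigma M v.
Proof.
  intros (Ht & Hr & Hs & s & l & Hl & HlM & Hu) E.
  repeat split; auto. exists s, l. repeat split; auto.
  intros t e x H1 H2. rewrite <- E; auto.
Qed.

Lemma W_bound tau rho sigma M u t e x :
  W tau rho sigma M u -> Rabs t <= tau -> Rabs e <= rho -> Rabs (u t e x) <= M.
Proof.
  intros (Ht & Hr & Hs & s & l & Hl & HlM & Hu) H1 H2.
  destruct (is_series_dominated (fun i => ev (s i) t e x) _ l Hl) as [l' [Hl' Hb]].
  - intros n. now apply ev_le_wt.
  - rewrite (is_series_inj _ _ _ (Hu t e x H1 H2) Hl'). lra.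
Qed.

(** Derivatives, projections and divisions by small divisors are defined atom by atom.
    Decompositions are not unique, so that such an operator has no value on a function: it
    is applied to one decomposition, and all that is kept is the existence of the result. *)
Lemma atoms_map tau rho sigma tau' rho' sigma' K (m : atom -> atom) (s : nat -> atom) l :
  0 <= tau' -> 0 <= rho' -> 0 <= sigma' ->
  (forall i, wt tau' rho' sigma' (m (s i)) <= K * wt tau rho sigma (s i)) ->
  is_series (fun i => wt tau rho sigma (s i)) l ->
  exists v, W tau' rho' sigma' (K * l) v /\
    forall t e x, Rabs t <= tau' -> Rabs e <= rho' ->
      is_series (fun i => ev (m (s i)) t e x) (v t e x).
Proof.
  intros Ht Hr Hs HK Hl.
  assert (HKl := is_series_Rmult K _ _ Hl).
  destruct (is_series_nonneg_dominated (fun i => wt tau' rho' sigma' (m (s i))) _ _ HKl)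
    as [l' [Hl' Hb]].
  { intros n; split; [now apply wt_ge0|apply HK]. }
  assert (Hv : forall t e x, Rabs t <= tau' -> Rabs e <= rho' ->
    is_series (fun i => ev (m (s i)) t e x) (Series (fun i => ev (m (s i)) t e x))).
  { intros t e x H1 H2. apply Series_correct.
    destruct (is_series_dominated (fun i => ev (m (s i)) t e x) _ _ Hl') as [y [Hy _]].
    - intros n. now apply ev_le_wt.
    - now exists y. }
  exists (fun t e x => Series (fun i => ev (m (s i)) t e x)). split; auto.
  repeat split; auto. exists (fun i => m (s i)), l'. repeat split; auto. lra.
Qed.

Lemma W_weaken tau rho sigma tau' rho' sigma' M u :
  W tau rho sigma M u -> 0 <= tau' <= tau -> 0 <= rho' <= rho -> 0 <= sigma' <= sigma ->
  W tau' rho' sigma' M u.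
Proof.
  intros (Ht & Hr & Hs & s & l & Hl & HlM & Hu) H1 H2 H3.
  destruct (is_series_nonneg_dominated (fun i => wt tau' rho' sigma' (s i)) _ _ Hl)
    as [l' [Hl' Hb]].
  { intros n; split; [apply wt_ge0; lra|apply wt_mono; lra]. }
  repeat split; try lra. exists s, l'. repeat split; auto; [lra|].
  intros; apply Hu; lra.
Qed.

Lemma wt_amp0 tau rho sigma l n k p : wt tau rho sigma (Atom 0 l n k p) = 0.
Proof. unfold wt; simpl. rewrite Rabs_R0. ring. Qed.

Lemma W_atom tau rho sigma a :
  0 <= tau -> 0 <= rho -> 0 <= sigma -> W tau rho sigma (wt tau rho sigma a) (ev a).
Proof.
  intros Ht Hr Hs. repeat split; auto.
  exists (fun i => match i with O => a | _ => Atom 0 0 0 0 0 end), (wt tau rho sigma a).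
  repeat split; [|lra|].
  - match goal with |- is_series ?b _ =>
      apply (is_series_eq b _ (sum_n b 0)); auto; [apply is_series_finite|now rewrite sum_O]
    end.
    intros [|n] Hn; [lia|]. apply wt_amp0.
  - intros t e x _ _.
    match goal with |- is_series ?b _ =>
      apply (is_series_eq b _ (sum_n b 0)); auto; [apply is_series_finite|now rewrite sum_O]
    end.
    intros [|n] Hn; [lia|]. unfold ev; simpl. ring.
Qed.

(** The algebra is complete, and this is the one place where decompositions are chosen and
    listed along a pairing; sums, products, inverses and compositions all reduce to it. *)
Lemma W_sum tau rho sigma (M : nat -> R) (S S' : R) (u : nat -> R -> R -> R -> R)
    (v : R -> R -> R -> R) :
  (forall j, W tau rho sigma (M j) (u j)) -> is_series M S -> S <= S' ->
  (forall t e x, Rabs t <= tau -> Rabs e <= rho ->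
     is_series (fun j => u j t e x) (v t e x)) ->
  W tau rho sigma S' v.
Proof.
  intros Hu HM HSS Hv.
  destruct (Hu 0%nat) as (Ht & Hr & Hs & _).
  assert (Hrep : forall j, exists s : nat -> atom, exists l : R,
    is_series (fun i => wt tau rho sigma (s i)) l /\ l <= M j /\
    forall t e x, Rabs t <= tau -> Rabs e <= rho ->
      is_series (fun i => ev (s i) t e x) (u j t e x)).
  { intros j. destruct (Hu j) as (_ & _ & _ & s & l & H). now exists s, l. }
  apply functional_choice in Hrep. destruct Hrep as [s Hrep].
  apply functional_choice in Hrep. destruct Hrep as [l Hrep].
  assert (Hw0 : forall a, 0 <= wt tau rho sigma a) by (intros; now apply wt_ge0).
  assert (Hl0 : forall j, 0 <= l j).
  { intros j. apply (is_series_ge0 _ _ (proj1 (Hrep j))). auto. }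
  destruct (is_series_nonneg_dominated l M S HM) as [L [HL HLS]].
  { intros j; split; auto. apply Hrep. }
  repeat split; auto.
  exists (fun n => s (fst (of_nat n)) (snd (of_nat n))), L.
  repeat split; [|lra|].
  - apply (is_series_cantor (fun j i => wt tau rho sigma (s j i))
      (fun j i => wt tau rho sigma (s j i)) l l L L); auto;
      try (intros j; apply Hrep).
    intros j i. rewrite Rabs_pos_eq; auto; lra.
  - intros t e x H1 H2.
    apply (is_series_cantor (fun j i => ev (s j i) t e x)
      (fun j i => wt tau rho sigma (s j i)) (fun j => u j t e x) l (v t e x) L); auto;
      try (intros j; apply Hrep; auto).
    intros j i. now apply ev_le_wt.
Qed.

Lemma is_series_pair (x y : R) :
  is_series (fun j : nat => match j with O => x | S O => y | _ => 0 end) (x + y).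
Proof.
  match goal with |- is_series ?b _ => apply (is_series_eq b _ (sum_n b 1)); auto end.
  - apply is_series_finite. intros [|[|n]] Hn; try lia. reflexivity.
  - rewrite sum_Sn, sum_O. reflexivity.
Qed.

Lemma W_zero tau rho sigma :
  0 <= tau -> 0 <= rho -> 0 <= sigma -> W tau rho sigma 0 (fun _ _ _ => 0).
Proof.
  intros Ht Hr Hs. apply (W_ext _ _ _ _ (ev (Atom 0 0 0 0 0))).
  - eapply W_le; [now apply W_atom|rewrite wt_amp0; lra].
  - intros; unfold ev; simpl; ring.
Qed.

Lemma W_add tau rho sigma M N u v :
  W tau rho sigma M u -> W tau rho sigma N v ->
  W tau rho sigma (M + N) (fun t e x => u t e x + v t e x).
Proof.
  intros Hu Hv. destruct (W_pos _ _ _ _ _ Hu) as (Ht & Hr & Hs & _).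
  apply (W_sum tau rho sigma (fun j => match j with O => M | S O => N | _ => 0 end) (M + N) _
    (fun j => match j with O => u | S O => v | _ => fun _ _ _ => 0 end)).
  - intros [|[|j]]; auto. now apply W_zero.
  - apply is_series_pair.
  - lra.
  - intros t e x _ _. apply (is_series_eq _ _ _ _ (is_series_pair (u t e x) (v t e x))); auto.
    intros [|[|n]]; reflexivity.
Qed.

Lemma W_scal tau rho sigma M c u :
  W tau rho sigma M u -> W tau rho sigma (Rabs c * M) (fun t e x => c * u t e x).
Proof.
  intros (Ht & Hr & Hs & s & l & Hl & HlM & Hu).
  destruct (atoms_map tau rho sigma tau rho sigma (Rabs c)
    (fun a => Atom (c * amp a) (tdeg a) (edeg a) (freq a) (phase a)) s l) as [v [Hv1 Hv2]]; auto.
  { intros i. unfold wt; simpl. rewrite Rabs_mult. right; ring. }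
  apply (W_ext _ _ _ _ v).
  - apply (W_le _ _ _ _ _ _ Hv1). apply Rmult_le_compat_l; auto using Rabs_pos.
  - intros t e x H1 H2. apply (is_series_inj _ _ _ (Hv2 t e x H1 H2)).
    apply (is_series_eq _ _ _ _ (is_series_Rmult c _ _ (Hu t e x H1 H2))); auto.
    intros n. unfold ev; simpl. ring.
Qed.

Lemma W_opp tau rho sigma M u :
  W tau rho sigma M u -> W tau rho sigma M (fun t e x => - u t e x).
Proof.
  intros Hu. apply (W_ext _ _ _ _ (fun t e x => -1 * u t e x)).
  - apply (W_le _ _ _ (Rabs (-1) * M)); [now apply W_scal|].
    rewrite Rabs_left by lra. lra.
  - intros; ring.
Qed.

Lemma W_sub tau rho sigma M N u v :
  W tau rho sigma M u -> W tau rho sigma N v ->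
  W tau rho sigma (M + N) (fun t e x => u t e x - v t e x).
Proof. intros Hu Hv. apply W_add; auto. now apply W_opp. Qed.

(** The product of two cosines has the frequencies [k + l] and [|k - l|], both at most [k + l],
    each with half of the amplitude: the weights are submultiplicative. *)
Lemma W_atom_mul tau rho sigma a b :
  0 <= tau -> 0 <= rho -> 0 <= sigma ->
  W tau rho sigma (wt tau rho sigma a * wt tau rho sigma b)
    (fun t e x => ev a t e x * ev b t e x).
Proof.
  intros Ht Hr Hs.
  set (k1 := (freq a + freq b)%nat).
  set (k2 := (Nat.max (freq a) (freq b) - Nat.min (freq a) (freq b))%nat).
  set (p2 := if Nat.leb (freq b) (freq a) then phase a - phase b else phase b - phase a).
  set (c := amp a * amp b / 2).
  set (m k p := Atom c (tdeg a + tdeg b) (edeg a + edeg b) k p).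
  apply (W_ext _ _ _ _ (fun t e x => ev (m k1 (phase a + phase b)) t e x + ev (m k2 p2) t e x)).
  - assert (Hm : forall k p, (k <= k1)%nat ->
      wt tau rho sigma (m k p) <= wt tau rho sigma a * wt tau rho sigma b / 2).
    { intros k p Hk. unfold wt, m, c; simpl. unfold Rdiv.
      rewrite !Rabs_mult, (Rabs_pos_eq (/ 2)), !pow_add by lra.
      apply Rle_trans with (Rabs (amp a) * Rabs (amp b) * / 2 *
        (tau ^ tdeg a * tau ^ tdeg b * (rho ^ edeg a * rho ^ edeg b) *
         (exp (sigma * INR (freq a)) * exp (sigma * INR (freq b))))).
      2: right; ring.
      apply Rmult_le_compat_l.
      { repeat apply Rmult_le_pos; auto using Rabs_pos; lra. }
      apply Rmult_le_compat_l.
      { repeat apply Rmult_le_pos; auto using pow_le. }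
      rewrite <- exp_plus. apply exp_le. rewrite <- Rmult_plus_distr_l, <- plus_INR.
      apply Rmult_le_compat_l; auto. now apply le_INR. }
    eapply W_le; [apply W_add; apply W_atom; auto|].
    assert (H1 := Hm k1 (phase a + phase b) (le_n _)).
    assert (Hk : (k2 <= k1)%nat) by (unfold k2, k1; lia).
    assert (H2 := Hm k2 p2 Hk). lra.
  - intros t e x _ _. unfold ev, m, c; simpl. rewrite !pow_add.
    assert (Hc : cos (INR k1 * x + (phase a + phase b)) + cos (INR k2 * x + p2) =
      2 * (cos (INR (freq a) * x + phase a) * cos (INR (freq b) * x + phase b))).
    { set (A := INR (freq a) * x + phase a). set (B := INR (freq b) * x + phase b).
      replace (INR k1 * x + (phase a + phase b)) with (A + B)
        by (unfold k1, A, B; rewrite plus_INR; ring).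
      replace (cos (INR k2 * x + p2)) with (cos (A - B)).
      - rewrite cos_plus, cos_minus. ring.
      - unfold k2, p2. destruct (Nat.leb_spec (freq b) (freq a)).
        + rewrite Nat.max_l, Nat.min_r, minus_INR by lia. f_equal. unfold A, B; ring.
        + rewrite Nat.max_r, Nat.min_l, minus_INR by lia.
          rewrite <- cos_neg. f_equal. unfold A, B; ring. }
    rewrite <- Rmult_plus_distr_l, <- Rmult_plus_distr_l.
    rewrite Hc. field.
Qed.

Lemma W_mul tau rho sigma M N u v :
  W tau rho sigma M u -> W tau rho sigma N v ->
  W tau rho sigma (M * N) (fun t e x => u t e x * v t e x).
Proof.
  intros (Ht & Hr & Hs & s & l & Hl & HlM & Hu) (_ & _ & _ & s' & l' & Hl' & HlM' & Hv).
  assert (H0 : 0 <= l) by (apply (is_series_ge0 _ _ Hl); intros; now apply wt_ge0).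
  assert (H0' : 0 <= l') by (apply (is_series_ge0 _ _ Hl'); intros; now apply wt_ge0).
  apply (W_le _ _ _ (l' * l)); [|rewrite Rmult_comm; now apply Rmult_le_compat].
  assert (Hrow : forall i, W tau rho sigma (wt tau rho sigma (s i) * l')
    (fun t e x => ev (s i) t e x * v t e x)).
  { intros i.
    apply (W_sum tau rho sigma (fun j => wt tau rho sigma (s i) * wt tau rho sigma (s' j))
      (wt tau rho sigma (s i) * l') _ (fun j t e x => ev (s i) t e x * ev (s' j) t e x)).
    - intros j. now apply W_atom_mul.
    - now apply is_series_Rmult.
    - lra.
    - intros t e x H1 H2. now apply is_series_Rmult, Hv. }
  apply (W_sum tau rho sigma _ (l' * l) _ _ _ Hrow).
  - apply (is_series_eq _ _ _ _ (is_series_Rmult l' _ _ Hl)); auto. intros n; simpl; ring.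
  - lra.
  - intros t e x H1 H2.
    apply (is_series_eq _ _ _ _ (is_series_Rmult (v t e x) _ _ (Hu t e x H1 H2))).
    + intros n; simpl; ring.
    + ring.
Qed.

Lemma W_monomial tau rho sigma c l n :
  0 <= tau -> 0 <= rho -> 0 <= sigma ->
  W tau rho sigma (Rabs c * (tau ^ l * rho ^ n)) (fun t e _ => c * (t ^ l * e ^ n)).
Proof.
  intros Ht Hr Hs. apply (W_ext _ _ _ _ (ev (Atom c l n 0 0))).
  - eapply W_le; [now apply W_atom|]. unfold wt; simpl. rewrite Rmult_0_r, exp_0. lra.
  - intros; unfold ev; simpl. rewrite Rmult_0_l, Rplus_0_r, cos_0. ring.
Qed.

Lemma W_const tau rho sigma c :
  0 <= tau -> 0 <= rho -> 0 <= sigma -> W tau rho sigma (Rabs c) (fun _ _ _ => c).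
Proof.
  intros Ht Hr Hs. apply (W_ext _ _ _ _ (fun t e _ => c * (t ^ 0 * e ^ 0))); [|intros; simpl; ring].
  eapply W_le; [now apply W_monomial|simpl; lra].
Qed.

Lemma W_t tau rho sigma :
  0 <= tau -> 0 <= rho -> 0 <= sigma -> W tau rho sigma tau (fun t _ _ => t).
Proof.
  intros Ht Hr Hs. apply (W_ext _ _ _ _ (fun t e _ => 1 * (t ^ 1 * e ^ 0))); [|intros; simpl; ring].
  eapply W_le; [now apply W_monomial|rewrite Rabs_R1; simpl; lra].
Qed.

Lemma W_e tau rho sigma :
  0 <= tau -> 0 <= rho -> 0 <= sigma -> W tau rho sigma rho (fun _ e _ => e).
Proof.
  intros Ht Hr Hs. apply (W_ext _ _ _ _ (fun t e _ => 1 * (t ^ 0 * e ^ 1))); [|intros; simpl; ring].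
  eapply W_le; [now apply W_monomial|rewrite Rabs_R1; simpl; lra].
Qed.

Lemma W_pow tau rho sigma M u n :
  W tau rho sigma M u -> W tau rho sigma (M ^ n) (fun t e x => u t e x ^ n).
Proof.
  intros Hu. destruct (W_pos _ _ _ _ _ Hu) as (Ht & Hr & Hs & _).
  induction n as [|n IH]; simpl.
  - rewrite <- Rabs_R1 at 1. now apply W_const.
  - now apply W_mul.
Qed.

(** Neumann series. *)
Lemma W_inv tau rho sigma M u :
  W tau rho sigma M u -> M < 1 -> W tau rho sigma (/ (1 - M)) (fun t e x => / (1 + u t e x)).
Proof.
  intros Hu HM. destruct (W_pos _ _ _ _ _ Hu) as (Ht & Hr & Hs & HM0).
  apply (W_sum tau rho sigma (fun n => M ^ n) (/ (1 - M)) _ (fun n t e x => (- u t e x) ^ n)).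
  - intros n. apply W_pow. now apply W_opp.
  - apply is_series_geom. rewrite Rabs_pos_eq; auto.
  - lra.
  - intros t e x H1 H2.
    replace (1 + u t e x) with (1 - - u t e x) by ring.
    apply is_series_geom. rewrite Rabs_Ropp.
    apply Rle_lt_trans with M; auto. eapply W_bound; eauto.
Qed.

Lemma W_shift tau rho sigma M u c :
  W tau rho sigma M u -> W tau rho sigma M (fun t e x => u t e (x + c)).
Proof.
  intros (Ht & Hr & Hs & s & l & Hl & HlM & Hu).
  repeat split; auto.
  exists (fun i => Atom (amp (s i)) (tdeg (s i)) (edeg (s i)) (freq (s i))
    (phase (s i) + INR (freq (s i)) * c)), l.
  repeat split; auto.
  intros t e x H1 H2. apply (is_series_eq _ _ _ _ (Hu t e (x + c) H1 H2)); auto.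
  intros n. unfold ev; simpl. do 2 f_equal. f_equal. ring.
Qed.

Lemma cos_period_INR k x p : cos (INR k * (x + 2 * PI) + p) = cos (INR k * x + p).
Proof.
  rewrite <- (cos_period (INR k * x + p) k). f_equal. ring.
Qed.

Lemma W_periodic tau rho sigma M u t e x :
  W tau rho sigma M u -> Rabs t <= tau -> Rabs e <= rho -> u t e (x + 2 * PI) = u t e x.
Proof.
  intros (Ht & Hr & Hs & s & l & Hl & HlM & Hu) H1 H2.
  apply (is_series_inj _ _ _ (Hu t e (x + 2 * PI) H1 H2)).
  apply (is_series_eq _ _ _ _ (Hu t e x H1 H2)); auto.
  intros n. unfold ev. now rewrite cos_period_INR.
Qed.

(** * Differentiation *)

Lemma mul_exp_neg_le d k : 0 < d -> 0 <= k -> k * exp (- (d * k)) <= / d.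
Proof.
  intros Hd Hk.
  assert (Hdk : 0 <= d * k) by (apply Rmult_le_pos; lra).
  assert (H1 : d * k <= exp (d * k)).
  { pose proof (exp_ineq1_le (d * k)). lra. }
  rewrite exp_Ropp. assert (He := exp_pos (d * k)).
  apply Rmult_le_reg_r with (exp (d * k)); auto.
  rewrite Rmult_assoc, Rinv_l, Rmult_1_r by lra.
  apply Rmult_le_reg_l with d; auto.
  rewrite <- Rmult_assoc, Rinv_r, Rmult_1_l by lra. exact H1.
Qed.

Lemma derive_remainder_le (f f' f'' : R -> R) (B x s : R) :
  (forall y, is_derive f y (f' y)) -> (forall y, is_derive f' y (f'' y)) ->
  (forall y, Rabs (f'' y) <= B) ->
  Rabs (f (x + s) - f x - s * f' x) <= B * s ^ 2.
Proof.
  intros Hf Hf' HB.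
  assert (HB0 : 0 <= B) by (eapply Rle_trans; [apply Rabs_pos|apply (HB 0)]).
  destruct (MVT_gen (fun y => f y - (y - x) * f' x) x (x + s) (fun y => f' y - f' x))
    as [c [Hc Ec]].
  { intros y _. apply (is_derive_minus f (fun y => (y - x) * f' x) y (f' y) (f' x)); auto.
    auto_derive; auto. ring. }
  { intros y _. apply (continuity_pt_minus f (fun y => (y - x) * f' x)).
    - apply derivable_continuous_pt. exists (f' y). apply is_derive_Reals, Hf.
    - reg. }
  destruct (MVT_gen f' x c f'') as [d [Hd Ed]].
  { intros y _. apply Hf'. }
  { intros y _. apply derivable_continuous_pt. exists (f'' y). apply is_derive_Reals, Hf'. }
  replace (f (x + s) - f x - s * f' x) with ((f'' d * (c - x)) * s).
  - rewrite !Rabs_mult. rewrite <- (pow2_abs s). simpl. rewrite Rmult_1_r, <- Rmult_assoc.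
    apply Rmult_le_compat_r; [apply Rabs_pos|].
    apply Rmult_le_compat; auto using Rabs_pos.
    unfold Rmin, Rmax in Hc. apply Rabs_le.
    unfold Rabs; destruct Rcase_abs; destruct Rle_dec; lra.
  - rewrite <- Ed. replace ((f' c - f' x) * s) with ((f' c - f' x) * (x + s - x)) by ring.
    rewrite <- Ec. ring.
Qed.

Lemma cos_remainder k p x s :
  Rabs (cos (k * (x + s) + p) - cos (k * x + p) - s * (k * cos (k * x + p + PI / 2)))
  <= k ^ 2 * s ^ 2.
Proof.
  assert (Hs : forall y, cos (y + PI / 2) = - sin y).
  { intros y. rewrite cos_plus, cos_PI2, sin_PI2. ring. }
  apply (derive_remainder_le (fun y => cos (k * y + p)) (fun y => k * cos (k * y + p + PI / 2))
    (fun y => k * (k * - cos (k * y + p)))).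
  - intros y. auto_derive; auto. rewrite Hs. ring.
  - intros y. apply (is_derive_ext (fun y => k * - sin (k * y + p))).
    + intros z. now rewrite Hs.
    + auto_derive; auto. ring.
  - intros y. rewrite !Rabs_mult, Rabs_Ropp, <- Rmult_assoc.
    replace (k ^ 2) with (Rabs k * Rabs k * 1).
    + apply Rmult_le_compat_l; [apply Rmult_le_pos; apply Rabs_pos|].
      apply Rabs_le, COS_bound.
    + rewrite <- Rabs_mult. rewrite Rabs_pos_eq; [ring|]. nra.
Qed.

(** With [r n] the remainder of order [n], [r (n + 1) = (e + z) r n + z^2 n e^(n - 1)]; one margin
    [b] pays for the increment and the other one for the factor [n]. *)
Lemma pow_remainder A b n e z :
  0 <= A -> 0 < b -> Rabs e <= A -> Rabs z <= b ->
  Rabs ((e + z) ^ n - e ^ n - z * (INR n * e ^ pred n)) <= z ^ 2 * ((A + 2 * b) ^ n / b ^ 2)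
  /\ INR n * Rabs e ^ pred n <= (A + 2 * b) ^ n / b.
Proof.
  intros HA Hb He Hz.
  assert (Hlin : forall n, b * (INR n * Rabs e ^ pred n) <= (A + b) ^ n).
  { intros m.
    assert (Hl : Rabs e ^ m + b * (INR m * Rabs e ^ pred m) <= (A + b) ^ m).
    { induction m as [|m IH]; [simpl; lra|].
      replace (Rabs e ^ S m + b * (INR (S m) * Rabs e ^ pred (S m))) with
        (Rabs e * (Rabs e ^ m + b * (INR m * Rabs e ^ pred m)) + b * Rabs e ^ m).
      - assert (H0 : 0 <= Rabs e ^ m) by (apply pow_le, Rabs_pos).
        assert (H1 : 0 <= INR m * Rabs e ^ pred m).
        { apply Rmult_le_pos; [apply pos_INR|apply pow_le, Rabs_pos]. }
        assert (H3 := Rabs_pos e). simpl.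
        set (P := Rabs e ^ m + b * (INR m * Rabs e ^ pred m)) in *.
        assert (Rabs e ^ m <= P) by (unfold P; nra).
        set (Q := (A + b) ^ m) in *. nra.
      - rewrite S_INR. destruct m as [|m]; simpl; ring. }
    assert (0 <= Rabs e ^ m) by (apply pow_le, Rabs_pos). lra. }
  assert (Hmono : forall n, (A + b) ^ n <= (A + 2 * b) ^ n).
  { intros m. apply pow_incr; lra. }
  split.
  - assert (H : b ^ 2 * Rabs ((e + z) ^ n - e ^ n - z * (INR n * e ^ pred n)) <=
      z ^ 2 * (A + 2 * b) ^ n).
    { induction n as [|n IH].
      - simpl. replace (1 - 1 - z * (0 * 1)) with 0 by ring. rewrite Rabs_R0. nra.
      - set (r := (e + z) ^ n - e ^ n - z * (INR n * e ^ pred n)) in *.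
        replace ((e + z) ^ S n - e ^ S n - z * (INR (S n) * e ^ pred (S n))) with
          ((e + z) * r + z ^ 2 * (INR n * e ^ pred n)).
        + eapply Rle_trans; [apply Rmult_le_compat_l; [nra|apply Rabs_triang]|].
          rewrite !Rabs_mult, (Rabs_pos_eq (z ^ 2)), (Rabs_pos_eq (INR n)), <- RPow_abs;
            [|apply pos_INR|nra].
          assert (H1 := Hlin n). assert (H2 := Hmono n).
          assert (H3 : Rabs (e + z) <= A + b) by (eapply Rle_trans; [apply Rabs_triang|lra]).
          assert (H4 := Rabs_pos r). assert (H5 := Rabs_pos (e + z)).
          assert (H6 : 0 <= z ^ 2) by nra.
          set (Y := INR n * Rabs e ^ pred n) in *.
          assert (H7 : b ^ 2 * (Rabs (e + z) * Rabs r) <= (A + b) * (z ^ 2 * (A + 2 * b) ^ n)).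
          { replace (b ^ 2 * (Rabs (e + z) * Rabs r)) with (Rabs (e + z) * (b ^ 2 * Rabs r))
              by ring.
            apply Rmult_le_compat; auto. apply Rmult_le_pos; auto. nra. }
          assert (H8 : b ^ 2 * (z ^ 2 * Y) <= b * (z ^ 2 * (A + 2 * b) ^ n)).
          { replace (b ^ 2 * (z ^ 2 * Y)) with (b * (z ^ 2 * (b * Y))) by ring.
            apply Rmult_le_compat_l; [lra|]. apply Rmult_le_compat_l; auto. lra. }
          simpl. simpl in H7, H8. lra.
        + unfold r. rewrite S_INR. destruct n as [|n]; simpl; ring. }
    apply Rmult_le_reg_l with (b ^ 2); [apply pow_lt; lra|].
    eapply Rle_trans; [exact H|]. right. field. lra.
  - apply Rmult_le_reg_l with b; auto.
    eapply Rle_trans; [apply Hlin|]. eapply Rle_trans; [apply Hmono|]. right; field; lra.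
Qed.

Lemma series_remainder (f g h b : nat -> R) (F G H B s : R) :
  is_series f F -> is_series g G -> is_series h H -> is_series b B ->
  (forall i, Rabs (f i - g i - s * h i) <= s ^ 2 * b i) ->
  Rabs (F - G - s * H) <= s ^ 2 * B.
Proof.
  intros Hf Hg Hh Hb Hle.
  destruct (is_series_dominated (fun i => f i - g i - s * h i) _ _
    (is_series_Rmult (s ^ 2) _ _ Hb) Hle) as [l [Hl Hl2]].
  replace (F - G - s * H) with l; auto.
  apply (is_series_inj _ _ _ Hl).
  apply is_series_Rminus; [now apply is_series_Rminus|now apply is_series_Rmult].
Qed.

Lemma wt_exp_shift tau rho sigma d a :
  wt tau rho (sigma - d) a = exp (- (d * INR (freq a))) * wt tau rho sigma a.
Proof.
  unfold wt.
  replace ((sigma - d) * INR (freq a)) with (- (d * INR (freq a)) + sigma * INR (freq a)) by ring.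
  rewrite exp_plus. ring.
Qed.

Lemma wt_scale tau rho sigma l n k p c p' :
  wt tau rho sigma (Atom (c * l) n k p p') =
  Rabs c * wt tau rho sigma (Atom l n k p p').
Proof. unfold wt; simpl. rewrite Rabs_mult. ring. Qed.

(** The factor [k] of the derivative is paid by the strip.  The remainder is bounded uniformly
    in the point, which gives Lipschitz bounds along with the derivative. *)
Lemma W_derive_x tau rho sigma M u d :
  W tau rho sigma M u -> 0 < d <= sigma ->
  exists v B, W tau rho (sigma - d) (M / d) v /\
    forall t e x s, Rabs t <= tau -> Rabs e <= rho ->
      Rabs (u t e (x + s) - u t e x - s * v t e x) <= s ^ 2 * B.
Proof.
  intros (Ht & Hr & Hs & s & l & Hl & HlM & Hu) Hd.
  assert (Hk : forall a, INR (freq a) * wt tau rho (sigma - d) a <= / d * wt tau rho sigma a).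
  { intros a. rewrite wt_exp_shift, <- Rmult_assoc.
    apply Rmult_le_compat_r; [now apply wt_ge0|].
    apply mul_exp_neg_le; [lra|apply pos_INR]. }
  destruct (atoms_map tau rho sigma tau rho (sigma - d) (/ d)
    (fun a => Atom (INR (freq a) * amp a) (tdeg a) (edeg a) (freq a) (phase a + PI / 2)) s l)
    as [v [Hv1 Hv2]]; auto; [lra| |].
  { intros i. rewrite wt_scale, Rabs_pos_eq by apply pos_INR.
    eapply Rle_trans; [|apply Hk]. right. reflexivity. }
  assert (Hk2 : forall a, 0 <= INR (freq a) ^ 2 * wt tau rho 0 a <=
    (2 / d) ^ 2 * wt tau rho sigma a).
  { intros a. split.
    - apply Rmult_le_pos; [apply pow_le, pos_INR|now apply wt_ge0].
    - eapply Rle_trans.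
      + apply Rmult_le_compat_l; [apply pow_le, pos_INR|].
        apply (wt_mono tau rho (sigma - d) tau rho 0); lra.
      + rewrite wt_exp_shift, <- Rmult_assoc.
        apply Rmult_le_compat_r; [now apply wt_ge0|].
        assert (H := mul_exp_neg_le (d / 2) (INR (freq a)) ltac:(lra) (pos_INR _)).
        replace (- (d * INR (freq a))) with
          (- (d / 2 * INR (freq a)) + - (d / 2 * INR (freq a))) by field.
        rewrite exp_plus. replace (2 / d) with (/ (d / 2)) by (field; lra).
        assert (Hp : 0 <= INR (freq a) * exp (- (d / 2 * INR (freq a)))).
        { apply Rmult_le_pos; [apply pos_INR|left; apply exp_pos]. }
        replace (INR (freq a) ^ 2 *
          (exp (- (d / 2 * INR (freq a))) * exp (- (d / 2 * INR (freq a))))) with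
          ((INR (freq a) * exp (- (d / 2 * INR (freq a)))) ^ 2) by ring.
        apply pow_incr. lra. }
  destruct (is_series_nonneg_dominated (fun i => INR (freq (s i)) ^ 2 * wt tau rho 0 (s i)) _ _
    (is_series_Rmult ((2 / d) ^ 2) _ _ Hl) (fun i => Hk2 (s i))) as [B [HB _]].
  exists v, B. split.
  - apply (W_le _ _ _ _ _ _ Hv1). unfold Rdiv. rewrite Rmult_comm.
    apply Rmult_le_compat_r; auto. left; apply Rinv_0_lt_compat; lra.
  - intros t e x h H1 H2.
    apply (series_remainder _ _ _ _ _ _ _ _ _ (Hu t e (x + h) H1 H2) (Hu t e x H1 H2)
      (Hv2 t e x H1 H2) HB).
    intros i. set (a := s i). unfold ev, wt; simpl.
    set (T := t ^ tdeg a * e ^ edeg a). set (k := INR (freq a)). rewrite <- Rplus_assoc.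
    replace (amp a * (T * cos (k * (x + h) + phase a)) - amp a * (T * cos (k * x + phase a)) -
      h * (k * amp a * (T * cos (k * x + phase a + PI / 2)))) with
      (amp a * (T * (cos (k * (x + h) + phase a) - cos (k * x + phase a) -
        h * (k * cos (k * x + phase a + PI / 2))))) by ring.
    rewrite !Rabs_mult.
    replace (h * (h * 1) * (k * (k * 1) * (Rabs (amp a) *
      (tau ^ tdeg a * rho ^ edeg a * exp (0 * k))))) with
      (Rabs (amp a) * (tau ^ tdeg a * rho ^ edeg a * (k ^ 2 * h ^ 2))).
    + apply Rmult_le_compat_l; [apply Rabs_pos|].
      apply Rmult_le_compat; [apply Rabs_pos|apply Rabs_pos| |apply cos_remainder].
      unfold T. rewrite Rabs_mult, <- !RPow_abs.
      apply Rmult_le_compat; try (apply pow_le, Rabs_pos);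
        apply pow_incr; split; auto using Rabs_pos.
    + rewrite Rmult_0_l, exp_0. ring.
Qed.

Lemma W_derive_e tau rho sigma M u b rho' :
  W tau rho sigma M u -> 0 < b -> 0 <= rho' -> rho' + 2 * b <= rho ->
  exists v B, W tau rho' sigma (M / b) v /\
    forall t e x s, Rabs t <= tau -> Rabs e <= rho' -> Rabs s <= b ->
      Rabs (u t (e + s) x - u t e x - s * v t e x) <= s ^ 2 * B.
Proof.
  intros (Ht & Hr & Hs & s & l & Hl & HlM & Hu) Hb Hr' Hrr.
  set (m := fun a => Atom (INR (edeg a) * amp a) (tdeg a) (pred (edeg a)) (freq a) (phase a)).
  assert (Hm : forall a, wt tau rho' sigma (m a) <= / b * wt tau rho sigma a).
  { intros a. unfold m, wt; simpl. rewrite Rabs_mult, (Rabs_pos_eq (INR _)) by apply pos_INR.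
    destruct (pow_remainder rho' b (edeg a) rho' b) as [_ H]; auto; try (rewrite Rabs_pos_eq; lra).
    rewrite (Rabs_pos_eq rho') in H by lra.
    assert (H2 : (rho' + 2 * b) ^ edeg a <= rho ^ edeg a) by (apply pow_incr; lra).
    assert (Hi : 0 < / b) by now apply Rinv_0_lt_compat.
    assert (H3 : INR (edeg a) * rho' ^ pred (edeg a) <= / b * rho ^ edeg a).
    { eapply Rle_trans; [exact H|]. unfold Rdiv. rewrite Rmult_comm.
      apply Rmult_le_compat_l; lra. }
    replace (INR (edeg a) * Rabs (amp a) *
      (tau ^ tdeg a * rho' ^ Init.Nat.pred (edeg a) * exp (sigma * INR (freq a)))) with
      (Rabs (amp a) * (tau ^ tdeg a * exp (sigma * INR (freq a))) *
       (INR (edeg a) * rho' ^ Init.Nat.pred (edeg a))) by ring.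
    replace (/ b * (Rabs (amp a) *
      (tau ^ tdeg a * rho ^ edeg a * exp (sigma * INR (freq a))))) with
      (Rabs (amp a) * (tau ^ tdeg a * exp (sigma * INR (freq a))) * (/ b * rho ^ edeg a)) by ring.
    apply Rmult_le_compat_l; auto.
    repeat apply Rmult_le_pos; auto using Rabs_pos, pow_le. left; apply exp_pos. }
  destruct (atoms_map tau rho sigma tau rho' sigma (/ b) m s l) as [v [Hv1 Hv2]]; auto.
  exists v, (/ b ^ 2 * l). split.
  - apply (W_le _ _ _ _ _ _ Hv1). unfold Rdiv. rewrite Rmult_comm.
    apply Rmult_le_compat_r; auto. left; apply Rinv_0_lt_compat; lra.
  - intros t e x h H1 H2 H3.
    assert (He : Rabs e <= rho) by lra.
    assert (He2 : Rabs (e + h) <= rho) by (eapply Rle_trans; [apply Rabs_triang|lra]).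
    apply (series_remainder _ _ _ _ _ _ _ _ _ (Hu t (e + h) x H1 He2) (Hu t e x H1 He)
      (Hv2 t e x H1 H2) (is_series_Rmult (/ b ^ 2) _ _ Hl)).
    intros i. set (a := s i). unfold ev, wt, m. simpl amp; simpl tdeg; simpl edeg; simpl freq.
    simpl phase. set (n := edeg a). set (C := cos (INR (freq a) * x + phase a)).
    replace (amp a * (t ^ tdeg a * (e + h) ^ n * C) - amp a * (t ^ tdeg a * e ^ n * C) -
      h * (INR n * amp a * (t ^ tdeg a * e ^ pred n * C))) with
      (amp a * (t ^ tdeg a * ((e + h) ^ n - e ^ n - h * (INR n * e ^ pred n)) * C)) by ring.
    rewrite !Rabs_mult.
    destruct (pow_remainder rho' b n e h) as [H _]; auto.
    replace (h ^ 2 * (/ b ^ 2 * (Rabs (amp a) *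
      (tau ^ tdeg a * rho ^ n * exp (sigma * INR (freq a)))))) with
      (Rabs (amp a) * (tau ^ tdeg a * (h ^ 2 * (rho ^ n / b ^ 2)) * exp (sigma * INR (freq a))))
      by (unfold Rdiv; ring).
    apply Rmult_le_compat_l; [apply Rabs_pos|].
    apply Rmult_le_compat3; split; auto using Rabs_pos.
    + rewrite <- RPow_abs. apply pow_incr; split; auto using Rabs_pos.
    + eapply Rle_trans; [exact H|]. apply Rmult_le_compat_l; [nra|].
      unfold Rdiv. apply Rmult_le_compat_r.
      * left. apply Rinv_0_lt_compat, pow_lt; lra.
      * apply pow_incr; lra.
    + apply Rle_trans with 1; [apply Rabs_le, COS_bound|].
      apply exp_ge1, Rmult_le_pos; auto using pos_INR.
Qed.

Lemma is_derive_of_remainder (f : R -> R) (x l B r : R) :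
  0 < r ->
  (forall s, Rabs s <= r -> Rabs (f (x + s) - f x - s * l) <= s ^ 2 * B) -> is_derive f x l.
Proof.
  intros Hr H. apply is_derive_Reals. intros eps Heps.
  assert (HB : 0 < Rabs B + 1) by (pose proof (Rabs_pos B); lra).
  assert (Hd : 0 < Rmin r (eps / (Rabs B + 1))).
  { apply Rmin_pos; auto. now apply Rdiv_lt_0_compat. }
  exists (mkposreal _ Hd). intros h Hh Hhd. simpl in Hhd.
  assert (H1 : Rabs h < r) by (eapply Rlt_le_trans; [exact Hhd|apply Rmin_l]).
  assert (H2 : Rabs h < eps / (Rabs B + 1)) by (eapply Rlt_le_trans; [exact Hhd|apply Rmin_r]).
  replace ((f (x + h) - f x) / h - l) with ((f (x + h) - f x - h * l) / h) by (field; auto).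
  unfold Rdiv. rewrite Rabs_mult, Rabs_inv.
  assert (Hh0 : 0 < Rabs h) by now apply Rabs_pos_lt.
  apply Rmult_lt_reg_r with (Rabs h); auto.
  rewrite Rmult_assoc, Rinv_l, Rmult_1_r by lra.
  eapply Rle_lt_trans; [apply H; lra|].
  rewrite <- (pow2_abs h).
  assert (Rabs h * (Rabs B + 1) < eps).
  { apply Rmult_lt_reg_r with (/ (Rabs B + 1)); [now apply Rinv_0_lt_compat|].
    rewrite Rmult_assoc, Rinv_r, Rmult_1_r by lra. exact H2. }
  assert (B <= Rabs B) by apply Rle_abs.
  nra.
Qed.

(** * The cohomological equation *)

Definition small_divisors (w Gamma N : R) : Prop :=
  1 <= Gamma /\ 0 < N /\
  forall k : nat, (0 < k)%nat -> INR k < N -> 1 <= Gamma * Rabs (2 * sin (PI * (INR k * w))).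

(** Frequencies below [N] are solved exactly, at the price of the small divisor, and
    the remaining ones are left over: they are exponentially small in a narrower
    strip. *)
Lemma W_cohomological w Gamma N tau rho sigma M u d :
  small_divisors w Gamma N -> W tau rho sigma M u -> 0 <= d <= sigma ->
  exists u0 r v,
    W tau rho sigma M u0 /\
    (forall t e x y, Rabs t <= tau -> Rabs e <= rho -> u0 t e x = u0 t e y) /\
    W tau rho (sigma - d) (exp (- (d * N)) * M) r /\
    W tau rho sigma (Gamma * M) v /\
    forall t e x, Rabs t <= tau -> Rabs e <= rho ->
      u t e x = u0 t e x + r t e x + (v t e (x + 2 * PI * w) - v t e x).
Proof.
  intros (HG & HN & HD) (Ht & Hr & Hs & s & l & Hl & HlM & Hu) Hd.
  set (low := fun k : nat => if Rlt_dec (INR k) N then true else false).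
  set (m0 := fun a => Atom (if Nat.eqb (freq a) 0 then amp a else 0)
    (tdeg a) (edeg a) 0 (phase a)).
  set (mr := fun a => Atom (if low (freq a) then 0 else amp a)
    (tdeg a) (edeg a) (freq a) (phase a)).
  set (mv := fun a => Atom
    (if low (freq a) then
       if Nat.eqb (freq a) 0 then 0 else amp a / (2 * sin (PI * (INR (freq a) * w)))
     else 0) (tdeg a) (edeg a) (freq a) (phase a - PI * (INR (freq a) * w) - PI / 2)).
  assert (Hw : forall a, 0 <= wt tau rho sigma a) by (intros; now apply wt_ge0).
  destruct (atoms_map tau rho sigma tau rho sigma 1 m0 s l) as [u0 [Hu01 Hu02]]; auto.
  { intros i. set (a := s i). rewrite Rmult_1_l. unfold m0. destruct (Nat.eqb_spec (freq a) 0).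
    - right. unfold wt; simpl. now rewrite e.
    - rewrite wt_amp0. auto. }
  destruct (atoms_map tau rho sigma tau rho (sigma - d) (exp (- (d * N))) mr s l)
    as [r [Hr1 Hr2]]; auto; [lra| |].
  { intros i. set (a := s i). unfold mr, low. destruct Rlt_dec.
    - rewrite wt_amp0. apply Rmult_le_pos; auto. left; apply exp_pos.
    - replace (wt tau rho (sigma - d) _) with (wt tau rho (sigma - d) a) by reflexivity.
      rewrite wt_exp_shift. apply Rmult_le_compat_r; auto. apply exp_le.
      apply Ropp_le_contravar, Rmult_le_compat_l; lra. }
  destruct (atoms_map tau rho sigma tau rho sigma Gamma mv s l) as [v [Hv1 Hv2]]; auto.
  { intros i. set (a := s i). unfold mv, low.
    assert (HG0 : 0 <= Gamma * wt tau rho sigma a) by (apply Rmult_le_pos; auto; lra).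
    destruct Rlt_dec as [Hlt|]; [|rewrite wt_amp0; auto].
    destruct (Nat.eqb_spec (freq a) 0) as [|Hk]; [rewrite wt_amp0; auto|].
    unfold Rdiv. rewrite Rmult_comm, wt_scale. apply Rmult_le_compat_r; [apply Hw|].
    assert (H := HD (freq a) ltac:(lia) Hlt).
    set (S := 2 * sin (PI * (INR (freq a) * w))) in *.
    assert (HS : 0 < Rabs S) by (assert (H1 := Rabs_pos S); nra).
    rewrite Rabs_inv. apply Rmult_le_reg_r with (Rabs S); auto.
    rewrite Rinv_l by lra. exact H. }
  exists u0, r, v. repeat split.
  - exact Ht.
  - exact Hr.
  - exact Hs.
  - apply (W_le _ _ _ _ _ _ Hu01). lra.
  - intros t e x y H1 H2. apply (is_series_inj _ _ _ (Hu02 t e x H1 H2)).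
    apply (is_series_eq _ _ _ _ (Hu02 t e y H1 H2)); auto.
    intros n. unfold ev, m0; simpl. now rewrite !Rmult_0_l.
  - exact Ht.
  - exact Hr.
  - lra.
  - apply (W_le _ _ _ _ _ _ Hr1). apply Rmult_le_compat_l; auto. left; apply exp_pos.
  - exact Ht.
  - exact Hr.
  - exact Hs.
  - apply (W_le _ _ _ _ _ _ Hv1). apply Rmult_le_compat_l; auto. lra.
  - intros t e x H1 H2. apply (is_series_inj _ _ _ (Hu t e x H1 H2)).
    apply (is_series_eq _ _ _ _ (is_series_Rplus _ _ _ _
      (is_series_Rplus _ _ _ _ (Hu02 t e x H1 H2) (Hr2 t e x H1 H2))
      (is_series_Rminus _ _ _ _ (Hv2 t e (x + 2 * PI * w) H1 H2) (Hv2 t e x H1 H2)))); auto.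
    intros i. set (a := s i). unfold ev, m0, mr, mv, low; simpl.
    destruct (Nat.eqb_spec (freq a) 0) as [E|Hk].
    + rewrite E. simpl. destruct Rlt_dec; [|lra]. rewrite Rmult_0_l. ring.
    + destruct Rlt_dec as [Hlt|]; [|ring].
      assert (H := HD (freq a) ltac:(lia) Hlt).
      set (al := PI * (INR (freq a) * w)) in *.
      assert (HS : sin al <> 0).
      { intros E. rewrite E, Rmult_0_r, Rabs_R0 in H. lra. }
      set (T := t ^ tdeg a * e ^ edeg a).
      replace (INR (freq a) * (x + 2 * PI * w) + (phase a - al - PI / 2)) with
        (INR (freq a) * x + phase a + al - PI / 2) by (unfold al; field).
      replace (INR (freq a) * x + (phase a - al - PI / 2)) with
        (INR (freq a) * x + phase a - al - PI / 2) by ring.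
      set (th := INR (freq a) * x + phase a).
      assert (Hc : forall y, cos (y - PI / 2) = sin y).
      { intros y. rewrite cos_minus, cos_PI2, sin_PI2. ring. }
      rewrite !Hc, sin_plus, sin_minus. field. exact HS.
Qed.

(** * Composition *)

Lemma is_series_exp x : is_series (fun n => / INR (fact n) * x ^ n) (exp x).
Proof. apply is_pseries_R, is_exp_Reals. Qed.

Lemma exp_coef_ge0 x n : 0 <= x -> 0 <= / INR (fact n) * x ^ n.
Proof.
  intros Hx. apply Rmult_le_pos; [left; apply Rinv_0_lt_compat, INR_fact_lt_0|now apply pow_le].
Qed.

(** For the even and the odd terms, that is for the cosine and the sine. *)
Lemma exp_subseries (p : nat -> nat) x :
  0 <= x -> (forall i, (p i < p (S i))%nat) ->
  exists l, is_series (fun i => / INR (fact (p i)) * x ^ p i) l /\ l <= exp x.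
Proof.
  intros Hx Hp. apply is_series_bounded.
  - intros i. now apply exp_coef_ge0.
  - intros N. apply Rle_trans with (sum_n (fun n => / INR (fact n) * x ^ n) (p N)).
    + induction N as [|N IH].
      * rewrite sum_O. generalize (p 0%nat). intros [|k]; [rewrite sum_O; lra|].
        rewrite sum_Sn.
        assert (H : 0 <= sum_n (fun n => / INR (fact n) * x ^ n) k).
        { clear Hp. induction k as [|k IH]; [rewrite sum_O; now apply exp_coef_ge0|].
          rewrite sum_Sn. apply Rplus_le_le_0_compat; auto. now apply exp_coef_ge0. }
        match goal with |- ?a <= plus ?b ?c => change (a <= b + c) end. lra.
      * rewrite sum_Sn.
        assert (H : forall k, (p N <= k)%nat ->
          sum_n (fun n => / INR (fact n) * x ^ n) (p N) <=
          sum_n (fun n => / INR (fact n) * x ^ n) k).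
        { intros k Hk. induction Hk as [|k Hk IHk]; [lra|].
          rewrite sum_Sn.
          match goal with |- _ <= plus ?b ?c => change (plus b c) with (b + c) end.
          assert (H1 := exp_coef_ge0 x (S k) Hx). lra. }
        specialize (Hp N). destruct (p (S N)) as [|k] eqn:E; [lia|].
        rewrite sum_Sn. specialize (H k ltac:(lia)).
        apply Rplus_le_compat; lra.
    + apply sum_n_le_series; [apply is_series_exp|]. intros n; now apply exp_coef_ge0.
Qed.

Lemma W_cos_small tau rho sigma M u :
  W tau rho sigma M u -> W tau rho sigma (exp M) (fun t e x => cos (u t e x)).
Proof.
  intros Hu. destruct (W_pos _ _ _ _ _ Hu) as (Ht & Hr & Hs & HM).
  destruct (exp_subseries (fun i => (2 * i)%nat) M HM) as [l [Hl Hle]]; [intros; lia|].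
  apply (W_sum tau rho sigma _ l (exp M)
    (fun i t e x => (cos_n i) * u t e x ^ (2 * i)) _) with (2 := Hl); auto.
  - intros i. eapply W_le; [apply W_scal, W_pow, Hu|].
    apply Rmult_le_compat_r; [now apply pow_le|]. unfold cos_n, Rdiv.
    rewrite Rabs_mult, pow_1_abs, Rmult_1_l. rewrite Rabs_pos_eq; [lra|].
    left. apply Rinv_0_lt_compat, INR_fact_lt_0.
  - intros t e x _ _. unfold cos. destruct (exist_cos (u t e x)²) as [a Ha].
    apply is_series_Reals in Ha. apply (is_series_eq _ _ _ _ Ha); auto.
    intros n. unfold Rsqr. rewrite pow_mult. do 2 f_equal. ring.
Qed.

Lemma W_sin_small tau rho sigma M u :
  W tau rho sigma M u -> W tau rho sigma (exp M) (fun t e x => sin (u t e x)).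
Proof.
  intros Hu. destruct (W_pos _ _ _ _ _ Hu) as (Ht & Hr & Hs & HM).
  destruct (exp_subseries (fun i => (2 * i + 1)%nat) M HM) as [l [Hl Hle]]; [intros; lia|].
  apply (W_sum tau rho sigma _ l (exp M)
    (fun i t e x => (sin_n i) * u t e x ^ (2 * i + 1)) _) with (2 := Hl); auto.
  - intros i. eapply W_le; [apply W_scal, W_pow, Hu|].
    apply Rmult_le_compat_r; [now apply pow_le|]. unfold sin_n, Rdiv.
    rewrite Rabs_mult, pow_1_abs, Rmult_1_l. rewrite Rabs_pos_eq; [lra|].
    left. apply Rinv_0_lt_compat, INR_fact_lt_0.
  - intros t e x _ _. unfold sin. destruct (exist_sin (u t e x)²) as [a Ha].
    apply is_series_Reals in Ha.
    apply (is_series_eq _ _ _ _ (is_series_Rmult (u t e x) _ _ Ha)); auto.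
    intros n. unfold Rsqr. rewrite pow_add, pow_mult.
    replace (u t e x ^ 2) with (u t e x * u t e x) by ring. ring.
Qed.

(** The norm is the one of an angle moved by [M] in the imaginary direction. *)
Lemma W_cos tau rho sigma M u k p :
  W tau rho sigma M u ->
  W tau rho sigma (2 * exp ((sigma + M) * INR k))
    (fun t e x => cos (INR k * (x + u t e x) + p)).
Proof.
  intros Hu. destruct (W_pos _ _ _ _ _ Hu) as (Ht & Hr & Hs & HM).
  assert (Hku := W_scal _ _ _ _ (INR k) _ Hu).
  rewrite (Rabs_pos_eq (INR k)) in Hku by apply pos_INR.
  assert (Ha : forall q, W tau rho sigma (exp (sigma * INR k))
    (fun t e x => cos (INR k * x + q))).
  { intros q. apply (W_ext _ _ _ _ (ev (Atom 1 0 0 k q))).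
    - eapply W_le; [now apply W_atom|]. unfold wt; simpl. rewrite Rabs_R1. lra.
    - intros; unfold ev; simpl; ring. }
  apply (W_ext _ _ _ _ (fun t e x =>
    cos (INR k * x + p) * cos (INR k * u t e x) +
    cos (INR k * x + (p + PI / 2)) * sin (INR k * u t e x))).
  - eapply W_le.
    + apply W_add; apply W_mul; auto; [exact (W_cos_small _ _ _ _ _ Hku)|exact (W_sin_small _ _ _ _ _ Hku)].
    + rewrite <- exp_plus. replace (sigma * INR k + INR k * M) with ((sigma + M) * INR k) by ring.
      lra.
  - intros t e x _ _.
    replace (INR k * (x + u t e x) + p) with ((INR k * x + p) + INR k * u t e x) by ring.
    rewrite <- Rplus_assoc, !cos_plus, cos_PI2, sin_PI2. ring.
Qed.

(** Functions of [eps] and [psi] alone; the weight of the absent variable [t] is immaterial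
    ([W_of_V]). *)
Definition V (rho sigma M : R) (u : R -> R -> R) : Prop :=
  W 1 rho sigma M (fun _ e x => u e x).

Lemma W_at tau rho sigma M u t0 :
  W tau rho sigma M u -> Rabs t0 <= tau -> V rho sigma M (u t0).
Proof.
  intros (Ht & Hr & Hs & s & l & Hl & HlM & Hu) Ht0.
  destruct (atoms_map tau rho sigma 1 rho sigma 1
    (fun a => Atom (amp a * t0 ^ tdeg a) 0 (edeg a) (freq a) (phase a)) s l) as [v [Hv1 Hv2]];
    auto; [lra| |].
  - intros i. set (a := s i). unfold wt; simpl. rewrite Rabs_mult, <- RPow_abs, !Rmult_1_l.
    rewrite !Rmult_assoc. apply Rmult_le_compat_l; [apply Rabs_pos|].
    apply Rmult_le_compat_r.
    + apply Rmult_le_pos; [now apply pow_le|left; apply exp_pos].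
    + apply pow_incr; split; auto using Rabs_pos.
  - unfold V. apply (W_ext _ _ _ _ v).
    + apply (W_le _ _ _ _ _ _ Hv1). lra.
    + intros t e x H1 H2. apply (is_series_inj _ _ _ (Hv2 t e x H1 H2)).
      apply (is_series_eq _ _ _ _ (Hu t0 e x Ht0 H2)); auto.
      intros i. unfold ev; simpl. ring.
Qed.

Lemma W_of_V tau rho sigma M u :
  V rho sigma M u -> 0 <= tau -> W tau rho sigma M (fun _ e x => u e x).
Proof.
  intros (_ & Hr & Hs & s & l & Hl & HlM & Hu) Ht.
  destruct (atoms_map 1 rho sigma tau rho sigma 1
    (fun a => Atom (amp a) 0 (edeg a) (freq a) (phase a)) s l) as [v [Hv1 Hv2]]; auto.
  - intros i. unfold wt; simpl. rewrite pow1. lra.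
  - apply (W_ext _ _ _ _ v).
    + apply (W_le _ _ _ _ _ _ Hv1). lra.
    + intros t e x H1 H2. apply (is_series_inj _ _ _ (Hv2 t e x H1 H2)).
      apply (is_series_eq _ _ _ _ (Hu 1 e x ltac:(rewrite Rabs_R1; lra) H2)); auto.
      intros i. unfold ev; simpl. rewrite pow1. ring.
Qed.

(** [F] is expanded in the action [H] and in cosines of the angle [x + h]; each term is composed
    by [W_cos], and [sigma0] and [s0] leave room for the displacements. *)
Lemma W_comp tau rho sigma s0 sigma0 C F M N h H :
  V s0 sigma0 C F -> W tau rho sigma M h -> W tau rho sigma N H ->
  sigma + M <= sigma0 -> N <= s0 ->
  W tau rho sigma (2 * C) (fun t e x => F (H t e x) (x + h t e x)).
Proof.
  intros (_ & Hs0 & Hsig0 & s & l & Hl & HlC & HF) Hh HH H1 H2.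
  destruct (W_pos _ _ _ _ _ HH) as (Ht & Hr & Hs & HN).
  apply (W_sum tau rho sigma (fun i => 2 * wt 1 s0 sigma0 (s i)) (2 * l) _
    (fun i t e x => ev (s i) 1 (H t e x) (x + h t e x))).
  - intros i. set (a := s i). unfold ev.
    apply (W_ext _ _ _ _ (fun t e x => amp a * (H t e x ^ edeg a *
      cos (INR (freq a) * (x + h t e x) + phase a)))).
    + eapply W_le.
      * apply W_scal, W_mul; [apply W_pow, HH|apply W_cos, Hh].
      * unfold wt. rewrite pow1, Rmult_1_l.
        replace (2 * (Rabs (amp a) * (s0 ^ edeg a * exp (sigma0 * INR (freq a))))) with
          (Rabs (amp a) * (s0 ^ edeg a * (2 * exp (sigma0 * INR (freq a))))) by ring.
        apply Rmult_le_compat_l; [apply Rabs_pos|].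
        assert (He : exp ((sigma + M) * INR (freq a)) <= exp (sigma0 * INR (freq a))).
        { apply exp_le, Rmult_le_compat_r; auto using pos_INR. }
        assert (He0 := exp_pos ((sigma + M) * INR (freq a))).
        apply Rmult_le_compat; [now apply pow_le|lra|apply pow_incr; lra|lra].
    + intros; rewrite pow1; ring.
  - now apply is_series_Rmult.
  - lra.
  - intros t e x Ht1 He1. apply HF; [rewrite Rabs_R1; lra|].
    apply Rle_trans with N; auto. eapply W_bound; eauto.
Qed.

(** Taylor remainders in [t]: a weight [tau] for the variable [t] means that the part of
    degree at least [j] in [t] has, at [t = 1], norm smaller by a factor [tau ^ j]. *)
Lemma W_taylor1 tau rho sigma M u :
  W tau rho sigma M u -> 1 <= tau -> V rho sigma (M / tau) (fun e x => u 1 e x - u 0 e x).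
Proof.
  intros (Ht & Hr & Hs & s & l & Hl & HlM & Hu) Ht1.
  assert (Hw : forall a, 0 <= wt tau rho sigma a) by (intros; now apply wt_ge0).
  destruct (atoms_map tau rho sigma 1 rho sigma (/ tau)
    (fun a => Atom (if Nat.eqb (tdeg a) 0 then 0 else amp a) 0 (edeg a) (freq a) (phase a)) s l)
    as [v [Hv1 Hv2]]; auto; [lra| |].
  - intros i. set (a := s i). destruct (Nat.eqb_spec (tdeg a) 0) as [E|E].
    + rewrite wt_amp0. apply Rmult_le_pos; auto. left; apply Rinv_0_lt_compat; lra.
    + unfold wt; simpl. destruct (tdeg a) as [|k]; [lia|].
      replace (/ tau * (Rabs (amp a) * (tau ^ S k * rho ^ edeg a * exp (sigma * INR (freq a)))))
        with (tau ^ k * (Rabs (amp a) * (1 * rho ^ edeg a * exp (sigma * INR (freq a)))))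
        by (simpl; field; lra).
      rewrite <- (Rmult_1_l (Rabs (amp a) * _)) at 1.
      apply Rmult_le_compat_r; [|now apply pow_R1_Rle].
      repeat apply Rmult_le_pos; auto using Rabs_pos, pow_le; try lra. left; apply exp_pos.
  - apply (W_ext _ _ _ _ v).
    + apply (W_le _ _ _ _ _ _ Hv1). unfold Rdiv. rewrite Rmult_comm.
      apply Rmult_le_compat_r; auto. left; apply Rinv_0_lt_compat; lra.
    + intros t e x H1 H2. apply (is_series_inj _ _ _ (Hv2 t e x H1 H2)).
      apply (is_series_eq _ _ _ _ (is_series_Rminus _ _ _ _
        (Hu 1 e x ltac:(rewrite Rabs_R1; lra) H2) (Hu 0 e x ltac:(rewrite Rabs_R0; lra) H2)));
        auto.
      intros i. set (a := s i). unfold ev; simpl. destruct (tdeg a) as [|k]; simpl; [ring|].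
      rewrite pow1. ring.
Qed.

Lemma W_taylor2 tau rho sigma M u :
  W tau rho sigma M u -> 1 <= tau ->
  exists b r, V rho sigma (M / tau ^ 2) r /\
    (forall e x, Rabs e <= rho -> u 1 e x = u 0 e x + b e x + r e x) /\
    (forall e x, Rabs e <= rho -> is_derive (fun t => u t e x) 0 (b e x)).
Proof.
  intros (Ht & Hr & Hs & s & l & Hl & HlM & Hu) Ht1.
  assert (Hw : forall a, 0 <= wt tau rho sigma a) by (intros; now apply wt_ge0).
  destruct (atoms_map tau rho sigma 1 rho sigma 1
    (fun a => Atom (if Nat.eqb (tdeg a) 1 then amp a else 0) 0 (edeg a) (freq a) (phase a)) s l)
    as [b [Hb1 Hb2]]; auto; [lra| |].
  { intros i. set (a := s i). destruct (Nat.eqb_spec (tdeg a) 1) as [E|E].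
    - unfold wt; simpl amp; simpl edeg; simpl freq; simpl tdeg.
      rewrite E, !Rmult_1_l, pow_1, Rmult_assoc.
      apply Rmult_le_compat_l; [apply Rabs_pos|].
      rewrite <- (Rmult_1_l (rho ^ _ * _)) at 1.
      apply Rmult_le_compat_r; [|lra].
      apply Rmult_le_pos; [now apply pow_le|left; apply exp_pos].
    - rewrite wt_amp0, Rmult_1_l. auto. }
  set (m2 := fun a => Atom (if Nat.leb 2 (tdeg a) then amp a else 0) 0
    (edeg a) (freq a) (phase a)).
  destruct (atoms_map tau rho sigma 1 rho sigma (/ tau ^ 2) m2 s l)
    as [r [Hr1 Hr2]]; auto; [lra| |].
  { intros i. set (a := s i). unfold m2. destruct (Nat.leb_spec 2 (tdeg a)) as [E|E].
    - unfold wt; simpl. destruct (tdeg a) as [|[|k]]; try lia.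
      replace (/ (tau * (tau * 1)) *
        (Rabs (amp a) * (tau ^ S (S k) * rho ^ edeg a * exp (sigma * INR (freq a)))))
        with (tau ^ k * (Rabs (amp a) * (1 * rho ^ edeg a * exp (sigma * INR (freq a)))))
        by (simpl; field; lra).
      rewrite <- (Rmult_1_l (Rabs (amp a) * _)) at 1.
      apply Rmult_le_compat_r; [|now apply pow_R1_Rle].
      repeat apply Rmult_le_pos; auto using Rabs_pos, pow_le; try lra. left; apply exp_pos.
    - rewrite wt_amp0. apply Rmult_le_pos; auto. left; apply Rinv_0_lt_compat, pow_lt; lra. }
  exists (b 0), (r 0). assert (H0 : Rabs 0 <= 1) by (rewrite Rabs_R0; lra).
  assert (H0' : Rabs 0 <= tau) by (rewrite Rabs_R0; lra). split; [|split].
  - apply (W_at 1); auto. apply (W_le _ _ _ _ _ _ Hr1). unfold Rdiv. rewrite Rmult_comm.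
    apply Rmult_le_compat_r; auto. left; apply Rinv_0_lt_compat, pow_lt; lra.
  - intros e x He.
    apply (is_series_inj _ _ _ (Hu 1 e x ltac:(rewrite Rabs_R1; lra) He)).
    apply (is_series_eq _ _ _ _ (is_series_Rplus _ _ _ _ (is_series_Rplus _ _ _ _
      (Hu 0 e x H0' He) (Hb2 0 e x H0 He)) (Hr2 0 e x H0 He))); auto.
    intros i. set (a := s i). unfold ev, m2; simpl.
    destruct (tdeg a) as [|[|k]]; simpl; try rewrite pow1; ring.
  - intros e x He.
    apply (is_derive_of_remainder _ _ _ l 1); [lra|].
    intros t Htt. rewrite Rplus_0_l.
    apply (series_remainder _ _ _ _ _ _ _ _ _ (Hu t e x ltac:(lra) He) (Hu 0 e x H0' He)
      (Hb2 0 e x H0 He) Hl).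
    intros i. set (a := s i). unfold ev, wt; simpl.
    assert (Hb : Rabs (amp a) * (tau ^ tdeg a * rho ^ edeg a * exp (sigma * INR (freq a))) =
      wt tau rho sigma a) by reflexivity.
    rewrite Rmult_1_r.
    destruct (Nat.leb_spec 2 (tdeg a)) as [E|E].
    + destruct (tdeg a) as [|[|k]] eqn:Ek; try lia. simpl Nat.eqb. cbv iota.
      replace (_ - _ - _) with (t * t * (amp a * (t ^ k * e ^ edeg a *
        cos (INR (freq a) * x + phase a)))) by (simpl; ring).
      rewrite Rabs_mult, (Rabs_pos_eq (t * t)) by nra.
      apply Rmult_le_compat_l; [nra|].
      eapply Rle_trans; [apply (ev_le_wt 1 rho sigma (Atom (amp a) k (edeg a) (freq a) (phase a))
        t e x); auto|].
      unfold wt; simpl. apply Rmult_le_compat_l; [apply Rabs_pos|].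
      apply Rmult_le_compat_r; [left; apply exp_pos|].
      apply Rmult_le_compat_r; [now apply pow_le|]. rewrite pow1.
      apply (pow_R1_Rle tau (S (S k))); lra.
    + replace (_ - _ - _) with 0.
      * rewrite Rabs_R0. apply Rmult_le_pos; [nra|]. rewrite Hb. apply Hw.
      * destruct (tdeg a) as [|[|k]]; try lia; simpl; ring.
Qed.

(** * Functions of the perturbation parameter and the angle *)

Section VAlgebra.
Context (rho sigma : R).

Lemma V_pos M u : V rho sigma M u -> 0 <= rho /\ 0 <= sigma /\ 0 <= M.
Proof. intros H. destruct (W_pos _ _ _ _ _ H) as (_ & H1 & H2 & H3). auto. Qed.

Lemma V_le M M' u : V rho sigma M u -> M <= M' -> V rho sigma M' u.
Proof. apply W_le. Qed.

Lemma V_ext M u v :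
  V rho sigma M u -> (forall e x, Rabs e <= rho -> u e x = v e x) -> V rho sigma M v.
Proof. intros H E. apply (W_ext _ _ _ _ _ _ H). auto. Qed.

Lemma V_bound M u e x : V rho sigma M u -> Rabs e <= rho -> Rabs (u e x) <= M.
Proof.
  intros H He. apply (W_bound _ _ _ _ _ 1 e x H); auto. rewrite Rabs_R1; lra.
Qed.

Lemma V_add M N u v :
  V rho sigma M u -> V rho sigma N v -> V rho sigma (M + N) (fun e x => u e x + v e x).
Proof. apply W_add. Qed.

Lemma V_sub M N u v :
  V rho sigma M u -> V rho sigma N v -> V rho sigma (M + N) (fun e x => u e x - v e x).
Proof. apply W_sub. Qed.

Lemma V_opp M u : V rho sigma M u -> V rho sigma M (fun e x => - u e x).
Proof. apply W_opp. Qed.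

Lemma V_mul M N u v :
  V rho sigma M u -> V rho sigma N v -> V rho sigma (M * N) (fun e x => u e x * v e x).
Proof. apply W_mul. Qed.

Lemma V_scal M c u : V rho sigma M u -> V rho sigma (Rabs c * M) (fun e x => c * u e x).
Proof. apply W_scal. Qed.

Lemma V_const c : 0 <= rho -> 0 <= sigma -> V rho sigma (Rabs c) (fun _ _ => c).
Proof. intros. apply W_const; auto; lra. Qed.

Lemma V_eps : 0 <= rho -> 0 <= sigma -> V rho sigma rho (fun e _ => e).
Proof. intros. apply W_e; auto; lra. Qed.

Lemma V_inv M u :
  V rho sigma M u -> M < 1 -> V rho sigma (/ (1 - M)) (fun e x => / (1 + u e x)).
Proof. apply W_inv. Qed.

Lemma V_shift M u c : V rho sigma M u -> V rho sigma M (fun e x => u e (x + c)).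
Proof. intros H. apply (W_shift _ _ _ _ _ c H). Qed.

Lemma V_periodic M u e x :
  V rho sigma M u -> Rabs e <= rho -> u e (x + 2 * PI) = u e x.
Proof.
  intros H He. apply (W_periodic _ _ _ _ _ 1 e x H); auto. rewrite Rabs_R1; lra.
Qed.

Lemma V_sum (M : nat -> R) (S S' : R) (u : nat -> R -> R -> R) (v : R -> R -> R) :
  (forall j, V rho sigma (M j) (u j)) -> is_series M S -> S <= S' ->
  (forall e x, Rabs e <= rho -> is_series (fun j => u j e x) (v e x)) ->
  V rho sigma S' v.
Proof.
  intros Hu HM HS Hv.
  apply (W_sum 1 rho sigma M S S' (fun j _ => u j) (fun _ => v)); auto.
Qed.

Lemma V_derive M u d :
  V rho sigma M u -> 0 < d <= sigma ->
  exists v, V rho (sigma - d) (M / d) v /\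
    forall e x, Rabs e <= rho -> is_derive (u e) x (v e x).
Proof.
  intros Hu Hd. destruct (W_derive_x _ _ _ _ _ d Hu Hd) as (v & B & Hv & HB).
  assert (H0 : Rabs 0 <= 1) by (rewrite Rabs_R0; lra).
  exists (v 0). split; [now apply (W_at 1)|].
  intros e x He. apply (is_derive_of_remainder _ _ _ B 1); [lra|].
  intros s _. now apply (HB 0 e x s).
Qed.

Lemma V_cohomological w Gamma N M u d :
  small_divisors w Gamma N -> V rho sigma M u -> 0 <= d <= sigma ->
  exists (u0 : R -> R) r v,
    V rho sigma M (fun e _ => u0 e) /\
    V rho (sigma - d) (exp (- (d * N)) * M) r /\
    V rho sigma (Gamma * M) v /\
    forall e x, Rabs e <= rho ->
      u e x = u0 e + r e x + (v e (x + 2 * PI * w) - v e x).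
Proof.
  intros HD Hu Hd.
  destruct (W_cohomological w Gamma N _ _ _ _ _ d HD Hu Hd)
    as (u0 & r & v & Hu0 & Hi & Hr & Hv & E).
  assert (H0 : Rabs 0 <= 1) by (rewrite Rabs_R0; lra).
  exists (fun e => u0 0 e 0), (r 0), (v 0).
  split; [|split; [now apply (W_at 1)|split; [now apply (W_at 1)|]]].
  - apply (V_ext M (u0 0)); [now apply (W_at 1)|]. intros e x He. now apply Hi.
  - intros e x He. rewrite (E 0 e x H0 He). do 2 f_equal. now apply Hi.
Qed.

End VAlgebra.

Lemma V_weaken rho sigma rho' sigma' M u :
  V rho sigma M u -> 0 <= rho' <= rho -> 0 <= sigma' <= sigma -> V rho' sigma' M u.
Proof. intros H H1 H2. apply (W_weaken _ _ _ _ _ _ _ _ H); lra. Qed.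

Lemma V_strip rho sigma sigma' M u :
  V rho sigma M u -> 0 <= sigma' <= sigma -> V rho sigma' M u.
Proof. intros H H1. assert (H2 := V_pos _ _ _ _ H). apply (V_weaken _ _ _ _ _ _ H); lra. Qed.

(** * Composition with a function of the phase space *)

(** In [F e x] the action is [y0 + e] and the angle is [x].  Differentiability is encoded by its
    effect on curves, which covers both the partial derivatives and the derivative of a
    composition. *)
Definition chain_rule (s0 : R) (F Fe Fx : R -> R -> R) : Prop :=
  forall (X Y : R -> R) t X' Y', is_derive X t X' -> is_derive Y t Y' -> Rabs (Y t) < s0 ->
    is_derive (fun t => F (Y t) (X t)) t (Fe (Y t) (X t) * Y' + Fx (Y t) (X t) * X').

Definition C1_data (s0 sigma0 C : R) (F Fe Fx : R -> R -> R) : Prop :=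
  V s0 sigma0 C F /\ V s0 sigma0 C Fe /\ V s0 sigma0 C Fx /\ chain_rule s0 F Fe Fx.

Lemma C1_data_weaken s0 sigma0 C s1 sigma1 C1 F Fe Fx :
  C1_data s0 sigma0 C F Fe Fx -> 0 <= s1 <= s0 -> 0 <= sigma1 <= sigma0 -> C <= C1 ->
  C1_data s1 sigma1 C1 F Fe Fx.
Proof.
  intros (H1 & H2 & H3 & H4) Hs Hsig HC.
  assert (Hw : forall u, V s0 sigma0 C u -> V s1 sigma1 C1 u).
  { intros u Hu. apply (V_le _ _ C); auto. now apply (V_weaken s0 sigma0). }
  split; [auto|]. split; [auto|]. split; [auto|].
  intros X Y t X' Y' HX HY Hlt. apply H4; auto. lra.
Qed.

(** The partial derivatives come with quadratic remainders, and the one in the angle is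
    Lipschitz in the action; together they make [F] differentiable in both variables. *)
Lemma V_C1_data s0 sigma0 C F :
  V s0 sigma0 C F -> 0 < s0 -> 0 < sigma0 ->
  exists s1 sigma1 C1 Fe Fx,
    0 < s1 <= s0 /\ 0 < sigma1 <= sigma0 /\ C1_data s1 sigma1 C1 F Fe Fx.
Proof.
  intros HF Hs0 Hsig.
  destruct (W_derive_x _ _ _ _ _ (sigma0 / 2) HF ltac:(lra)) as (Fx & B1 & HFx & HB1).
  destruct (W_derive_e _ _ _ _ _ (s0 / 4) (s0 / 2) HF ltac:(lra) ltac:(lra) ltac:(lra))
    as (Fe & B2 & HFe & HB2).
  destruct (W_derive_e _ _ _ _ _ (s0 / 4) (s0 / 2) HFx ltac:(lra) ltac:(lra) ltac:(lra))
    as (Fxe & B3 & HFxe & HB3).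
  replace (sigma0 - sigma0 / 2) with (sigma0 / 2) in HFx, HFxe by field.
  set (M3 := C / (sigma0 / 2) / (s0 / 4)) in *.
  assert (H0 : Rabs 0 <= 1) by (rewrite Rabs_R0; lra).
  destruct (V_pos _ _ _ _ HF) as (_ & _ & HC).
  exists (s0 / 2), (sigma0 / 2), (C + C / (sigma0 / 2) + C / (s0 / 4)), (Fe 0), (Fx 0).
  assert (Hp1 : 0 <= C / (sigma0 / 2)) by (apply Rle_mult_inv_pos; lra).
  assert (Hp2 : 0 <= C / (s0 / 4)) by (apply Rle_mult_inv_pos; lra).
  split; [lra|]. split; [lra|]. split; [|split; [|split]].
  - apply (V_le _ _ C); [|lra]. apply (V_weaken s0 sigma0); auto; lra.
  - apply (V_le _ _ (C / (s0 / 4))); [|lra]. apply (V_weaken (s0 / 2) sigma0); try lra.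
    now apply (W_at 1).
  - apply (V_le _ _ (C / (sigma0 / 2))); [|lra]. apply (V_weaken s0 (sigma0 / 2)); try lra.
    now apply (W_at 1).
  - intros X Y t X' Y' HX HY Hlt.
    apply is_derive_Reals.
    apply (derivable_pt_lim_comp_2d F Y X t (Fe 0 (Y t) (X t)) (Fx 0 (Y t) (X t)) Y' X');
      [|now apply is_derive_Reals|now apply is_derive_Reals].
    set (e := Y t) in *. set (x := X t).
    set (K := Rabs B1 + (M3 + s0 / 4 * Rabs B3) + Rabs B2).
    assert (HM3 : 0 <= M3) by (apply (W_pos _ _ _ _ _ HFxe)).
    assert (HK : 0 <= K).
    { unfold K. pose proof (Rabs_pos B1). pose proof (Rabs_pos B2). pose proof (Rabs_pos B3).
      assert (0 <= s0 / 4 * Rabs B3) by (apply Rmult_le_pos; lra). lra. }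
    intros eps.
    assert (Hd : 0 < Rmin (s0 / 4) (eps / (K + 1))).
    { apply Rmin_pos; [lra|]. apply Rdiv_lt_0_compat; [apply eps|lra]. }
    exists (mkposreal _ Hd). simpl. intros u v Hu Hv.
    set (z := u - e) in *. set (s := v - x) in *.
    assert (Hz1 : Rabs z < s0 / 4) by (eapply Rlt_le_trans; [exact Hu|apply Rmin_l]).
    set (m := Rmax (Rabs z) (Rabs s)).
    assert (Hm : m < eps / (K + 1)).
    { unfold m. apply Rmax_lub_lt; [apply (Rlt_le_trans _ _ _ Hu)|apply (Rlt_le_trans _ _ _ Hv)];
        apply Rmin_r. }
    assert (Hm1 : Rabs z <= m) by apply Rmax_l.
    assert (Hm2 : Rabs s <= m) by apply Rmax_r.
    assert (He : Rabs e <= s0 / 2) by lra.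
    assert (Hez : Rabs (e + z) <= s0).
    { eapply Rle_trans; [apply Rabs_triang|lra]. }
    assert (E1 := HB1 0 (e + z) x s H0 Hez).
    assert (E2 := HB2 0 e x z H0 He ltac:(lra)).
    assert (E3 := HB3 0 e x z H0 He ltac:(lra)).
    assert (E4 := W_bound _ _ _ _ _ 0 e x HFxe H0 He).
    replace u with (e + z) by (unfold z; ring). replace v with (x + s) by (unfold s; ring).
    assert (Hx : Rabs (Fx 0 (e + z) x - Fx 0 e x) <= (M3 + s0 / 4 * Rabs B3) * Rabs z).
    { replace (Fx 0 (e + z) x - Fx 0 e x) with
        ((Fx 0 (e + z) x - Fx 0 e x - z * Fxe 0 e x) + z * Fxe 0 e x) by ring.
      eapply Rle_trans; [apply Rabs_triang|]. rewrite Rabs_mult.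
      rewrite <- (pow2_abs z) in E3.
      assert (Rabs z ^ 2 * B3 <= Rabs z * (s0 / 4 * Rabs B3)).
      { apply Rle_trans with (Rabs z ^ 2 * Rabs B3).
        - apply Rmult_le_compat_l; [apply pow2_ge_0|apply Rle_abs].
        - replace (Rabs z ^ 2 * Rabs B3) with (Rabs z * (Rabs z * Rabs B3)) by ring.
          apply Rmult_le_compat_l; [apply Rabs_pos|].
          apply Rmult_le_compat_r; [apply Rabs_pos|lra]. }
      assert (Rabs z * Rabs (Fxe 0 e x) <= Rabs z * M3)
        by (apply Rmult_le_compat_l; auto; apply Rabs_pos).
      lra. }
    assert (Hq : forall B r, Rabs r <= m -> r ^ 2 * B <= Rabs B * (m * m)).
    { intros B r Hr. rewrite <- (pow2_abs r).
      assert (HB := Rle_abs B). assert (H1 := Rabs_pos r). assert (H2 := Rabs_pos B).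
      apply Rle_trans with (Rabs r ^ 2 * Rabs B).
      - apply Rmult_le_compat_l; [apply pow2_ge_0|auto].
      - rewrite Rmult_comm. apply Rmult_le_compat_l; auto. simpl. rewrite Rmult_1_r.
        apply Rmult_le_compat; auto. }
    assert (Q1 := Hq B1 s Hm2). assert (Q2 := Hq B2 z Hm1).
    assert (Q3 : Rabs (s * (Fx 0 (e + z) x - Fx 0 e x)) <= (M3 + s0 / 4 * Rabs B3) * (m * m)).
    { rewrite Rabs_mult.
      apply Rle_trans with (m * ((M3 + s0 / 4 * Rabs B3) * m)); [|right; ring].
      apply Rmult_le_compat; auto using Rabs_pos.
      eapply Rle_trans; [exact Hx|]. apply Rmult_le_compat_l; auto.
      pose proof (Rabs_pos B3). assert (0 <= s0 / 4 * Rabs B3) by (apply Rmult_le_pos; lra). lra. }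
    replace (F (e + z) (x + s) - F e x - (Fe 0 e x * z + Fx 0 e x * s)) with
      ((F (e + z) (x + s) - F (e + z) x - s * Fx 0 (e + z) x) +
       (s * (Fx 0 (e + z) x - Fx 0 e x) + (F (e + z) x - F e x - z * Fe 0 e x))) by ring.
    eapply Rle_trans; [apply Rabs_triang|].
    eapply Rle_trans; [apply Rplus_le_compat_l, Rabs_triang|].
    apply Rle_trans with (K * (m * m)).
    { unfold K. lra. }
    replace (K * (m * m)) with (K * m * m) by ring.
    apply Rmult_le_compat_r.
    { apply Rle_trans with (Rabs z); auto. apply Rabs_pos. }
    assert (m * (K + 1) < eps).
    { apply Rmult_lt_reg_r with (/ (K + 1)); [apply Rinv_0_lt_compat; lra|].
      rewrite Rmult_assoc, Rinv_r, Rmult_1_r by lra. exact Hm. }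
    assert (0 <= m) by (apply Rle_trans with (Rabs z); auto; apply Rabs_pos).
    nra.
Qed.

Section Compose.
Context (s0 sigma0 C : R) (F Fe Fx : R -> R -> R) (HF : C1_data s0 sigma0 C F Fe Fx).
Context (rho sigma k : R) (h H : R -> R -> R).
Context (Hh : V rho sigma k h) (HH : V rho sigma k H).

Lemma V_comp G :
  V s0 sigma0 C G -> sigma + k <= sigma0 -> k <= s0 ->
  V rho sigma (2 * C) (fun e x => G (H e x) (x + h e x)).
Proof.
  intros HG H1 H2. exact (W_comp 1 rho sigma s0 sigma0 C G k k _ _ HG Hh HH H1 H2).
Qed.

(** Second order Taylor formula: a perturbation of size [z] may be dilated by the factor
    [Z / z] before leaving the domain. *)
Lemma V_taylor xi eta z Z :
  V rho sigma z xi -> V rho sigma z eta -> 0 < z <= Z ->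
  sigma + k + Z <= sigma0 -> k + Z <= s0 ->
  exists r, V rho sigma (2 * C * (z / Z) ^ 2) r /\
    forall e x, Rabs e <= rho ->
      F (H e x + eta e x) (x + h e x + xi e x) =
      F (H e x) (x + h e x) + Fe (H e x) (x + h e x) * eta e x +
      Fx (H e x) (x + h e x) * xi e x + r e x.
Proof.
  intros Hxi Heta Hz H1 H2.
  set (tau := Z / z).
  assert (Ht : 1 <= tau).
  { unfold tau. apply Rmult_le_reg_r with z; [lra|]. unfold Rdiv.
    rewrite Rmult_assoc, Rinv_l by lra. lra. }
  destruct (V_pos _ _ _ _ Hh) as (Hr & Hs & Hk).
  assert (Hdil : forall u v, V rho sigma k u -> V rho sigma z v ->
    W tau rho sigma (k + Z) (fun t e x => u e x + t * v e x)).
  { intros u v Hu Hv. replace Z with (tau * z) at 1 by (unfold tau; field; lra).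
    apply (W_add _ _ _ _ _ (fun _ => u)); [apply W_of_V; auto; lra|].
    apply (W_mul _ _ _ _ _ (fun t _ _ => t) (fun _ => v)); [apply W_t; lra|].
    apply W_of_V; auto; lra. }
  assert (HU := W_comp tau rho sigma s0 sigma0 C F _ _ _ _ (proj1 HF)
    (Hdil _ _ Hh Hxi) (Hdil _ _ HH Heta) ltac:(lra) H2).
  destruct (W_taylor2 _ _ _ _ _ HU Ht) as (b & r & Hr1 & E & Hb).
  exists r. split.
  - apply (V_le _ _ _ _ _ Hr1). right. unfold tau. field. lra.
  - intros e x He. assert (E1 := E e x He). simpl in E1.
    rewrite !Rmult_1_l, !Rmult_0_l, !Rplus_0_r, <- Rplus_assoc in E1. rewrite E1.
    assert (Hd : is_derive (fun t => F (H e x + t * eta e x) (x + (h e x + t * xi e x))) 0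
      (Fe (H e x) (x + h e x) * eta e x + Fx (H e x) (x + h e x) * xi e x)).
    { assert (HY : is_derive (fun t => H e x + t * eta e x) 0 (eta e x)).
      { auto_derive; auto. ring. }
      assert (HX : is_derive (fun t => x + (h e x + t * xi e x)) 0 (xi e x)).
      { auto_derive; auto. ring. }
      destruct HF as (_ & _ & _ & Hch).
      assert (D := Hch _ _ 0 _ _ HX HY). cbv beta in D.
      rewrite !Rmult_0_l, !Rplus_0_r in D. apply D.
      apply Rle_lt_trans with k; [|lra]. now apply (V_bound rho sigma). }
    assert (E2 := is_derive_unique _ _ _ Hd).
    rewrite (is_derive_unique _ _ _ (Hb e x He)) in E2. rewrite E2. ring.
Qed.

(** First order: the variation from the unperturbed torus. *)
Lemma V_variation G Z :
  V s0 sigma0 C G -> 0 < k <= Z -> sigma + Z <= sigma0 -> Z <= s0 ->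
  V rho sigma (2 * C * (k / Z)) (fun e x => G (H e x) (x + h e x) - G 0 x).
Proof.
  intros HG Hk H1 H2.
  set (tau := Z / k).
  assert (Ht : 1 <= tau).
  { unfold tau. apply Rmult_le_reg_r with k; [lra|]. unfold Rdiv.
    rewrite Rmult_assoc, Rinv_l by lra. lra. }
  destruct (V_pos _ _ _ _ Hh) as (Hr & Hs & _).
  assert (Hdil : forall u, V rho sigma k u -> W tau rho sigma Z (fun t e x => t * u e x)).
  { intros u Hu. replace Z with (tau * k) at 1 by (unfold tau; field; lra).
    apply (W_mul _ _ _ _ _ (fun t _ _ => t) (fun _ => u)); [apply W_t; lra|].
    apply W_of_V; auto; lra. }
  assert (HU := W_comp tau rho sigma s0 sigma0 C G _ _ _ _ HG (Hdil _ Hh) (Hdil _ HH) H1 H2).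
  apply (V_ext _ _ _ (fun e x => G (1 * H e x) (x + 1 * h e x) - G (0 * H e x) (x + 0 * h e x))).
  - apply (V_le _ _ _ _ _ (W_taylor1 _ _ _ _ _ HU Ht)). right. unfold tau. field. lra.
  - intros e x He. now rewrite !Rmult_1_l, !Rmult_0_l, Rplus_0_r.
Qed.
End Compose.

(** * The Newton step *)

Lemma is_derive_Rplus (f g : R -> R) x a b :
  is_derive f x a -> is_derive g x b -> is_derive (fun y => f y + g y) x (a + b).
Proof. apply (is_derive_plus f g x a b). Qed.

Lemma is_derive_Rminus (f g : R -> R) x a b :
  is_derive f x a -> is_derive g x b -> is_derive (fun y => f y - g y) x (a - b).
Proof. apply (is_derive_minus f g x a b). Qed.

Lemma is_derive_Rid x : is_derive (fun y => y) x 1.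
Proof. auto_derive; auto. Qed.

Lemma is_derive_Rconst c x : is_derive (fun _ => c) x 0.
Proof. auto_derive; auto. Qed.

Lemma is_derive_Rscal (f : R -> R) x a c :
  is_derive f x a -> is_derive (fun y => c * f y) x (c * a).
Proof. apply (is_derive_scal f x c a). Qed.

Lemma is_derive_Rmult (f g : R -> R) x a b :
  is_derive f x a -> is_derive g x b -> is_derive (fun y => f y * g y) x (a * g x + f x * b).
Proof. intros H1 H2. apply (is_derive_mult f g x a b H1 H2). intros; apply Rmult_comm. Qed.

Lemma is_derive_translate (f : R -> R) x a c :
  is_derive f (x + c) a -> is_derive (fun y => f (y + c)) x a.
Proof.
  intros H. replace a with (1 * a) by ring.
  apply (is_derive_comp f (fun y => y + c) x a 1); auto. auto_derive; auto.
Qed.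

Lemma is_derive_inj (f : R -> R) x a b : is_derive f x a -> is_derive f x b -> a = b.
Proof.
  intros H1 H2. now rewrite <- (is_derive_unique _ _ _ H1), (is_derive_unique _ _ _ H2).
Qed.

(** Values at one point of the quantities of the Newton step: the suffix [s] is for the
    shifted angle, [I] is the inverse of [Xp], and [D1], [D2] are the derivatives of the errors.
    Differentiating the errors along the curve shows that the map sends the tangent [(Xp, Yp)]
    to [(Xs, Ys)] up to [(D1, D2)]. *)
Lemma newton_identity_1 A11 A12 Xp Xs Yp I Is p ps q E1 D1 rp :
  Is * Xs = 1 ->
  D1 = A11 * Xp + A12 * Yp - Xs -> ps - p = (E1 + A12 * q * I) * Is - rp ->
  A11 * (Xp * p) + A12 * (Yp * p + q * I) - Xs * ps + E1 = Xs * rp + D1 * p.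
Proof.
  intros HIs -> Hp. replace ps with (p + ((E1 + A12 * q * I) * Is - rp)) by lra.
  replace (Xs * (p + ((E1 + A12 * q * I) * Is - rp))) with
    (Xs * p + (E1 + A12 * q * I) * (Is * Xs) - Xs * rp) by ring.
  rewrite HIs. ring.
Qed.

(** The determinant condition turns the matrix acting on [q] into the identity. *)
Lemma newton_identity_2 A11 A12 A21 A22 Xp Xs Yp Ys I Is p ps q qs E1 E2 mu D1 D2 rp rq :
  I * Xp = 1 -> Is * Xs = 1 -> A11 * A22 - A12 * A21 = 1 ->
  D1 = A11 * Xp + A12 * Yp - Xs -> D2 = A21 * Xp + A22 * Yp - Ys ->
  ps - p = (E1 + A12 * q * I) * Is - rp ->
  qs - q = Xs * (E2 + mu) - Ys * E1 - rq ->
  A21 * (Xp * p) + A22 * (Yp * p + q * I) - (Ys * ps + qs * Is) + E2 + mu =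
  (Ys * (Xs * rp + D1 * p) + (Xs * D2 - Ys * D1) * p + (A12 * D2 - A22 * D1) * (q * I) + rq) * Is.
Proof.
  intros HI HIs Hdet -> -> Hp Hq.
  assert (HX : Xp <> 0) by (intros E; rewrite E in HI; lra).
  assert (HXs : Xs <> 0) by (intros E; rewrite E in HIs; lra).
  replace I with (/ Xp) in *.
  2: { apply (Rmult_eq_reg_r Xp); auto. rewrite HI. now rewrite Rinv_l. }
  replace Is with (/ Xs) in *.
  2: { apply (Rmult_eq_reg_r Xs); auto. rewrite HIs. now rewrite Rinv_l. }
  replace ps with (p + ((E1 + A12 * q * / Xp) * / Xs - rp)) by lra.
  replace qs with (q + (Xs * (E2 + mu) - Ys * E1 - rq)) by lra.
  apply Rminus_diag_uniq.
  match goal with |- ?l = 0 =>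
    replace l with ((A11 * A22 - A12 * A21 - 1) * (q * / Xs)) by (field; auto) end.
  rewrite Hdet. ring.
Qed.

Section Newton.
Context (w s0 sigma0 C Z : R) (a ae : R -> R) (f fe fx g ge gx : R -> R -> R).

Let om := 2 * PI * w.

(** Defects of invariance of the curve; the angle [x] cancels in the first one, which is
    therefore periodic. *)
Definition error1 (h H : R -> R -> R) (e x : R) : R :=
  h e x + a (H e x) + e * f (H e x) (x + h e x) - 2 * PI * w - h e (x + 2 * PI * w).

Definition error2 (h H : R -> R -> R) (lam : R -> R) (e x : R) : R :=
  H e x + e * g (H e x) (x + h e x) - H e (x + 2 * PI * w) + lam e.

Definition x_derivative (rho : R) (u du : R -> R -> R) : Prop :=
  forall e x, Rabs e <= rho -> is_derive (u e) x (du e x).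

(** A translated curve up to an error of size [er]: the counterterm [lam] translates the
    action, and is shown to vanish only for the exact solution. *)
Definition approximate (rho sigma k er : R) (h H dh dH : R -> R -> R) (lam : R -> R) : Prop :=
  V rho sigma k h /\ V rho sigma k H /\ V rho sigma k dh /\ V rho sigma k dH /\
  x_derivative rho h dh /\ x_derivative rho H dH /\
  V rho sigma er (error1 h H) /\ V rho sigma er (error2 h H lam).

Context (HC : 1 <= C) (HZ : 0 < Z) (Ha1 : 0 < ae 0).
Context (Da : C1_data s0 sigma0 C (fun e _ => a e) (fun e _ => ae e) (fun _ _ => 0)).
Context (Df : C1_data s0 sigma0 C f fe fx) (Dg : C1_data s0 sigma0 C g ge gx).

(** Bounds of [q] in units of [Gam er / d], of the corrections in units of [Gam^2 er / d], and of
    the new error. *)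
Definition newton_const2 : R := 6 + 196 * C / ae 0.
Definition newton_const3 : R := 392 * C + 2 * newton_const2.
Definition newton_const : R :=
  1600 * C + 24 * C * newton_const2 + 4 * C * (newton_const3 / Z) ^ 2 + newton_const3.

Lemma newton_const_bounds :
  6 <= newton_const2 /\ 1 <= newton_const3 /\ 1 <= newton_const /\ newton_const3 <= newton_const.
Proof.
  assert (H2 : 6 <= newton_const2).
  { unfold newton_const2. assert (0 <= 196 * C / ae 0) by (apply Rle_mult_inv_pos; lra). lra. }
  assert (H3 : 1 <= newton_const3) by (unfold newton_const3; lra).
  assert (0 <= 4 * C * (newton_const3 / Z) ^ 2).
  { apply Rmult_le_pos; [lra|apply pow2_ge_0]. }
  assert (0 <= 24 * C * newton_const2) by (apply Rmult_le_pos; lra).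
  repeat split; auto; unfold newton_const; lra.
Qed.

Context (rho sigma k er d Gam N : R) (h H dh dH : R -> R -> R) (lam : R -> R).
Context (Hrho : 0 < rho <= 1) (HrhoC : 2 * rho * C <= 1) (Hk : 0 < k <= / 2).
Context (HkZ : k <= Z) (Hs0 : k + Z <= s0) (Hsigma0 : sigma + k + Z <= sigma0).
Context (Hsmall : 4 * (2 * C * (k / Z)) + 8 * rho * C + 6 * k * ae 0 <= ae 0 / 2).
Context (Hdet : forall eps e x, Rabs eps <= rho -> Rabs e < s0 ->
  (1 + eps * fx e x) * (1 + eps * ge e x) - (ae e + eps * fe e x) * (eps * gx e x) = 1).
Context (HD : small_divisors w Gam N) (Hd : 0 < d <= 1) (Hds : 2 * d <= sigma) (Her : 0 < er).
Context (Hz : newton_const3 * (Gam ^ 2 * er / d) <= Z).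
Context (Happ : approximate rho sigma k er h H dh dH lam).

(** [P ^ 2] collects the quadratic terms (derivative of the error times correction, and Taylor
    remainder) and [T] the neglected high frequencies. *)
Lemma newton_step :
  let P := Gam ^ 2 * er / d in
  let T := exp (- (d * N)) * (Gam * er / d) in
  exists (xi eta dxi deta : R -> R -> R) (mu : R -> R),
    V rho (sigma - 2 * d) (newton_const * P) xi /\
    V rho (sigma - 2 * d) (newton_const * P) eta /\
    V rho (sigma - 2 * d) (newton_const * (P / d)) dxi /\
    V rho (sigma - 2 * d) (newton_const * (P / d)) deta /\
    V rho (sigma - 2 * d) (newton_const * P) (fun e _ => mu e) /\
    x_derivative rho xi dxi /\ x_derivative rho eta deta /\
    V rho (sigma - 2 * d) (newton_const * (P ^ 2 + T))
      (error1 (fun e x => h e x + xi e x) (fun e x => H e x + eta e x)) /\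
    V rho (sigma - 2 * d) (newton_const * (P ^ 2 + T))
      (error2 (fun e x => h e x + xi e x) (fun e x => H e x + eta e x)
        (fun e => lam e + mu e)).
Proof.
  intros P T. set (th := exp (- (d * N))) in *.
  destruct Happ as (Vh & VH & Vdh & VdH & Hdh & HdH & VE1 & VE2).
  destruct HD as (HG & HN & _).
  destruct newton_const_bounds as (HC2 & HC3 & HK & HK3).
  assert (Hth : 0 < th) by apply exp_pos.
  (* every norm below is bounded by a multiple of [Q], [P] or [T] *)
  set (Q := Gam * er / d) in *.
  assert (HDi : 1 <= / d).
  { rewrite <- Rinv_1. apply Rinv_le_contravar; lra. }
  assert (HeQ : Gam * er <= Q).
  { unfold Q, Rdiv. rewrite <- (Rmult_1_r (Gam * er)) at 1.
    apply Rmult_le_compat_l; [apply Rmult_le_pos; lra|auto]. }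
  assert (HeG : er <= Gam * er) by nra.
  assert (HeD : er / d <= Q).
  { unfold Q, Rdiv. apply Rmult_le_compat_r; lra. }
  assert (HQP : Q <= P).
  { replace P with (Gam * Q) by (unfold P, Q; field; lra). nra. }
  assert (HQ : 0 < Q) by lra.
  assert (HGQ : Gam * Q = P) by (unfold P, Q; field; lra).
  assert (HT : th * Q = T) by reflexivity.
  assert (HP : 0 < P) by lra.
  assert (HTp : 0 < T) by (rewrite <- HT; apply Rmult_lt_0_compat; lra).
  assert (VX : V rho sigma 2 (fun e x => 1 + dh e x)).
  { eapply V_le; [eapply (V_add _ _ _ _ (fun _ _ => 1) dh); [apply V_const; lra|exact Vdh]|].
    rewrite Rabs_R1. lra. }
  assert (HI : exists I, V rho sigma 2 I /\ V rho sigma (2 * k) (fun e x => I e x - 1) /\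
    forall e x, Rabs e <= rho -> I e x * (1 + dh e x) = 1).
  { exists (fun e x => / (1 + dh e x)).
    assert (VI : V rho sigma 2 (fun e x => / (1 + dh e x))).
    { eapply V_le; [eapply V_inv; [exact Vdh|lra]|].
      replace 2 with (/ (/ 2)) by field. apply Rinv_le_contravar; lra. }
    assert (Hne : forall e x, Rabs e <= rho -> 1 + dh e x <> 0).
    { intros e x He E. assert (Hb := V_bound _ _ _ _ e x Vdh He).
      replace (dh e x) with (-1) in Hb by lra. rewrite Rabs_left in Hb; lra. }
    split; [exact VI|]. split.
    - eapply (V_ext _ _ _ (fun e x => (- dh e x) * / (1 + dh e x))).
      + eapply V_le; [eapply V_mul; [eapply V_opp; exact Vdh|exact VI]|]. lra.
      + intros e x He. field. now apply Hne.
    - intros e x He. apply Rinv_l. now apply Hne. }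
  destruct HI as (I & VI & VI1 & HI).
  assert (HkH : forall e x, Rabs e <= rho -> Rabs (H e x) < s0).
  { intros e x He. apply Rle_lt_trans with k; [|lra]. now eapply (V_bound rho sigma). }
  assert (Vc : forall G, V s0 sigma0 C G -> V rho sigma (2 * C) (fun e x => G (H e x) (x + h e x))).
  { intros G HG'. eapply (V_comp s0 sigma0 C rho sigma k h H Vh VH G); auto; lra. }
  assert (Veps : V rho sigma rho (fun e _ => e)) by (apply V_eps; lra).
  assert (Vef : forall G, V s0 sigma0 C G ->
    V rho sigma 1 (fun e x => e * G (H e x) (x + h e x))).
  { intros G HG'. eapply V_le; [eapply (V_mul _ _ _ _ (fun e _ => e)); [exact Veps|apply Vc, HG']|].
    lra. }
  assert (V1 : V rho sigma 1 (fun _ _ => 1)).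
  { rewrite <- Rabs_R1 at 1. apply V_const; lra. }
  destruct Da as (Va & Vae & _ & Cha). destruct Df as (Vf & Vfe & Vfx & Chf).
  destruct Dg as (Vg & Vge & Vgx & Chg).
  assert (HA : exists A11 A12 A21 A22,
    (V rho sigma 2 A11 /\ V rho sigma (4 * C) A12 /\ V rho sigma 1 A21 /\ V rho sigma 2 A22) /\
    V rho sigma (2 * C * (k / Z) + 2 * rho * C) (fun e x => A12 e x - ae 0) /\
    (forall e x, A11 e x = 1 + e * fx (H e x) (x + h e x)) /\
    (forall e x, A12 e x = ae (H e x) + e * fe (H e x) (x + h e x)) /\
    (forall e x, A21 e x = e * gx (H e x) (x + h e x)) /\
    (forall e x, A22 e x = 1 + e * ge (H e x) (x + h e x))).
  { exists (fun e x => 1 + e * fx (H e x) (x + h e x)),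
      (fun e x => ae (H e x) + e * fe (H e x) (x + h e x)),
      (fun e x => e * gx (H e x) (x + h e x)), (fun e x => 1 + e * ge (H e x) (x + h e x)).
    assert (Hfe : V rho sigma (2 * rho * C) (fun e x => e * fe (H e x) (x + h e x))).
    { eapply V_le; [eapply (V_mul _ _ _ _ (fun e _ => e)); [exact Veps|apply Vc, Vfe]|]. lra. }
    split; [|split; [|auto]].
    - split; [|split; [|split]].
      + eapply V_le; [eapply (V_add _ _ _ _ _ _ V1 (Vef _ Vfx))|lra].
      + eapply V_le; [eapply (V_add _ _ _ _ _ _ (Vc _ Vae) Hfe)|lra].
      + apply Vef, Vgx.
      + eapply V_le; [eapply (V_add _ _ _ _ _ _ V1 (Vef _ Vge))|lra].
    - eapply (V_ext _ _ _ (fun e x => (ae (H e x) - ae 0) + e * fe (H e x) (x + h e x))).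
      + eapply V_add; auto.
        eapply (V_variation s0 sigma0 C rho sigma k h H Vh VH (fun e _ => ae e) Z); auto; lra.
      + intros; ring. }
  destruct HA as (A11 & A12 & A21 & A22 & (VA11 & VA12 & VA21 & VA22) & VA12d &
    EA11 & EA12 & EA21 & EA22).
  assert (Hdet' : forall e x, Rabs e <= rho ->
    A11 e x * A22 e x - A12 e x * A21 e x = 1).
  { intros e x He. rewrite EA11, EA12, EA21, EA22. apply Hdet; auto. }
  destruct (V_derive _ _ _ _ d VE1 ltac:(lra)) as (D1 & VD1 & HD1).
  destruct (V_derive _ _ _ _ d VE2 ltac:(lra)) as (D2 & VD2 & HD2).
  assert (ED1 : forall e x, Rabs e <= rho ->
    D1 e x = A11 e x * (1 + dh e x) + A12 e x * dH e x - (1 + dh e (x + om))).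
  { intros e x He. apply (is_derive_inj _ _ _ _ (HD1 e x He)).
    assert (HX : is_derive (fun y => y + h e y) x (1 + dh e x)).
    { apply is_derive_Rplus; [apply is_derive_Rid|now apply Hdh]. }
    replace (A11 e x * (1 + dh e x) + A12 e x * dH e x - (1 + dh e (x + om))) with
      (dh e x + (ae (H e x) * dH e x + 0 * (1 + dh e x)) +
       e * (fe (H e x) (x + h e x) * dH e x + fx (H e x) (x + h e x) * (1 + dh e x)) - 0 -
       dh e (x + om)) by (rewrite EA11, EA12; ring).
    unfold error1.
    apply is_derive_Rminus; [apply is_derive_Rminus; [apply is_derive_Rplus|]|].
    - apply is_derive_Rplus; [now apply Hdh|].
      apply (Cha (fun y => y + h e y) (H e)); auto.
    - apply is_derive_Rscal. apply (Chf (fun y => y + h e y) (H e)); auto.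
    - apply is_derive_Rconst.
    - apply is_derive_translate, Hdh; auto. }
  assert (ED2 : forall e x, Rabs e <= rho ->
    D2 e x = A21 e x * (1 + dh e x) + A22 e x * dH e x - dH e (x + om)).
  { intros e x He. apply (is_derive_inj _ _ _ _ (HD2 e x He)).
    assert (HX : is_derive (fun y => y + h e y) x (1 + dh e x)).
    { apply is_derive_Rplus; [apply is_derive_Rid|now apply Hdh]. }
    replace (A21 e x * (1 + dh e x) + A22 e x * dH e x - dH e (x + om)) with
      (dH e x + e * (ge (H e x) (x + h e x) * dH e x + gx (H e x) (x + h e x) * (1 + dh e x)) -
       dH e (x + om) + 0) by (rewrite EA21, EA22; ring).
    unfold error2.
    apply is_derive_Rplus; [apply is_derive_Rminus; [apply is_derive_Rplus|]|].
    - now apply HdH.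
    - apply is_derive_Rscal. apply (Chg (fun y => y + h e y) (H e)); auto.
    - apply is_derive_translate, HdH; auto.
    - apply is_derive_Rconst. }
  assert (VD1' : V rho (sigma - d) Q D1) by (eapply V_le; [exact VD1|exact HeD]).
  assert (VD2' : V rho (sigma - d) Q D2) by (eapply V_le; [exact VD2|exact HeD]).
  clear VD1 VD2 HD1 HD2.
  (* the equation for [q], up to the choice of its mean *)
  set (E1 := error1 h H) in *. set (E2 := error2 h H lam) in *.
  assert (VR : V rho sigma (3 * er)
    (fun e x => (1 + dh e (x + om)) * E2 e x - dH e (x + om) * E1 e x)).
  { eapply V_le; [eapply V_sub; eapply V_mul; [eapply (V_shift _ _ _ _ om VX)|exact VE2|
      eapply (V_shift _ _ _ _ om VdH)|exact VE1]|]. nra. }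
  destruct (V_cohomological _ _ w Gam N _ _ d HD VR ltac:(lra)) as (m1 & r1 & v1 & Vm1 & Vr1 & Vv1 & ER).
  destruct (V_cohomological _ _ w Gam N _ _ d HD Vh ltac:(lra)) as (h0 & rh & vh & _ & Vrh & Vvh & Eh).
  destruct (V_derive _ _ _ _ d Vrh ltac:(lra)) as (drh & Vdrh & Hdrh).
  destruct (V_derive _ _ _ _ d Vvh ltac:(lra)) as (dvh & Vdvh & Hdvh).
  fold th in Vr1, Vrh, Vdrh. fold om in ER, Eh.
  replace (sigma - d - d) with (sigma - 2 * d) in Vdrh by ring.
  (* the derivative of [h] has mean zero, hence is a coboundary *)
  assert (Edh : forall e x, Rabs e <= rho ->
    dh e x = drh e x + (dvh e (x + om) - dvh e x)).
  { intros e x He. apply (is_derive_inj (h e) x); [now apply Hdh|].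
    apply (is_derive_ext (fun y => h0 e + rh e y + (vh e (y + om) - vh e y))).
    - intros y. symmetry. now apply Eh.
    - replace (drh e x) with (0 + drh e x) by ring.
      apply is_derive_Rplus; [apply is_derive_Rplus|apply is_derive_Rminus].
      + apply is_derive_Rconst.
      + now apply Hdrh.
      + apply is_derive_translate. now apply Hdvh.
      + now apply Hdvh. }
  set (mu := fun e => - m1 e).
  assert (Vmu : V rho sigma (3 * er) (fun e _ => mu e)) by (eapply (V_opp _ _ _ _ Vm1)).
  assert (Vs : forall M u, V rho sigma M u -> V rho (sigma - d) M u).
  { intros M u Hu. eapply (V_strip _ sigma); auto; lra. }
  assert (Vs2 : forall M u, V rho (sigma - d) M u -> V rho (sigma - 2 * d) M u).
  { intros M u Hu. eapply (V_strip _ (sigma - d)); auto; lra. }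
  set (q1 := fun e x => v1 e x + mu e * dvh e (x + om)).
  set (rq := fun e x => r1 e x + mu e * drh e (x + om)).
  assert (Vq1 : V rho (sigma - d) (6 * Q) q1).
  { eapply V_le; [eapply V_add; [apply Vs; exact Vv1|
      eapply (V_mul _ _ _ _ (fun e _ => mu e)); [apply Vs; exact Vmu|
      eapply (V_shift _ _ _ _ om Vdvh)]]|].
    replace (Gam * (3 * er) + 3 * er * (Gam * k / d)) with (3 * (Gam * er) + 3 * (k * Q))
      by (unfold Q; field; lra). nra. }
  assert (Vrq : V rho (sigma - 2 * d) (6 * T) rq).
  { eapply V_le; [eapply V_add; [apply Vs2; exact Vr1|
      eapply (V_mul _ _ _ _ (fun e _ => mu e)); [apply Vs2, Vs; exact Vmu|
      eapply (V_shift _ _ _ _ om Vdrh)]]|].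
    replace (th * (3 * er) + 3 * er * (th * k / d)) with (th * (3 * er + 3 * (k * (er / d))))
      by (field; lra).
    rewrite <- HT. replace (6 * (th * Q)) with (th * (6 * Q)) by ring.
    apply Rmult_le_compat_l; [lra|]. nra. }
  assert (Eq1 : forall e x, Rabs e <= rho ->
    q1 e (x + om) - q1 e x =
    (1 + dh e (x + om)) * (E2 e x + mu e) - dH e (x + om) * E1 e x - rq e x).
  { intros e x He. unfold q1, rq.
    replace ((1 + dh e (x + om)) * (E2 e x + mu e) - dH e (x + om) * E1 e x) with
      (((1 + dh e (x + om)) * E2 e x - dH e (x + om) * E1 e x) +
       (1 + dh e (x + om)) * mu e) by ring.
    rewrite (ER e x He), (Edh e (x + om) He). unfold mu. ring. }
  (* the equation for [p]; the mean [c] of [q] makes it solvable *)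
  assert (VB : V rho (sigma - d) (98 * C * Q)
    (fun e x => (E1 e x + A12 e x * q1 e x * I e x) * I e (x + om))).
  { eapply V_le; [eapply V_mul; [eapply V_add; [apply Vs; exact VE1|eapply V_mul; [eapply V_mul;
      [apply Vs; exact VA12|exact Vq1]|apply Vs; exact VI]]|
      eapply (V_shift _ _ _ _ om (Vs _ _ VI))]|].
    assert (er <= C * Q) by nra. nra. }
  set (II := fun e x => I e x * I e (x + om)).
  assert (VII : V rho sigma 4 II).
  { eapply V_le; [eapply V_mul; [exact VI|eapply (V_shift _ _ _ _ om VI)]|lra]. }
  assert (VII1 : V rho sigma (6 * k) (fun e x => II e x - 1)).
  { eapply (V_ext _ _ _ (fun e x => (I e x - 1) * I e (x + om) + (I e (x + om) - 1))).
    - eapply V_le; [eapply V_add; [eapply V_mul; [exact VI1|eapply (V_shift _ _ _ _ om VI)]|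
        eapply (V_shift _ _ _ _ om VI1)]|lra].
    - intros; unfold II; ring. }
  assert (VA : V rho sigma (ae 0 / 2) (fun e x => A12 e x * II e x - ae 0)).
  { eapply (V_ext _ _ _ (fun e x => (A12 e x - ae 0) * II e x + ae 0 * (II e x - 1))).
    - eapply V_le; [eapply V_add; [eapply V_mul; [exact VA12d|exact VII]|eapply V_scal; exact VII1]|].
      rewrite Rabs_pos_eq by lra. lra.
    - intros; ring. }
  destruct (V_cohomological _ _ w Gam N _ _ d HD VB ltac:(lra)) as (mB & rB & vB & VmB & VrB & VvB & EB).
  destruct (V_cohomological _ _ w Gam N _ _ d HD VA ltac:(lra)) as (mA & rA & vA & VmA & VrA & VvA & EA).
  fold th in VrB, VrA. fold om in EB, EA.
  replace (sigma - d - d) with (sigma - 2 * d) in VrB by ring.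
  assert (Hc : exists c : R -> R, V rho (sigma - d) (196 * C * Q / ae 0) (fun e _ => c e) /\
    forall e, Rabs e <= rho -> mB e + c e * (ae 0 + mA e) = 0).
  { exists (fun e => - mB e * (/ ae 0 * / (1 + / ae 0 * mA e))).
    assert (VmA' : V rho sigma (/ 2) (fun e _ => / ae 0 * mA e)).
    { eapply V_le; [eapply (V_scal _ _ _ (/ ae 0) _ VmA)|].
      rewrite Rabs_pos_eq; [right; field; lra|]. left; now apply Rinv_0_lt_compat. }
    split.
    - eapply V_le; [eapply (V_mul _ _ _ _ (fun e _ => - mB e)); [eapply (V_opp _ _ _ _ VmB)|
        eapply (V_scal _ _ _ _ (fun e _ => / (1 + / ae 0 * mA e))), Vs;
        eapply (V_inv _ _ _ _ VmA'); lra]|].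
      rewrite Rabs_pos_eq; [right; field; lra|]. left; now apply Rinv_0_lt_compat.
    - intros e He.
      assert (Hb := V_bound _ _ _ _ e 0 VmA He). simpl in Hb. apply Rabs_le_between in Hb.
      field. split; lra. }
  destruct Hc as (c & Vc' & Ec).
  set (p := fun e x => vB e x + c e * vA e x).
  set (rp := fun e x => rB e x + c e * rA e x).
  set (q := fun e x => q1 e x + c e).
  assert (Vp : V rho (sigma - d) (196 * C * P) p).
  { eapply V_le; [eapply V_add; [exact VvB|eapply (V_mul _ _ _ _ (fun e _ => c e));
      [exact Vc'|apply Vs; exact VvA]]|].
    rewrite <- HGQ. right. field. lra. }
  assert (Vrp : V rho (sigma - 2 * d) (196 * C * T) rp).
  { eapply V_le; [eapply V_add; [exact VrB|eapply (V_mul _ _ _ _ (fun e _ => c e));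
      [apply Vs2; exact Vc'|apply Vs2; exact VrA]]|].
    rewrite <- HT. right. field. lra. }
  assert (Vq : V rho (sigma - d) (newton_const2 * Q) q).
  { eapply V_le; [eapply (V_add _ _ _ _ _ (fun e _ => c e) Vq1 Vc')|].
    unfold newton_const2. right. field. lra. }
  assert (Eq : forall e x, Rabs e <= rho -> q e (x + om) - q e x =
    (1 + dh e (x + om)) * (E2 e x + mu e) - dH e (x + om) * E1 e x - rq e x).
  { intros e x He. rewrite <- Eq1; auto. unfold q. ring. }
  assert (Ep : forall e x, Rabs e <= rho -> p e (x + om) - p e x =
    (E1 e x + A12 e x * q e x * I e x) * I e (x + om) - rp e x).
  { intros e x He. assert (H1 := EB e x He). assert (H2 := EA e x He). assert (H3 := Ec e He).
    unfold p, rp, q, II in *.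
    replace ((E1 e x + A12 e x * (q1 e x + c e) * I e x) * I e (x + om)) with
      ((E1 e x + A12 e x * q1 e x * I e x) * I e (x + om) +
       c e * ((A12 e x * (I e x * I e (x + om)) - ae 0) + ae 0)) by ring.
    rewrite H1, H2. replace (mB e) with (- (c e * (ae 0 + mA e))) by lra. ring. }
  set (xi := fun e x => (1 + dh e x) * p e x).
  set (eta := fun e x => dH e x * p e x + q e x * I e x).
  assert (Vxi : V rho (sigma - d) (newton_const3 * P) xi).
  { eapply V_le; [eapply V_mul; [apply Vs; exact VX|exact Vp]|].
    replace (2 * (196 * C * P)) with (392 * C * P) by ring.
    apply Rmult_le_compat_r; [lra|]. unfold newton_const3. lra. }
  assert (Veta : V rho (sigma - d) (newton_const3 * P) eta).
  { eapply V_le; [eapply V_add; eapply V_mul; [apply Vs; exact VdH|exact Vp|exact Vq|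
      apply Vs; exact VI]|].
    unfold newton_const3.
    assert (k * (196 * C * P) <= 196 * C * P).
    { rewrite <- (Rmult_1_l (196 * C * P)) at 2. apply Rmult_le_compat_r; [|lra].
      repeat apply Rmult_le_pos; lra. }
    assert (newton_const2 * Q <= newton_const2 * P) by (apply Rmult_le_compat_l; lra).
    assert (0 <= C * P) by (apply Rmult_le_pos; lra). nra. }
  destruct (V_derive _ _ _ _ d Vxi ltac:(lra)) as (dxi & Vdxi & Hdxi).
  destruct (V_derive _ _ _ _ d Veta ltac:(lra)) as (deta & Vdeta & Hdeta).
  replace (sigma - d - d) with (sigma - 2 * d) in Vdxi, Vdeta by ring.
  assert (HKP : newton_const3 * P <= newton_const * P) by (apply Rmult_le_compat_r; lra).
  assert (HKPd : newton_const3 * P / d <= newton_const * (P / d)).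
  { unfold Rdiv. rewrite Rmult_assoc. apply Rmult_le_compat_r; auto.
    apply Rmult_le_pos; [lra|]. left. apply Rinv_0_lt_compat; lra. }
  set (z := newton_const3 * P).
  assert (Hzp : 0 < z <= Z) by (split; [apply Rmult_lt_0_compat; lra|exact Hz]).
  assert (Htay : forall F Fe Fx, C1_data s0 sigma0 C F Fe Fx ->
    exists r, V rho (sigma - d) (2 * C * (z / Z) ^ 2) r /\
    forall e x, Rabs e <= rho ->
      F (H e x + eta e x) (x + h e x + xi e x) =
      F (H e x) (x + h e x) + Fe (H e x) (x + h e x) * eta e x +
      Fx (H e x) (x + h e x) * xi e x + r e x).
  { intros F Fe Fx HF. eapply (V_taylor s0 sigma0 C F Fe Fx HF rho (sigma - d) k h H); auto; lra. }
  destruct (Htay _ _ _ Da) as (ra & Vra & Era).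
  destruct (Htay _ _ _ Df) as (rf & Vrf & Erf).
  destruct (Htay _ _ _ Dg) as (rg & Vrg & Erg).
  assert (Hrz : (z / Z) ^ 2 = (newton_const3 / Z) ^ 2 * P ^ 2) by (unfold z; field; lra).
  assert (Vef2 : forall r, V rho (sigma - d) (2 * C * (z / Z) ^ 2) r ->
    V rho (sigma - 2 * d) (2 * C * (newton_const3 / Z) ^ 2 * P ^ 2) (fun e x => e * r e x)).
  { intros r Hr. eapply V_le; [eapply (V_mul _ _ _ _ (fun e _ => e));
      [apply Vs2, Vs; exact Veps|apply Vs2; exact Hr]|].
    rewrite Hrz. rewrite <- (Rmult_1_l (2 * C * (newton_const3 / Z) ^ 2 * P ^ 2)).
    apply Rmult_le_compat; try lra.
    apply Rmult_le_pos; [lra|]. apply Rmult_le_pos; apply pow2_ge_0. }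
  assert (VXs : V rho (sigma - 2 * d) 2 (fun e x => 1 + dh e (x + om)))
    by (eapply (V_shift _ _ _ _ om (Vs2 _ _ (Vs _ _ VX)))).
  assert (VYs : V rho (sigma - 2 * d) 1 (fun e x => dH e (x + om))).
  { eapply V_le; [eapply (V_shift _ _ _ _ om (Vs2 _ _ (Vs _ _ VdH)))|lra]. }
  set (W1 := fun e x => (1 + dh e (x + om)) * rp e x + D1 e x * p e x).
  assert (HPP : Q * P <= P ^ 2) by (simpl; nra).
  assert (HQQ : Q * Q <= P ^ 2) by (simpl; nra).
  assert (VW1 : V rho (sigma - 2 * d) (392 * C * T + 196 * C * P ^ 2) W1).
  { eapply V_le; [eapply V_add; eapply V_mul; [exact VXs|exact Vrp|apply Vs2; exact VD1'|
      apply Vs2; exact Vp]|].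
    assert (C * (Q * P) <= C * P ^ 2) by (apply Rmult_le_compat_l; lra). lra. }
  assert (HCT : 0 <= C * T) by (apply Rmult_le_pos; lra).
  assert (HCP : 0 <= C * P ^ 2) by (apply Rmult_le_pos; [lra|apply pow2_ge_0]).
  assert (HCC : 0 <= C * newton_const2 * P ^ 2)
    by (apply Rmult_le_pos; [apply Rmult_le_pos; lra|apply pow2_ge_0]).
  assert (HTT : T <= C * T) by nra.
  assert (HRp : 0 <= C * (newton_const3 / Z) ^ 2 * T).
  { apply Rmult_le_pos; [apply Rmult_le_pos; [lra|apply pow2_ge_0]|lra]. }
  assert (HRp2 : 0 <= C * newton_const2 * T).
  { apply Rmult_le_pos; [apply Rmult_le_pos; lra|lra]. }
  assert (HRp3 : 0 <= newton_const3 * (P ^ 2 + T)).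
  { apply Rmult_le_pos; [lra|]. assert (H1 := pow2_ge_0 P). lra. }
  assert (HRp4 : 0 <= C * (newton_const3 / Z) ^ 2 * P ^ 2).
  { apply Rmult_le_pos; [apply Rmult_le_pos; [lra|apply pow2_ge_0]|apply pow2_ge_0]. }
  exists xi, eta, dxi, deta, mu.
  split; [|split; [|split; [|split; [|split; [|split; [|split; [|split]]]]]]].
  - eapply V_le; [apply Vs2; exact Vxi|exact HKP].
  - eapply V_le; [apply Vs2; exact Veta|exact HKP].
  - eapply V_le; [exact Vdxi|exact HKPd].
  - eapply V_le; [exact Vdeta|exact HKPd].
  - eapply V_le; [apply Vs2, Vs; exact Vmu|].
    assert (1600 * C * P <= newton_const * P).
    { apply Rmult_le_compat_r; [lra|]. unfold newton_const.
      assert (0 <= 4 * C * (newton_const3 / Z) ^ 2).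
      { apply Rmult_le_pos; [lra|apply pow2_ge_0]. }
      assert (0 <= 24 * C * newton_const2) by (apply Rmult_le_pos; lra). lra. }
    assert (P <= C * P) by nra. lra.
  - exact Hdxi.
  - exact Hdeta.
  - eapply (V_ext _ _ _ (fun e x => W1 e x + (ra e x + e * rf e x))).
    + eapply V_le; [eapply V_add; [exact VW1|eapply V_add; [apply Vs2; exact Vra|
        apply Vef2; exact Vrf]]|].
      rewrite Hrz. unfold newton_const. lra.
    + intros e x He. unfold error1. fold om.
      assert (Ea := Era e x He). simpl in Ea. rewrite Rmult_0_l, Rplus_0_r in Ea.
      assert (Ef := Erf e x He).
      rewrite <- (Rplus_assoc x (h e x)), Ea, Ef.
      assert (HI1 := HI e (x + om) He).
      assert (Id := newton_identity_1 (A11 e x) (A12 e x) (1 + dh e x) (1 + dh e (x + om))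
        (dH e x) (I e x) (I e (x + om)) (p e x) (p e (x + om)) (q e x) (E1 e x) (D1 e x) (rp e x)
        HI1 (ED1 e x He) (Ep e x He)).
      unfold W1. rewrite <- Id, EA11, EA12. unfold E1, error1, xi, eta. fold om. ring.
  - eapply (V_ext _ _ _ (fun e x => (dH e (x + om) * W1 e x +
      ((1 + dh e (x + om)) * D2 e x - dH e (x + om) * D1 e x) * p e x +
      (A12 e x * D2 e x - A22 e x * D1 e x) * (q e x * I e x) + rq e x) * I e (x + om) +
      e * rg e x)).
    + eapply V_le; [eapply V_add; [eapply V_mul; [eapply V_add; [eapply V_add; [eapply V_add|]|]|]|
        apply Vef2; exact Vrg]|].
      * eapply V_mul; [exact VYs|exact VW1].
      * eapply V_mul; [eapply V_sub; eapply V_mul; [exact VXs|apply Vs2; exact VD2'|exact VYs|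
          apply Vs2; exact VD1']|apply Vs2; exact Vp].
      * eapply V_mul; [eapply V_sub; eapply V_mul; [apply Vs2, Vs; exact VA12|apply Vs2; exact VD2'|
          apply Vs2, Vs; exact VA22|apply Vs2; exact VD1']|
          eapply V_mul; [apply Vs2; exact Vq|apply Vs2, Vs; exact VI]].
      * exact Vrq.
      * eapply (V_shift _ _ _ _ om (Vs2 _ _ (Vs _ _ VI))).
      * assert (B1 : (2 * Q + 1 * Q) * (196 * C * P) <= 588 * (C * P ^ 2)).
        { assert (C * (Q * P) <= C * P ^ 2) by (apply Rmult_le_compat_l; lra). lra. }
        assert (B2 : (4 * C * Q + 2 * Q) * (newton_const2 * Q * 2) <= 12 * (C * newton_const2 * P ^ 2)).
        { assert (H1 : newton_const2 * (Q * Q) <= newton_const2 * P ^ 2)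
            by (apply Rmult_le_compat_l; lra).
          assert (H2 : C * (newton_const2 * (Q * Q)) <= C * (newton_const2 * P ^ 2))
            by (apply Rmult_le_compat_l; lra).
          assert (H3 : 0 <= newton_const2 * (Q * Q)).
          { apply Rmult_le_pos; [lra|]. apply Rmult_le_pos; lra. }
          assert (H4 : newton_const2 * (Q * Q) <= C * (newton_const2 * (Q * Q))) by nra.
          lra. }
        unfold newton_const. lra.
    + intros e x He. unfold error2. fold om.
      assert (Eg := Erg e x He).
      rewrite <- (Rplus_assoc x (h e x)), Eg.
      assert (Id := newton_identity_2 (A11 e x) (A12 e x) (A21 e x) (A22 e x) (1 + dh e x)
        (1 + dh e (x + om)) (dH e x) (dH e (x + om)) (I e x) (I e (x + om)) (p e x) (p e (x + om))
        (q e x) (q e (x + om)) (E1 e x) (E2 e x) (mu e) (D1 e x) (D2 e x) (rp e x) (rq e x)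
        (HI e x He) (HI e (x + om) He) (Hdet' e x He) (ED1 e x He) (ED2 e x He) (Ep e x He)
        (Eq e x He)).
      unfold W1. rewrite <- Id, EA21, EA22. unfold E2, error2, xi, eta. fold om. ring.
Qed.

End Newton.

(** * Continued fractions *)

Section ContinuedFraction.
Context (w : R) (Hw : irrational w).

Lemma frac_part_bounds r : 0 <= frac_part r < 1.
Proof. destruct (base_fp r); lra. Qed.

Lemma cf_rem_irrational n : irrational (cf_rem w n).
Proof.
  induction n as [|n IH]; [exact Hw|].
  intros p q Hq E. simpl in E. unfold frac_part in E.
  set (r := cf_rem w n) in *. set (m := Int_part r) in *.
  assert (Hp : IZR q <> 0) by now apply not_0_IZR.
  assert (Hne : r - IZR m <> 0).
  { intros E0. apply (IH m 1%Z); [discriminate|]. fold r. unfold Rdiv. rewrite Rinv_1. lra. }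
  assert (Hp0 : p <> 0%Z).
  { intros ->. apply (Rinv_neq_0_compat _ Hne). rewrite E. unfold Rdiv. ring. }
  assert (Hpr : IZR p <> 0) by now apply not_0_IZR.
  apply (IH (q + m * p)%Z p Hp0). fold r. rewrite plus_IZR, mult_IZR.
  assert (E' : r - IZR m = IZR q / IZR p).
  { rewrite <- (Rinv_inv (r - IZR m)), E. field. auto. }
  replace r with (IZR m + (r - IZR m)) by ring. rewrite E'. field. auto.
Qed.

Lemma cf_frac_pos n : 0 < frac_part (cf_rem w n) < 1.
Proof.
  destruct (frac_part_bounds (cf_rem w n)) as [[H|H] H1]; [lra|].
  exfalso. apply (cf_rem_irrational n (Int_part (cf_rem w n)) 1%Z); [discriminate|].
  unfold frac_part in H. unfold Rdiv. rewrite Rinv_1. lra.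
Qed.

Lemma cf_quot_pos n : (1 <= cf_quot w (S n))%Z.
Proof.
  unfold cf_quot. destruct (base_Int_part (cf_rem w (S n))) as [_ H].
  assert (H1 : 1 < cf_rem w (S n)).
  { simpl. assert (Hf := cf_frac_pos n). rewrite <- Rinv_1. apply Rinv_lt_contravar; lra. }
  assert (H2 : 0 < IZR (Int_part (cf_rem w (S n)))) by lra.
  apply lt_IZR in H2. lia.
Qed.

Lemma cf_den_step n :
  cf_den w (S (S n)) = (cf_quot w (S (S n)) * cf_den w (S n) + cf_den w n)%Z.
Proof. reflexivity. Qed.

Fixpoint cf_num (n : nat) : Z :=
  match n with
  | O => cf_quot w 0
  | S m =>
      match m with
      | O => (cf_quot w 1 * cf_quot w 0 + 1)%Z
      | S p => (cf_quot w n * cf_num m + cf_num p)%Z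
      end
  end.

Lemma cf_num_step n :
  cf_num (S (S n)) = (cf_quot w (S (S n)) * cf_num (S n) + cf_num n)%Z.
Proof. reflexivity. Qed.

Lemma cf_den_mono n : (1 <= cf_den w n /\ cf_den w n <= cf_den w (S n) /\
  Z.of_nat n <= cf_den w n /\ Z.of_nat (S n) <= cf_den w (S n))%Z.
Proof.
  induction n as [|n IH].
  - assert (H := cf_quot_pos 0). change (cf_den w 1) with (cf_quot w 1).
    change (cf_den w 0) with 1%Z. lia.
  - rewrite cf_den_step. assert (H := cf_quot_pos (S n)).
    destruct IH as (H1 & H2 & H3 & H4).
    assert (cf_den w (S n) <= cf_quot w (S (S n)) * cf_den w (S n))%Z by nia.
    lia.
Qed.

Lemma cf_det n :
  (cf_den w (S n) * cf_num n - cf_den w n * cf_num (S n) = 1 \/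
   cf_den w (S n) * cf_num n - cf_den w n * cf_num (S n) = -1)%Z.
Proof.
  induction n as [|n IH].
  - right. change (cf_den w 1) with (cf_quot w 1). change (cf_den w 0) with 1%Z.
    change (cf_num 1) with (cf_quot w 1 * cf_quot w 0 + 1)%Z.
    change (cf_num 0) with (cf_quot w 0). ring.
  - rewrite cf_den_step, cf_num_step.
    replace ((cf_quot w (S (S n)) * cf_den w (S n) + cf_den w n) * cf_num (S n) -
      cf_den w (S n) * (cf_quot w (S (S n)) * cf_num (S n) + cf_num n))%Z with
      (- (cf_den w (S n) * cf_num n - cf_den w n * cf_num (S n)))%Z by ring.
    lia.
Qed.

Definition cf_gap (n : nat) : R := IZR (cf_den w n) * w - IZR (cf_num n).

(** Consecutive gaps have opposite signs and decrease. *)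
Lemma cf_gap_step n : cf_gap (S n) = - cf_gap n * frac_part (cf_rem w (S n)).
Proof.
  induction n as [|n IH].
  - unfold cf_gap. change (cf_den w 1) with (cf_quot w 1). change (cf_den w 0) with 1%Z.
    change (cf_num 1) with (cf_quot w 1 * cf_quot w 0 + 1)%Z.
    change (cf_num 0) with (cf_quot w 0).
    rewrite plus_IZR, mult_IZR.
    assert (Hf := cf_frac_pos 0).
    assert (E0 : w - IZR (cf_quot w 0) = frac_part (cf_rem w 0)) by reflexivity.
    unfold frac_part at 1. fold (cf_quot w 1).
    assert (E1 : cf_rem w 1 * frac_part (cf_rem w 0) = 1) by (simpl; field; simpl in Hf; lra).
    replace (- (1 * w - IZR (cf_quot w 0)) * (cf_rem w 1 - IZR (cf_quot w 1))) with
      (IZR (cf_quot w 1) * (w - IZR (cf_quot w 0)) -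
       cf_rem w 1 * (w - IZR (cf_quot w 0))) by ring.
    rewrite E0, E1, <- E0. ring.
  - assert (Hf := cf_frac_pos (S n)).
    assert (E : cf_gap n = - cf_rem w (S (S n)) * cf_gap (S n)).
    { rewrite IH. change (cf_rem w (S (S n))) with (/ frac_part (cf_rem w (S n))). field. lra. }
    replace (cf_gap (S (S n))) with (IZR (cf_quot w (S (S n))) * cf_gap (S n) + cf_gap n).
    + rewrite E. unfold frac_part. fold (cf_quot w (S (S n))). ring.
    + unfold cf_gap. rewrite cf_den_step, cf_num_step, !plus_IZR, !mult_IZR. ring.
Qed.

Lemma cf_gap_abs n : Rabs (cf_gap (S n)) <= Rabs (cf_gap n).
Proof.
  rewrite cf_gap_step, Rabs_mult, Rabs_Ropp. assert (Hf := cf_frac_pos (S n)).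
  rewrite (Rabs_pos_eq (frac_part _)) by lra. assert (H := Rabs_pos (cf_gap n)). nra.
Qed.

Lemma cf_gap_opposite n : cf_gap n * cf_gap (S n) <= 0.
Proof.
  rewrite cf_gap_step. assert (Hf := cf_frac_pos (S n)). nra.
Qed.

Lemma Rabs_plus_same x y : 0 <= x * y -> Rabs (x + y) = Rabs x + Rabs y.
Proof.
  intros H. destruct (Rle_dec 0 x) as [Hx|Hx], (Rle_dec 0 y) as [Hy|Hy].
  - rewrite !Rabs_pos_eq; lra.
  - destruct Hx as [Hx|<-]; [nra|]. rewrite Rabs_R0, !Rplus_0_l. reflexivity.
  - destruct Hy as [Hy|<-]; [nra|]. rewrite Rabs_R0, !Rplus_0_r. reflexivity.
  - rewrite !Rabs_left; lra.
Qed.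

(** The determinant of consecutive convergents, expressed by the gaps. *)
Lemma cf_gap_lower n : 1 <= 2 * IZR (cf_den w (S n)) * Rabs (cf_gap n).
Proof.
  set (q := IZR (cf_den w n)). set (q' := IZR (cf_den w (S n))).
  destruct (cf_den_mono n) as (H1 & H2 & _).
  apply IZR_le in H1, H2. fold q in H1, H2. fold q' in H2.
  assert (E : Rabs (q' * cf_gap n + (- q) * cf_gap (S n)) = 1).
  { replace (q' * cf_gap n + (- q) * cf_gap (S n)) with
      (- IZR (cf_den w (S n) * cf_num n - cf_den w n * cf_num (S n))%Z).
    - destruct (cf_det n) as [E0|E0]; rewrite E0; rewrite Rabs_Ropp; [apply Rabs_R1|].
      rewrite Rabs_left; lra.
    - rewrite minus_IZR, !mult_IZR. unfold cf_gap, q, q'. ring. }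
  assert (H3 := cf_gap_abs n). assert (H4 := Rabs_pos (cf_gap (S n))).
  assert (H5 := Rabs_triang (q' * cf_gap n) (- q * cf_gap (S n))).
  rewrite E, !Rabs_mult, Rabs_Ropp, (Rabs_pos_eq q), (Rabs_pos_eq q') in H5 by lra.
  assert (q * Rabs (cf_gap (S n)) <= q' * Rabs (cf_gap n)) by (apply Rmult_le_compat; lra).
  lra.
Qed.

(** Best approximation: an integer pair is an integral combination of two consecutive
    convergents, and the two contributions to the gap do not cancel. *)
Lemma cf_best_approximation n (k p : Z) :
  (0 < k < cf_den w (S n))%Z -> Rabs (cf_gap n) <= Rabs (IZR k * w - IZR p).
Proof.
  intros Hk.
  assert (Hxy : exists x y : Z, (k = x * cf_den w n + y * cf_den w (S n))%Z /\
    (p = x * cf_num n + y * cf_num (S n))%Z).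
  { set (q := cf_den w n). set (q' := cf_den w (S n)). set (r := cf_num n).
    set (r' := cf_num (S n)).
    destruct (cf_det n) as [E|E]; fold q q' r r' in E.
    - exists (p * q' - k * r')%Z, (k * r - p * q)%Z. split.
      + replace ((p * q' - k * r') * q + (k * r - p * q) * q')%Z with
          (k * (q' * r - q * r'))%Z by ring. rewrite E. ring.
      + replace ((p * q' - k * r') * r + (k * r - p * q) * r')%Z with
          (p * (q' * r - q * r'))%Z by ring. rewrite E. ring.
    - exists (k * r' - p * q')%Z, (p * q - k * r)%Z. split.
      + replace ((k * r' - p * q') * q + (p * q - k * r) * q')%Z with
          (- k * (q' * r - q * r'))%Z by ring. rewrite E. ring.
      + replace ((k * r' - p * q') * r + (p * q - k * r) * r')%Z with
          (- p * (q' * r - q * r'))%Z by ring. rewrite E. ring. }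
  destruct Hxy as (x & y & Ek & Ep).
  assert (E : IZR k * w - IZR p = IZR x * cf_gap n + IZR y * cf_gap (S n)).
  { rewrite Ek, Ep, !plus_IZR, !mult_IZR. unfold cf_gap. ring. }
  destruct (cf_den_mono n) as (H1 & H2 & _).
  assert (Hx : x <> 0%Z).
  { intros ->. assert (y <= 0 \/ 1 <= y)%Z by lia. nia. }
  assert (Hsign : (x * y <= 0)%Z).
  { destruct (Z.le_gt_cases x 0), (Z.le_gt_cases y 0); nia. }
  assert (Hsame : 0 <= (IZR x * cf_gap n) * (IZR y * cf_gap (S n))).
  { replace ((IZR x * cf_gap n) * (IZR y * cf_gap (S n))) with
      (IZR (x * y) * (cf_gap n * cf_gap (S n))) by (rewrite mult_IZR; ring).
    apply IZR_le in Hsign. assert (Ho := cf_gap_opposite n). nra. }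
  rewrite E, Rabs_plus_same by exact Hsame.
  assert (H3 : 1 <= Rabs (IZR x)).
  { rewrite <- abs_IZR. apply IZR_le. lia. }
  rewrite (Rabs_mult (IZR x)).
  assert (H4 := Rabs_pos (cf_gap n)). assert (H5 := Rabs_pos (IZR y * cf_gap (S n))). nra.
Qed.

Lemma Rabs_sin_PI_Z x (p : Z) : Rabs (sin (x + IZR p * PI)) = Rabs (sin x).
Proof.
  assert (Hn : forall n y, Rabs (sin (y + INR n * PI)) = Rabs (sin y)).
  { induction n as [|n IH]; intros y; [simpl; f_equal; f_equal; ring|].
    rewrite S_INR. replace (y + (INR n + 1) * PI) with ((y + INR n * PI) + PI) by ring.
    rewrite neg_sin, Rabs_Ropp. apply IH. }
  destruct (Z.le_gt_cases 0 p).
  - rewrite <- (Z2Nat.id p) by auto. rewrite <- INR_IZR_INZ. apply Hn.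
  - rewrite <- (Hn (Z.to_nat (- p)) (x + IZR p * PI)).
    rewrite INR_IZR_INZ, Z2Nat.id, opp_IZR by lia. do 2 f_equal. ring.
Qed.

(** [2 / 5] is below the optimal [2 / PI] and is reached by the Taylor polynomial of degree 7. *)
Lemma sin_lower x : 0 <= x <= PI / 2 -> 2 / 5 * x <= sin x.
Proof.
  intros [H1 H2]. assert (H3 := PI_4). assert (H4 := PI_RGT_0).
  destruct (SIN x H1 ltac:(lra)) as [H _].
  eapply Rle_trans; [|exact H].
  unfold sin_lb, sin_approx, sin_term. simpl.
  set (s := x * x).
  assert (Hs : 0 <= s <= 4) by (unfold s; nra).
  assert (Hp : 2 / 5 <= 1 - s / 6 + s ^ 2 / 120 - s ^ 3 / 5040).
  { simpl. nra. }
  apply Rle_trans with (x * (1 - s / 6 + s ^ 2 / 120 - s ^ 3 / 5040)).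
  - rewrite Rmult_comm. now apply Rmult_le_compat_l.
  - right. unfold s. field.
Qed.

Lemma cf_small_divisor n (k : nat) :
  (0 < Z.of_nat k < cf_den w (S n))%Z ->
  1 <= IZR (cf_den w (S n)) * Rabs (2 * sin (PI * (INR k * w))).
Proof.
  intros Hk.
  set (t := INR k * w). set (p := Int_part (t + / 2)).
  assert (Hp : Rabs (t - IZR p) <= / 2).
  { destruct (base_Int_part (t + / 2)) as [H1 H2]. fold p in H1, H2. apply Rabs_le. lra. }
  assert (Hg : Rabs (cf_gap n) <= Rabs (t - IZR p)).
  { unfold t. rewrite INR_IZR_INZ. now apply cf_best_approximation. }
  assert (Hl := cf_gap_lower n).
  set (q := IZR (cf_den w (S n))) in *.
  assert (Hq : 0 < q).
  { apply IZR_lt. destruct (cf_den_mono (S n)). lia. }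
  replace (PI * t) with (PI * (t - IZR p) + IZR p * PI) by ring.
  rewrite Rabs_mult, Rabs_sin_PI_Z, (Rabs_pos_eq 2) by lra.
  set (u := t - IZR p) in *.
  assert (Hpi := PI2_3_2). assert (Hpi4 := PI_4).
  assert (Hs : 2 / 5 * (PI * Rabs u) <= Rabs (sin (PI * u))).
  { assert (Hu := Rabs_pos u).
    replace (Rabs (sin (PI * u))) with (Rabs (sin (PI * Rabs u))).
    - eapply Rle_trans; [apply sin_lower; nra|apply Rle_abs].
    - unfold Rabs at 2. destruct (Rcase_abs u); auto.
      replace (PI * - u) with (- (PI * u)) by ring. now rewrite sin_neg, Rabs_Ropp. }
  assert (Hu : 1 <= 2 * q * Rabs u).
  { eapply Rle_trans; [exact Hl|]. apply Rmult_le_compat_l; lra. }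
  assert (3 * Rabs u <= PI * Rabs u) by (apply Rmult_le_compat_r; [apply Rabs_pos|lra]).
  nra.
Qed.

End ContinuedFraction.

(** * Bryuno's condition and geometric scales *)

(** The first scale above [q] is at least [q], and the sum of the geometric series with ratio
    [4 / 5] is five times its first term. *)
Lemma geometric_tail (q : R) :
  1 <= q ->
  exists l : R, is_series (fun m => if Rle_dec q ((5 / 4) ^ m) then / (5 / 4) ^ m else 0) l /\
    l <= 5 / q.
Proof.
  intros Hq. set (x := fun m => if Rle_dec q ((5 / 4) ^ m) then / (5 / 4) ^ m else 0).
  assert (Hpos : forall m, 0 < (5 / 4) ^ m) by (intros; apply pow_lt; lra).
  apply is_series_bounded.
  - intros m. destruct Rle_dec; [|lra]. left. now apply Rinv_0_lt_compat.
  - fold x.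
    assert (H : forall M, sum_n x M <=
      if Rle_dec q ((5 / 4) ^ M) then 5 / q - 4 * / (5 / 4) ^ M else 0).
    { assert (Hfirst : forall M, q <= (5 / 4) ^ M -> / (5 / 4) ^ M <= / q).
      { intros M HM. apply Rinv_le_contravar; lra. }
      induction M as [|M IH].
      - rewrite sum_O. unfold x. destruct Rle_dec as [H|H]; [|lra].
        assert (H1 := Hfirst _ H). lra.
      - rewrite sum_Sn.
        match goal with |- plus ?a ?b <= _ => change (plus a b) with (a + b) end.
        unfold x at 2.
        assert (E : / (5 / 4) ^ M = 5 / 4 * / (5 / 4) ^ S M).
        { simpl. assert (H := Hpos M). field. lra. }
        destruct (Rle_dec q ((5 / 4) ^ S M)) as [H1|H1], (Rle_dec q ((5 / 4) ^ M)) as [H2|H2].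
        + rewrite E in IH. lra.
        + assert (H3 := Hfirst _ H1). lra.
        + exfalso. apply H1. simpl. assert (H := Hpos M). lra.
        + lra. }
    intros M. eapply Rle_trans; [apply H|]. destruct Rle_dec.
    + assert (0 < / (5 / 4) ^ M) by now apply Rinv_0_lt_compat. lra.
    + apply Rle_mult_inv_pos; lra.
Qed.

(** Along the scales [(5/4)^m] the logarithms of the small divisors are summable with
    weights [(4/5)^m]; each denominator [q_n] contributes at most [5 / q_n] by
    [geometric_tail]. *)
Lemma bryuno_scales w :
  bryuno w ->
  exists L : nat -> R,
    (forall m, 0 <= L m) /\ (forall m, small_divisors w (exp (L m)) ((5 / 4) ^ m)) /\
    ex_series (fun m => L m / (5 / 4) ^ m).
Proof.
  intros [Hw [B HB]].
  assert (Hpos : forall m, 0 < (5 / 4) ^ m) by (intros; apply pow_lt; lra).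
  assert (Hq1 : forall n, 1 <= IZR (cf_den w n)).
  { intros n. apply IZR_le, cf_den_mono, Hw. }
  set (b := fun n => ln (IZR (cf_den w (S n)))).
  assert (Hb : forall n, 0 <= b n).
  { intros n. unfold b. rewrite <- ln_1. apply Rcomplements.ln_le; [lra|apply Hq1]. }
  set (x := fun n m => b n *
    (if Rle_dec (IZR (cf_den w n)) ((5 / 4) ^ m) then / (5 / 4) ^ m else 0)).
  assert (Hx0 : forall n m, 0 <= x n m).
  { intros n m. apply Rmult_le_pos; auto. destruct Rle_dec; [|lra].
    left; now apply Rinv_0_lt_compat. }
  destruct (functional_choice _ (fun n => geometric_tail _ (Hq1 n))) as [l Hl].
  assert (Hrow : forall n, is_series (x n) (b n * l n)) by (intros n; apply is_series_Rmult, Hl).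
  destruct (is_series_nonneg_dominated (fun n => b n * l n) _ _
    (is_series_Rmult 5 _ _ HB)) as [S [HS _]].
  { intros n. split.
    - apply (is_series_ge0 _ _ (Hrow n)). auto.
    - destruct (Hl n) as [_ H]. fold (b n).
      replace (5 * (/ IZR (cf_den w n) * b n)) with (b n * (5 / IZR (cf_den w n)))
        by (unfold Rdiv; ring).
      now apply Rmult_le_compat_l. }
  assert (Hxx : forall n m, Rabs (x n m) <= x n m).
  { intros n m. rewrite Rabs_pos_eq; auto. lra. }
  destruct (is_series_swap x x _ _ S S Hxx Hrow HS Hrow HS) as [D [HD1 HD2]].
  exists (fun m => (5 / 4) ^ m * D m).
  assert (HD0 : forall m, 0 <= D m) by (intros m; apply (is_series_ge0 _ _ (HD1 m)); auto).
  assert (HL0 : forall m, 0 <= (5 / 4) ^ m * D m).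
  { intros m. apply Rmult_le_pos; auto. left; auto. }
  split; [exact HL0|]. split.
  - intros m. split; [now apply exp_ge1|]. split; [auto|].
    intros k Hk HkN.
    assert (Hn : exists n, (cf_den w n <= Z.of_nat k < cf_den w (Datatypes.S n))%Z).
    { assert (Hex : exists n, (Z.of_nat k < cf_den w (Datatypes.S n))%Z).
      { exists k. destruct (cf_den_mono w Hw k) as (_ & _ & _ & H). lia. }
      destruct (Wf_nat.dec_inh_nat_subset_has_unique_least_element
        (fun n => (Z.of_nat k < cf_den w (Datatypes.S n))%Z)) as [n [[Hn1 Hn2] _]]; auto.
      { intros n. apply classic. }
      exists n. split; auto. destruct n as [|n].
      - change (cf_den w 0) with 1%Z. lia.
      - apply Z.nlt_ge. intros Hlt. specialize (Hn2 n Hlt). lia. }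
    destruct Hn as [n [Hn1 Hn2]].
    assert (Hsd := cf_small_divisor w Hw n k ltac:(lia)).
    eapply Rle_trans; [exact Hsd|]. apply Rmult_le_compat_r; [apply Rabs_pos|].
    rewrite <- (exp_ln (IZR (cf_den w (Datatypes.S n)))) by (assert (H := Hq1 (Datatypes.S n)); lra).
    apply exp_le. fold (b n).
    assert (Hterm : x n m <= D m) by (apply (term_le_series (fun n => x n m)); auto).
    unfold x in Hterm. destruct Rle_dec as [Hle|Hnle].
    + assert (H := Hpos m). apply Rmult_le_reg_r with (/ (5 / 4) ^ m).
      * now apply Rinv_0_lt_compat.
      * replace ((5 / 4) ^ m * D m * / (5 / 4) ^ m) with (D m : R);
          [exact Hterm|]. change ((D m : R) = (5 / 4) ^ m * D m * / (5 / 4) ^ m).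
        symmetry. rewrite (Rmult_comm _ (D m : R)), Rmult_assoc, Rinv_r by lra. apply Rmult_1_r.
    + exfalso. apply Hnle. apply IZR_le in Hn1. rewrite <- INR_IZR_INZ in Hn1. lra.
  - exists S. apply (is_series_eq _ _ _ _ HD2); auto.
    intros m. assert (H := Hpos m).
    change ((D m : R) = (5 / 4) ^ m * D m / (5 / 4) ^ m). generalize (D m : R). intros y.
    field. lra.
Qed.

(** * Convergence of the Newton iteration *)

Lemma is_series_tail (u : nat -> R) (S : R) (i : nat) :
  (forall n, 0 <= u n) -> is_series u S ->
  exists l : R, is_series (fun m => u (m + i)%nat) l /\ 0 <= l <= S.
Proof.
  intros Hp HS. induction i as [|i [l [Hl Hb]]].
  - exists S. split; [|split; [now apply (is_series_ge0 u)|lra]].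
    apply (is_series_eq _ _ _ _ HS); auto. intros n. now rewrite Nat.add_0_r.
  - exists (l - u i). assert (Hl' : is_series (fun m => u (m + Datatypes.S i)%nat) (l - u i)).
    { apply (is_series_eq (fun k => u (Datatypes.S k + i)%nat) _ (l - u i)); auto.
      - apply (is_series_incr_1 (fun m => u (m + i)%nat)).
        apply (is_series_eq _ _ _ _ Hl); auto.
        assert (E : (l : R) = (l - u i) + u i) by ring. exact E.
      - intros n. f_equal. lia. }
    split; auto. split; [now apply (is_series_ge0 _ _ Hl')|]. specialize (Hp i). lra.
Qed.

(** Each term is spread over the earlier indices with ratio [5/6], so that the majorant does not
    jump when the sequence does. *)
Lemma summable_majorant (b : nat -> R) :
  (forall m, 0 <= b m) -> ex_series b ->
  exists dl : nat -> R, ex_series dl /\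
    (forall m, b m <= dl m) /\ (forall m, 5 / 6 * dl (S m) <= dl m).
Proof.
  intros Hb [S HS].
  destruct (functional_choice _ (fun i => is_series_tail b S i Hb HS)) as [l Hl].
  set (x := fun i m => (5 / 6) ^ i * b (m + i)%nat).
  assert (Hp : forall i, 0 < (5 / 6) ^ i) by (intros; apply pow_lt; lra).
  assert (Hx0 : forall i m, 0 <= x i m).
  { intros i m. apply Rmult_le_pos; auto. left; auto. }
  assert (Hrow : forall i, is_series (x i) ((5 / 6) ^ i * l i))
    by (intros i; apply is_series_Rmult, Hl).
  assert (Hgeo : is_series (fun i => S * (5 / 6) ^ i) (S * / (1 - 5 / 6))).
  { apply is_series_Rmult, is_series_geom. rewrite Rabs_pos_eq; lra. }
  destruct (is_series_nonneg_dominated (fun i => (5 / 6) ^ i * l i) _ _ Hgeo) as [T [HT _]].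
  { intros i. destruct (Hl i) as [_ H1]. specialize (Hp i). split; [apply Rmult_le_pos; lra|].
    rewrite Rmult_comm. apply Rmult_le_compat_r; lra. }
  assert (Hxx : forall i m, Rabs (x i m) <= x i m).
  { intros i m. rewrite Rabs_pos_eq; auto. lra. }
  destruct (is_series_swap x x _ _ T T Hxx Hrow HT Hrow HT) as [D [HD1 HD2]].
  exists D. split; [now exists T|].
  assert (E : forall m, b m + 5 / 6 * D (Datatypes.S m) = D m).
  { intros m.
    assert (H1 := is_series_Rmult (5 / 6) _ _ (HD1 (Datatypes.S m))).
    assert (H2 : is_series (fun i => x (Datatypes.S i) m) (5 / 6 * D (Datatypes.S m))).
    { apply (is_series_eq _ _ _ _ H1); auto. intros i. unfold x.
      rewrite Nat.add_succ_comm. simpl. ring. }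
    apply (is_series_inj (fun i => x i m)); [|apply HD1].
    apply is_series_decr_1.
    apply (is_series_eq _ _ _ _ H2); auto.
    unfold x. simpl. rewrite Nat.add_0_r, Rmult_1_l.
    assert (E : forall y z : R, y = z + y + - z) by (intros; ring). apply E. }
  assert (HD0 : forall m, 0 <= D m) by (intros m; apply (is_series_ge0 _ _ (HD1 m)); auto).
  split; intros m; specialize (E m); specialize (HD0 (Datatypes.S m)); specialize (Hb m); lra.
Qed.

(** The sequences which govern the iteration: the error at step [m] is [exp (- Lam m)], and
    the strip shrinks by [2 Lam m / (5/4)^m], so that the truncation error is again
    [exp (- Lam m)].  The growth rate [3/2] is below the factor [2] of Newton's method and
    above the ratio [5/4] of the scales. *)
Lemma newton_scales w K :
  bryuno w -> 1 <= K ->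
  exists L Lam : nat -> R,
    (forall m, small_divisors w (exp (L m)) ((5 / 4) ^ m)) /\
    (forall m, 1 <= Lam m) /\
    ex_series (fun m => Lam m / (5 / 4) ^ m) /\
    (forall m, Lam (S m) <= 3 / 2 * Lam m) /\
    (forall m, 2 * K * exp (L m) ^ 4 * ((5 / 4) ^ m) ^ 2 <= exp (Lam m / 2)) /\
    (forall m, exp (- (Lam m / 2)) <= (16 / 25) ^ m).
Proof.
  intros Hw HK. destruct (bryuno_scales w Hw) as (L & HL0 & HL & HLs).
  assert (Hpos : forall m, 0 < (5 / 4) ^ m) by (intros; apply pow_lt; lra).
  set (b := fun m => 2 * ln (2 * K) + 2 + 8 * L m + INR m).
  assert (Hln : 0 <= ln (2 * K)).
  { rewrite <- ln_1. apply Rcomplements.ln_le; lra. }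
  assert (Hb : forall m, 2 <= b m).
  { intros m. unfold b. specialize (HL0 m). assert (H := pos_INR m). lra. }
  assert (Hm : forall m, INR m <= 9 * (10 / 9) ^ m).
  { induction m as [|m IH]; [simpl; lra|]. rewrite S_INR. simpl.
    assert (1 <= (10 / 9) ^ m) by (apply pow_R1_Rle; lra). lra. }
  destruct (summable_majorant (fun m => b m / (5 / 4) ^ m)) as (dl & Hdl & Hbd & Hrate).
  - intros m. apply Rle_mult_inv_pos; auto. specialize (Hb m); lra.
  - destruct HLs as [S HS].
    assert (G1 := is_series_Rmult (2 * ln (2 * K) + 2) _ _ (is_series_geom (4 / 5)
      ltac:(rewrite Rabs_pos_eq; lra))).
    assert (G2 := is_series_Rmult 9 _ _ (is_series_geom (8 / 9)
      ltac:(rewrite Rabs_pos_eq; lra))).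
    assert (G3 := is_series_Rmult 8 _ _ HS).
    assert (G := is_series_Rplus _ _ _ _ (is_series_Rplus _ _ _ _ G1 G3) G2).
    eapply (ex_series_le (V := R_CompleteNormedModule)); [|eexists; exact G].
    intros m. change (norm (b m / (5 / 4) ^ m)) with (Rabs (b m / (5 / 4) ^ m)).
    rewrite Rabs_pos_eq.
    2: { apply Rle_mult_inv_pos; auto. specialize (Hb m); lra. }
    replace ((4 / 5) ^ m) with (/ (5 / 4) ^ m).
    2: { rewrite <- pow_inv. f_equal. field. }
    replace ((8 / 9) ^ m) with ((10 / 9) ^ m * / (5 / 4) ^ m).
    2: { rewrite <- pow_inv, <- Rpow_mult_distr. f_equal. field. }
    unfold b, Rdiv. assert (Hi := Rinv_0_lt_compat _ (Hpos m)). specialize (Hm m). nra.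
  - assert (Hbm : forall m, b m <= dl m * (5 / 4) ^ m).
    { intros m. specialize (Hbd m). specialize (Hpos m).
      apply Rmult_le_reg_r with (/ (5 / 4) ^ m); [now apply Rinv_0_lt_compat|].
      rewrite Rmult_assoc, Rinv_r, Rmult_1_r by lra. exact Hbd. }
    assert (Hexp : forall m, (5 / 4) ^ m <= exp (INR m / 4)).
    { intros m. replace (INR m / 4) with (INR m * (1 / 4)) by field.
      induction m as [|m IH].
      - simpl. rewrite Rmult_0_l, exp_0. lra.
      - rewrite S_INR, Rmult_plus_distr_r, Rmult_1_l, exp_plus, Rmult_comm. simpl.
        rewrite Rmult_comm. specialize (Hpos m).
        assert (H := exp_ineq1_le (1 / 4)). rewrite Rmult_comm.
        apply Rmult_le_compat; lra. }
    exists L, (fun m => dl m * (5 / 4) ^ m).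
    split; [exact HL|]. split; [|split; [|split; [|split]]].
    + intros m. specialize (Hb m). specialize (Hbm m). lra.
    + apply (ex_series_ext dl); auto. intros m.
      assert (E : forall y z : R, 0 < z -> y = y * z / z) by (intros; field; lra).
      now apply E.
    + intros m. simpl. specialize (Hrate m). specialize (Hpos m). nra.
    + intros m. apply Rle_trans with (exp (b m / 2)).
      * unfold b. replace ((2 * ln (2 * K) + 2 + 8 * L m + INR m) / 2) with
          (ln (2 * K) + (L m + L m + L m + L m) + (1 + (INR m / 4 + INR m / 4))) by field.
        rewrite !exp_plus, exp_ln by lra.
        assert (H1 := exp_pos (L m)). assert (H2 := Hexp m). assert (H3 := Hpos m).
        assert (H4 := exp_ineq1_le 1).
        replace (2 * K * exp (L m) ^ 4 * ((5 / 4) ^ m) ^ 2) with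
          (2 * K * (exp (L m) * exp (L m) * exp (L m) * exp (L m)) *
           (1 * ((5 / 4) ^ m * (5 / 4) ^ m))) by ring.
        apply Rmult_le_compat_l.
        { repeat apply Rmult_le_pos; lra. }
        apply Rmult_le_compat; [lra|apply Rmult_le_pos; lra|lra|apply Rmult_le_compat; lra].
      * apply exp_le. specialize (Hbm m). lra.
    + intros m. rewrite exp_Ropp.
      replace (16 / 25) with (/ (5 / 4 * (5 / 4))) by field.
      rewrite pow_inv, Rpow_mult_distr.
      assert (H3 := Hpos m).
      apply Rinv_le_contravar; [nra|].
      apply Rle_trans with (exp (b m / 2)).
      * apply Rle_trans with (exp (INR m / 4 + INR m / 4)).
        { rewrite exp_plus. assert (H2 := Hexp m). apply Rmult_le_compat; lra. }
        apply exp_le. unfold b. specialize (HL0 m). lra.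
      * apply exp_le. specialize (Hbm m). lra.
Qed.

Lemma dependent_choice (A : Type) (Inv : nat -> A -> Prop) (Rel : nat -> A -> A -> Prop) (a0 : A) :
  Inv 0%nat a0 -> (forall n a, Inv n a -> exists a', Inv (S n) a' /\ Rel n a a') ->
  exists s : nat -> A, s 0%nat = a0 /\ forall n, Inv n (s n) /\ Rel n (s n) (s (S n)).
Proof.
  intros H0 Hn.
  set (next := fun n a => epsilon (inhabits a0) (fun a' => Inv (S n) a' /\ Rel n a a')).
  set (s := fix s n := match n with O => a0 | S n => next n (s n) end).
  assert (Hs : forall n, Inv n (s n)).
  { induction n as [|n IH]; [exact H0|]. simpl.
    apply (epsilon_spec (inhabits a0) (fun a' => Inv (S n) a' /\ Rel n (s n) a') (Hn n _ IH)). }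
  exists s. split; [reflexivity|]. intros n. split; [apply Hs|].
  apply (epsilon_spec (inhabits a0) (fun a' => Inv (S n) a' /\ Rel n (s n) a') (Hn n _ (Hs n))).
Qed.

Lemma C1_data_lipschitz s0 sigma0 C F Fe Fx y y' x x' :
  C1_data s0 sigma0 C F Fe Fx -> Rabs y < s0 -> Rabs y' < s0 ->
  Rabs (F y' x' - F y x) <= C * (Rabs (y' - y) + Rabs (x' - x)).
Proof.
  intros (HF & HFe & HFx & Hch) Hy Hy'.
  assert (Hseg : forall t, 0 <= t <= 1 -> Rabs (y + t * (y' - y)) < s0).
  { intros t Ht. apply Rle_lt_trans with (Rmax (Rabs y) (Rabs y')); [|now apply Rmax_lub_lt].
    assert (H1 := Rmax_l (Rabs y) (Rabs y')). assert (H2 := Rmax_r (Rabs y) (Rabs y')).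
    set (m := Rmax (Rabs y) (Rabs y')) in *.
    replace (y + t * (y' - y)) with ((1 - t) * y + t * y') by ring.
    eapply Rle_trans; [apply Rabs_triang|]. rewrite !Rabs_mult, (Rabs_pos_eq (1 - t)), (Rabs_pos_eq t) by lra. nra. }
  set (df := fun t => Fe (y + t * (y' - y)) (x + t * (x' - x)) * (y' - y) +
    Fx (y + t * (y' - y)) (x + t * (x' - x)) * (x' - x)).
  assert (Hd : forall t, 0 <= t <= 1 ->
    is_derive (fun t => F (y + t * (y' - y)) (x + t * (x' - x))) t (df t)).
  { intros t Ht. apply (Hch (fun t => x + t * (x' - x)) (fun t => y + t * (y' - y))).
    - auto_derive; auto; ring.
    - auto_derive; auto; ring.
    - now apply Hseg. }
  destruct (MVT_gen (fun t => F (y + t * (y' - y)) (x + t * (x' - x))) 0 1 df) as [c [Hc E]].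
  - rewrite Rmin_left, Rmax_right by lra. intros t Ht. apply Hd; lra.
  - rewrite Rmin_left, Rmax_right by lra. intros t Ht.
    apply derivable_continuous_pt. exists (df t). apply is_derive_Reals, Hd; lra.
  - rewrite Rmin_left, Rmax_right in Hc by lra.
    rewrite !Rmult_1_l, !Rmult_0_l, !Rplus_0_r in E.
    replace (y + (y' - y)) with y' in E by ring. replace (x + (x' - x)) with x' in E by ring.
    rewrite E. replace (df c * (1 - 0)) with (df c) by ring. unfold df.
    assert (Hs := Hseg c Hc). set (u := y + c * (y' - y)) in *. set (v := x + c * (x' - x)).
    assert (B1 := V_bound _ _ _ _ u v HFe ltac:(lra)).
    assert (B2 := V_bound _ _ _ _ u v HFx ltac:(lra)).
    eapply Rle_trans; [apply Rabs_triang|]. rewrite !Rabs_mult.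
    rewrite Rmult_plus_distr_l. apply Rplus_le_compat; apply Rmult_le_compat_r; auto using Rabs_pos.
Qed.

Lemma increments_series (u : nat -> R) l :
  u 0%nat = 0 -> is_series (fun n => u (S n) - u n) l -> is_lim_seq u l.
Proof.
  intros H0 Hl. apply is_lim_seq_incr_1.
  eapply is_lim_seq_ext; [|exact Hl].
  intros n. induction n as [|n IH].
  - rewrite sum_O, H0. ring.
  - rewrite sum_Sn, IH. change (u (S n) + (u (S (S n)) - u (S n)) = u (S (S n))). ring.
Qed.

(** The limit of the iterates is the sum of the increments, and so stays in the algebra. *)
Lemma V_increments rho sigma (I : nat -> R) (S S' : R) (u : nat -> R -> R -> R) :
  (forall n, V rho sigma (I n) (fun e x => u (Datatypes.S n) e x - u n e x)) ->
  is_series I S -> S <= S' -> (forall e x, u 0%nat e x = 0) ->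
  exists v, V rho sigma S' v /\
    forall e x, Rabs e <= rho -> is_lim_seq (fun n => u n e x) (v e x).
Proof.
  intros Hu HI HS H0.
  assert (Hser : forall e x, Rabs e <= rho ->
    is_series (fun n => u (Datatypes.S n) e x - u n e x)
      (Series (fun n => u (Datatypes.S n) e x - u n e x))).
  { intros e x He. apply Series_correct.
    destruct (is_series_dominated (fun n => u (Datatypes.S n) e x - u n e x) _ _ HI) as [l [Hl _]].
    - intros n. exact (V_bound _ _ _ _ e x (Hu n) He).
    - now exists l. }
  exists (fun e x => Series (fun n => u (Datatypes.S n) e x - u n e x)). split.
  - apply (V_sum rho sigma I S S' _ _ Hu HI HS). exact Hser.
  - intros e x He. apply (increments_series (fun n => u n e x)); auto.
Qed.

Fixpoint below (m : R) (l : list R) : Prop :=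
  match l with nil => True | x :: l' => m <= x /\ below m l' end.

Lemma exists_below (l : list R) : Forall (Rlt 0) l -> exists m, 0 < m /\ below m l.
Proof.
  assert (Hmono : forall l m m', m' <= m -> below m l -> below m' l).
  { induction l0 as [|x l0 IH]; simpl; auto. intros m m' Hm [H1 H2]. split; [lra|eauto]. }
  induction l as [|x l IH]; intros Hl; [exists 1; simpl; split; [lra|auto]|].
  inversion_clear Hl. destruct (IH H0) as (m & Hm & Hb).
  exists (Rmin x m). split; [now apply Rmin_pos|]. split; [apply Rmin_l|].
  apply (Hmono l m); auto. apply Rmin_r.
Qed.

Lemma small_tail (u : nat -> R) (b : R) :
  (forall m, 0 <= u m) -> ex_series u -> 0 < b ->
  exists m0, (forall m, (m0 <= m)%nat -> u m <= b) /\
    forall m, (m0 <= m)%nat -> exists T : R, is_series (fun n => u (n + m)%nat) T /\ T <= b.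
Proof.
  intros Hu [S HS] Hb.
  assert (Hlim : is_lim_seq (sum_n u) S) by exact HS.
  apply is_lim_seq_spec in Hlim. destruct (Hlim (mkposreal _ Hb)) as [n1 Hn1]. simpl in Hn1.
  assert (HT : forall n, (n1 <= n)%nat ->
    exists T : R, is_series (fun j => u (j + Datatypes.S n)%nat) T /\ T <= b).
  { intros n Hn. exists (S - sum_n u n). split.
    - apply (is_series_eq (fun j => u (Datatypes.S n + j)%nat) _ (S - sum_n u n)); auto.
      + apply (is_series_incr_n u (Datatypes.S n)); [lia|].
        apply (is_series_eq _ _ _ _ HS); auto.
        assert (E : forall y z : R, y = y - z + z) by (intros; ring). apply E.
      + intros j. now rewrite Nat.add_comm.
    - assert (H := Hn1 n Hn). apply Rabs_def2 in H. lra. }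
  assert (HT' : forall m, (Datatypes.S n1 <= m)%nat ->
    exists T : R, is_series (fun j => u (j + m)%nat) T /\ T <= b).
  { intros [|m] Hm; [lia|]. apply HT. lia. }
  exists (Datatypes.S n1). split; [|exact HT'].
  intros m Hm. destruct (HT' m Hm) as (T & HT1 & HT2).
  assert (H := term_le_series _ _ 0 HT1 (fun j => Hu _)). simpl in H. lra.
Qed.

(** The sizes produced by one Newton step when the error is [exp (- Lam)] and the strip loses
    [d = Lam / N]: the factor [exp (Lam / 2)] absorbs the small divisors, so the corrections
    are at most [exp (- Lam / 2)] and the new error is [exp (- 3 / 2 * Lam)]. *)
Lemma newton_step_sizes K G N Lam Lam' :
  let d := Lam / N in
  let P := G ^ 2 * exp (- Lam) / d in
  let T := exp (- (d * N)) * (G * exp (- Lam) / d) in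
  1 <= K -> 1 <= G -> 1 <= N -> 1 <= Lam -> d <= 1 -> Lam' <= 3 / 2 * Lam ->
  2 * K * G ^ 4 * N ^ 2 <= exp (Lam / 2) ->
  0 <= P /\ K * P <= exp (- (Lam / 2)) /\ K * (P / d) <= exp (- (Lam / 2)) /\
  K * (P ^ 2 + T) <= exp (- Lam').
Proof.
  intros d P T HK HG HN HL Hd HL' HKG.
  assert (Hd0 : 0 < d) by (apply Rdiv_lt_0_compat; lra).
  assert (ETn : exp (- (d * N)) = exp (- Lam)) by (f_equal; unfold d; field; lra).
  assert (Her : exp (- Lam) = exp (- (Lam / 2)) * exp (- (Lam / 2))).
  { rewrite <- exp_plus. f_equal. field. }
  assert (Hhalf : exp (Lam / 2) * exp (- (Lam / 2)) = 1).
  { rewrite <- exp_plus. replace (Lam / 2 + - (Lam / 2)) with 0 by ring. apply exp_0. }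
  assert (Hx3 : exp (- (Lam / 2)) * exp (- (Lam / 2)) * exp (- (Lam / 2)) <= exp (- Lam')).
  { rewrite <- !exp_plus. apply exp_le. lra. }
  set (x := exp (- (Lam / 2))) in *. assert (Hx0 : 0 < x) by apply exp_pos.
  assert (HKx : 2 * K * G ^ 4 * N ^ 2 * x <= 1).
  { rewrite <- Hhalf. apply Rmult_le_compat_r; lra. }
  set (y := / d).
  assert (Hy1 : 1 <= y) by (unfold y; rewrite <- Rinv_1; apply Rinv_le_contravar; lra).
  assert (HyN : y <= N).
  { unfold y, d, Rdiv. rewrite Rinv_mult, Rinv_inv.
    rewrite <- (Rmult_1_l N) at 2. apply Rmult_le_compat_r; [lra|].
    rewrite <- Rinv_1. apply Rinv_le_contravar; lra. }
  assert (Hy2 : y * y <= N ^ 2) by (simpl; rewrite Rmult_1_r; apply Rmult_le_compat; lra).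
  assert (HG4 : G ^ 2 <= G ^ 4) by (apply Rle_pow; [exact HG|lia]).
  assert (HG2 : 1 <= G ^ 2) by (apply pow_R1_Rle; exact HG).
  assert (EP : P = G ^ 2 * y * (x * x)) by (unfold P; rewrite Her; unfold Rdiv; fold y; ring).
  assert (HP0 : 0 <= P) by (rewrite EP; repeat apply Rmult_le_pos; lra).
  assert (HPd : K * (P / d) <= x).
  { unfold Rdiv. fold y. rewrite EP.
    replace (K * (G ^ 2 * y * (x * x) * y)) with ((K * (G ^ 2 * (y * y)) * x) * x) by ring.
    apply Rle_trans with (1 * x); [|lra]. apply Rmult_le_compat_r; [lra|].
    eapply Rle_trans; [|exact HKx]. apply Rmult_le_compat_r; [lra|].
    assert (H1 : G ^ 2 * (y * y) <= G ^ 4 * N ^ 2) by (apply Rmult_le_compat; nra).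
    assert (H2 : 0 <= G ^ 2 * (y * y)) by (apply Rmult_le_pos; nra). nra. }
  split; [exact HP0|]. split; [|split; [exact HPd|]].
  - eapply Rle_trans; [|exact HPd]. apply Rmult_le_compat_l; [lra|].
    unfold Rdiv. fold y. rewrite <- (Rmult_1_r P) at 1. apply Rmult_le_compat_l; lra.
  - assert (HTP : T <= P ^ 2).
    { unfold T. rewrite ETn, EP, Her. unfold Rdiv. fold y.
      replace (x * x * (G * (x * x) * y)) with ((G * y) * (x * x * x * x)) by ring.
      replace ((G ^ 2 * y * (x * x)) ^ 2) with ((G ^ 4 * (y * y)) * (x * x * x * x)) by ring.
      apply Rmult_le_compat_r; [repeat apply Rmult_le_pos; lra|].
      apply Rmult_le_compat; try lra; simpl; nra. }
    apply Rle_trans with (2 * K * P ^ 2).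
    { replace (2 * K * P ^ 2) with (K * (P ^ 2 + P ^ 2)) by ring.
      apply Rmult_le_compat_l; lra. }
    rewrite EP.
    replace (2 * K * (G ^ 2 * y * (x * x)) ^ 2) with
      ((2 * K * G ^ 4 * (y * y) * x) * (x * x * x)) by ring.
    apply Rle_trans with (1 * (x * x * x)); [|lra].
    apply Rmult_le_compat_r; [repeat apply Rmult_le_pos; lra|].
    eapply Rle_trans; [|exact HKx]. apply Rmult_le_compat_r; [lra|].
    apply Rmult_le_compat_l; [|exact Hy2].
    apply Rmult_le_pos; [lra|]. apply pow_le; lra.
Qed.

Section Iteration.
Context (w s0 sigma0 C : R) (a ae : R -> R) (f fe fx g ge gx : R -> R -> R).
Context (Hs0 : 0 < s0) (Hsigma0 : 0 < sigma0) (HC : 1 <= C).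
Context (Ha1 : 0 < ae 0) (Ha0 : a 0 = 2 * PI * w) (Hw : bryuno w).
Context (Da : C1_data s0 sigma0 C (fun e _ => a e) (fun e _ => ae e) (fun _ _ => 0)).
Context (Df : C1_data s0 sigma0 C f fe fx) (Dg : C1_data s0 sigma0 C g ge gx).
Context (eps1 : R) (Heps1 : 0 < eps1).
Context (Hdet : forall eps e x, Rabs eps < eps1 -> Rabs e < s0 ->
  (1 + eps * fx e x) * (1 + eps * ge e x) - (ae e + eps * fe e x) * (eps * gx e x) = 1).

Section Limit.
Context (hn Hn : nat -> R -> R -> R) (ln : nat -> R -> R) (h H : R -> R -> R) (lam : R -> R).
Context (e : R) (Hh : forall x, is_lim_seq (fun n => hn n e x) (h e x)).
Context (HH : forall x, is_lim_seq (fun n => Hn n e x) (H e x)).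
Context (Hl : is_lim_seq (fun n => ln n e) (lam e)).
Context (HHn : forall n x, Rabs (Hn n e x) < s0) (HH0 : forall x, Rabs (H e x) < s0).

Lemma composition_lim F Fe Fx x :
  C1_data s0 sigma0 C F Fe Fx ->
  is_lim_seq (fun n => F (Hn n e x) (x + hn n e x)) (F (H e x) (x + h e x)).
Proof.
  intros HF.
  assert (Hd : forall (u : nat -> R) (l : R), is_lim_seq u l -> is_lim_seq (fun n => Rabs (u n - l)) 0).
  { intros u l Hu. apply (proj1 (is_lim_seq_abs_0 _)). replace 0 with (l - l) by ring.
    apply is_lim_seq_minus'; [exact Hu|apply is_lim_seq_const]. }
  assert (Hb : is_lim_seq (fun n => C * (Rabs (Hn n e x - H e x) +
    Rabs (x + hn n e x - (x + h e x)))) (C * (0 + 0))).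
  { apply (is_lim_seq_scal_l _ C (0 + 0)). apply is_lim_seq_plus'; [now apply Hd|].
    apply (Hd (fun n => x + hn n e x)). apply is_lim_seq_plus'; [apply is_lim_seq_const|auto]. }
  rewrite Rplus_0_r, Rmult_0_r in Hb.
  assert (H0 : is_lim_seq (fun n => F (Hn n e x) (x + hn n e x) - F (H e x) (x + h e x)) 0).
  { apply (proj2 (is_lim_seq_abs_0 _)).
    apply (is_lim_seq_le_le (fun _ => 0) _ _ 0) with (2 := is_lim_seq_const 0) (3 := Hb).
    intros n. split; [apply Rabs_pos|]. apply (C1_data_lipschitz s0 sigma0 C F Fe Fx); auto. }
  assert (H1 := is_lim_seq_plus' _ _ _ _ H0 (is_lim_seq_const (F (H e x) (x + h e x)))).
  rewrite Rplus_0_l in H1. refine (is_lim_seq_ext _ _ _ _ H1). intros n. simpl. ring.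
Qed.

Lemma error1_lim x : is_lim_seq (fun n => error1 w a f (hn n) (Hn n) e x) (error1 w a f h H e x).
Proof.
  unfold error1. apply is_lim_seq_minus'; [apply is_lim_seq_minus'|apply Hh].
  - apply is_lim_seq_plus'; [apply is_lim_seq_plus'; [apply Hh|]|].
    + apply (composition_lim (fun e _ => a e) _ _ x Da).
    + apply (is_lim_seq_scal_l (fun n => f (Hn n e x) (x + hn n e x)) e (f (H e x) (x + h e x))).
      apply (composition_lim _ _ _ x Df).
  - apply is_lim_seq_const.
Qed.

Lemma error2_lim x :
  is_lim_seq (fun n => error2 w g (hn n) (Hn n) (ln n) e x) (error2 w g h H lam e x).
Proof.
  unfold error2. apply is_lim_seq_plus'; [apply is_lim_seq_minus'; [|apply HH]|exact Hl].
  apply is_lim_seq_plus'; [apply HH|].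
  apply (is_lim_seq_scal_l (fun n => g (Hn n e x) (x + hn n e x)) e (g (H e x) (x + h e x))).
  apply (composition_lim _ _ _ x Dg).
Qed.

End Limit.

(** The parameters are fixed in the order [Z] (distance to the boundary of the domain), [k] (size
    of the total correction), [m0] (first step) and [rho]: the constant of the Newton step does
    not depend on [rho], which only has to make the initial error small. *)
Theorem translated_curve :
  exists rho sigma k (h H : R -> R -> R) (lam : R -> R),
    0 < rho < eps1 /\ 0 < sigma /\ k < s0 /\
    V rho sigma k h /\ V rho sigma k H /\
    forall e x, Rabs e <= rho ->
      error1 w a f h H e x = 0 /\ error2 w g h H lam e x = 0.
Proof.
  set (a1 := ae 0) in *.
  destruct (exists_below (s0 / 4 :: sigma0 / 4 :: nil)) as (Z & HZ & HZs & HZsig & _);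
    [repeat constructor; lra|].
  set (K := newton_const C Z ae).
  destruct (newton_const_bounds C Z ae HC Ha1) as (_ & _ & HK & HK3). fold K in HK, HK3.
  destruct (newton_scales w K Hw HK) as (L & Lam & HL & HLam1 & HLams & HLamr & HLamK & HLami).
  set (N := fun m => (5 / 4) ^ m).
  assert (HN1 : forall m, 1 <= N m) by (intros; apply pow_R1_Rle; lra).
  (* [k] bounds the corrections; the twist must survive them *)
  set (D := 8 * C / Z + 6 * a1).
  assert (HD0 : 0 < D).
  { unfold D. assert (0 < 8 * C / Z) by (apply Rdiv_lt_0_compat; lra). lra. }
  destruct (exists_below (/ 2 :: Z :: a1 / 4 / D :: nil)) as (k & Hk0 & Hk2 & HkZ & HkD & _).
  { repeat constructor; try lra. apply Rdiv_lt_0_compat; lra. }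
  assert (Hksmall : 4 * (2 * C * (k / Z)) + 6 * k * a1 <= a1 / 4).
  { replace (4 * (2 * C * (k / Z)) + 6 * k * a1) with (k * D) by (unfold D; field; lra).
    apply Rmult_le_reg_r with (/ D); [now apply Rinv_0_lt_compat|].
    rewrite Rmult_assoc, Rinv_r, Rmult_1_r by lra. exact HkD. }
  (* starting the iteration late makes the total loss of strip and the corrections small *)
  destruct (small_tail (fun m => Lam m / N m) (Rmin 1 (Z / 4))) as (m1 & Hm1 & Hm1T); auto.
  { intros m. specialize (HN1 m). specialize (HLam1 m). apply Rle_mult_inv_pos; lra. }
  { apply Rmin_pos; lra. }
  destruct (small_tail (fun m => (16 / 25) ^ m) (k / 2)) as (m2 & Hm2 & Hm2T).
  { intros m. apply pow_le; lra. }
  { eexists. apply is_series_geom. rewrite Rabs_pos_eq; lra. }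
  { lra. }
  set (m0 := (m1 + m2)%nat).
  destruct (Hm1T m0) as (T & HT & HTZ); [unfold m0; lia|].
  destruct (Hm2T m0) as (U & HU & HUk); [unfold m0; lia|].
  set (d := fun n => Lam (n + m0)%nat / N (n + m0)%nat) in *.
  set (er := fun n => exp (- Lam (n + m0)%nat)).
  set (inc := fun n => (16 / 25) ^ (n + m0)) in *.
  assert (Hmin1 := Rmin_l 1 (Z / 4)). assert (Hmin2 := Rmin_r 1 (Z / 4)).
  assert (Her : forall n, 0 < er n) by (intros; apply exp_pos).
  assert (Hinc0 : forall n, 0 <= inc n) by (intros; apply pow_le; lra).
  assert (Hinck : forall n, inc n <= k / 2) by (intros n; apply Hm2; unfold m0; lia).
  assert (Hd : forall n, 0 < d n <= 1).
  { intros n. split; [|apply Rle_trans with (Rmin 1 (Z / 4)); auto; apply Hm1; unfold m0; lia].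
    apply Rdiv_lt_0_compat; [specialize (HLam1 (n + m0)%nat)|specialize (HN1 (n + m0)%nat)]; lra. }
  set (psum := fun (u : nat -> R) n => match n with O => 0 | S j => sum_n u j end).
  assert (HpsumS : forall u n, psum u (S n) = psum u n + u n).
  { intros u [|n]; simpl; [rewrite sum_O; ring|exact (sum_Sn (G := R_AbelianMonoid) u n)]. }
  assert (Hpsum : forall u l, is_series u l -> (forall n, 0 <= u n) -> forall n, 0 <= psum u n <= l).
  { intros u l Hu Hu0 n. split.
    - induction n as [|n IH]; [simpl; lra|]. rewrite HpsumS. specialize (Hu0 n). lra.
    - destruct n as [|n]; [now apply (is_series_ge0 u)|now apply sum_n_le_series]. }
  set (sg := fun n => Z - 2 * psum d n). set (kn := fun n => k / 2 + psum inc n).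
  assert (Hsg : forall n, Z / 2 <= sg n <= Z).
  { intros n. assert (H := Hpsum d T HT (fun j => Rlt_le _ _ (proj1 (Hd j))) n). unfold sg. lra. }
  assert (HsgS : forall n, sg (S n) = sg n - 2 * d n) by (intros n; unfold sg; rewrite HpsumS; ring).
  assert (Hkn : forall n, kn n <= k).
  { intros n. assert (H := Hpsum inc U HU Hinc0 n). unfold kn. lra. }
  assert (HknS : forall n, kn n + inc n = kn (S n)) by (intros n; unfold kn; rewrite HpsumS; ring).
  destruct (exists_below (eps1 / 2 :: er 0%nat / (2 * C) :: / (2 * C) :: a1 / (32 * C) :: nil))
    as (rho & Hr0 & Hr1 & Hr2 & Hr3 & Hr4 & _).
  { repeat constructor; try (apply Rdiv_lt_0_compat; try lra; apply Her).
    apply Rinv_0_lt_compat; lra. }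
  assert (Hdiv : forall x y, rho <= x / y -> 0 < y -> rho * y <= x).
  { intros x y Hx Hy. apply Rmult_le_reg_r with (/ y); [now apply Rinv_0_lt_compat|].
    rewrite Rmult_assoc, Rinv_r, Rmult_1_r by lra. exact Hx. }
  apply Hdiv in Hr2; [|lra]. apply Hdiv in Hr4; [|lra].
  rewrite <- (Rmult_1_l (/ (2 * C))) in Hr3. apply Hdiv in Hr3; [|lra].
  assert (Hrho1 : rho <= 1) by nra.
  set (St := (((R -> R -> R) * (R -> R -> R)) * ((R -> R -> R) * (R -> R -> R)) * (R -> R))%type).
  set (sh := fun s : St => fst (fst (fst s))). set (sH := fun s : St => snd (fst (fst s))).
  set (sdh := fun s : St => fst (snd (fst s))). set (sdH := fun s : St => snd (snd (fst s))).
  set (sl := fun s : St => snd s).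
  set (Inv := fun n (s : St) =>
    approximate w a f g rho (sg n) (kn n) (er n) (sh s) (sH s) (sdh s) (sdH s) (sl s)).
  set (Rel := fun n (s s' : St) =>
    V rho (Z / 2) (inc n) (fun e x => sh s' e x - sh s e x) /\
    V rho (Z / 2) (inc n) (fun e x => sH s' e x - sH s e x) /\
    V rho (Z / 2) (inc n) (fun e _ => sl s' e - sl s e)).
  set (z2 := fun _ _ : R => 0).
  assert (Hz2 : forall M, 0 <= M -> V rho Z M z2).
  { intros M HM. eapply V_le; [apply V_const; lra|]. now rewrite Rabs_R0. }
  destruct (dependent_choice St Inv Rel (((z2, z2), (z2, z2)), fun _ => 0)) as [s [Hs_0 Hs]].
  - unfold Inv, approximate, sh, sH, sdh, sdH, sl; simpl.
    assert (Hsg0 : sg 0%nat = Z) by (unfold sg; simpl; ring). rewrite Hsg0.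
    assert (Hkn0 : 0 <= kn 0%nat) by (unfold kn; simpl; lra).
    assert (Hder : x_derivative rho z2 z2) by (intros e x _; apply is_derive_Rconst).
    assert (Herr : forall F, V s0 sigma0 C F -> V rho Z (er 0%nat) (fun e x => e * F 0 x)).
    { intros F HF. apply (V_le _ _ (rho * (2 * C))); [|exact Hr2].
      apply (V_ext _ _ _ (fun e x => e * F (z2 e x) (x + z2 e x))).
      - apply (V_mul _ _ _ _ (fun e _ => e)); [apply V_eps; lra|].
        apply (V_comp s0 sigma0 C rho Z k z2 z2); auto; try (apply Hz2; lra); lra.
      - intros e x _. unfold z2. now rewrite Rplus_0_r. }
    repeat (split; [first [now apply Hz2|exact Hder]|]).
    split.
    + apply (V_ext _ _ _ _ _ (Herr _ (proj1 Df))). intros e x _. unfold error1, z2.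
      rewrite Ha0, !Rplus_0_r. ring.
    + apply (V_ext _ _ _ _ _ (Herr _ (proj1 Dg))). intros e x _. unfold error2, z2.
      rewrite !Rplus_0_r. ring.
  - intros n st Hst. set (m := (n + m0)%nat).
    assert (Hsgn := Hsg n). assert (HsgSn := Hsg (S n)). rewrite HsgS in HsgSn.
    destruct (Hd n) as [Hd0 Hd1].
    destruct (newton_step_sizes K (exp (L m)) (N m) (Lam m) (Lam (S m)) HK (proj1 (HL m)) (HN1 m)
      (HLam1 m) Hd1 (HLamr m) (HLamK m)) as (HP0 & HPi & HPd & Herr).
    change (Lam m / N m) with (d n) in HP0, HPi, HPd, Herr.
    change (exp (- Lam m)) with (er n) in HP0, HPi, HPd, Herr.
    change (exp (- Lam (S m))) with (er (S n)) in Herr.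
    apply (fun H => Rle_trans _ _ _ H (HLami m)) in HPi, HPd.
    change ((16 / 25) ^ m) with (inc n) in HPi, HPd.
    assert (Hincn := Hinck n).
    destruct Hst as (I1 & I2 & I3 & I4 & I5 & I6 & I7 & I8).
    assert (Happ : approximate w a f g rho (sg n) k (er n) (sh st) (sH st) (sdh st) (sdH st) (sl st)).
    { repeat (split; [first [assumption|eapply V_le; [eassumption|apply Hkn]]|]). assumption. }
    destruct (newton_step w s0 sigma0 C Z a ae f fe fx g ge gx HC HZ Ha1 Da Df Dg
      rho (sg n) k (er n) (d n) (exp (L m)) (N m) (sh st) (sH st) (sdh st) (sdH st) (sl st))
      as (xi & eta & dxi & deta & mu & V1 & V2 & V3 & V4 & V5 & V6 & V7 & V8 & V9); auto;
      try lra.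
    + fold a1. lra.
    + intros eps e y' He Hy. apply Hdet; auto. lra.
    + eapply Rle_trans; [apply Rmult_le_compat_r; [exact HP0|exact HK3]|]. lra.
    + rewrite <- HsgS in V1, V2, V3, V4, V5, V8, V9.
      change (newton_const C Z ae) with K in V1, V2, V3, V4, V5, V8, V9.
      exists (((fun e x => sh st e x + xi e x, fun e x => sH st e x + eta e x),
        (fun e x => sdh st e x + dxi e x, fun e x => sdH st e x + deta e x)),
        fun e => sl st e + mu e).
      rewrite <- HsgS in HsgSn.
      assert (Hst' : forall M u, V rho (sg n) M u -> V rho (sg (S n)) M u).
      { intros M u Hu. apply (V_strip _ (sg n)); auto. rewrite HsgS in *. lra. }
      assert (Hst2 : forall M u, V rho (sg (S n)) M u -> V rho (Z / 2) M u).
      { intros M u Hu. apply (V_strip _ (sg (S n))); auto. lra. }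
      split.
      * unfold Inv, approximate, sh, sH, sdh, sdH, sl; simpl.
        rewrite <- HknS.
        split; [apply V_add; [now apply Hst'|eapply V_le; eassumption]|].
        split; [apply V_add; [now apply Hst'|eapply V_le; eassumption]|].
        split; [apply V_add; [now apply Hst'|eapply V_le; eassumption]|].
        split; [apply V_add; [now apply Hst'|eapply V_le; eassumption]|].
        split; [intros e y' He; apply is_derive_Rplus; [now apply I5|now apply V6]|].
        split; [intros e y' He; apply is_derive_Rplus; [now apply I6|now apply V7]|].
        split; [eapply V_le; [exact V8|exact Herr]|eapply V_le; [exact V9|exact Herr]].
      * unfold Rel, sh, sH, sl; simpl.
        split; [|split].
        -- apply (V_ext _ _ _ xi); [apply Hst2; eapply V_le; eassumption|intros; ring].
        -- apply (V_ext _ _ _ eta); [apply Hst2; eapply V_le; eassumption|intros; ring].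
        -- apply (V_ext _ _ _ (fun e _ => mu e)); [apply Hst2; eapply V_le; eassumption|intros; ring].
  - assert (HUk' : U <= k) by lra.
    destruct (V_increments rho (Z / 2) inc U k (fun n => sh (s n))
      (fun n => proj1 (proj2 (Hs n))) HU HUk') as (h & Vh & Hh); [intros; now rewrite Hs_0|].
    destruct (V_increments rho (Z / 2) inc U k (fun n => sH (s n))
      (fun n => proj1 (proj2 (proj2 (Hs n)))) HU HUk') as (H & VH & HH); [intros; now rewrite Hs_0|].
    destruct (V_increments rho (Z / 2) inc U k (fun n e _ => sl (s n) e)
      (fun n => proj2 (proj2 (proj2 (Hs n)))) HU HUk') as (lam & _ & Hlam);
      [intros; now rewrite Hs_0|].
    exists rho, (Z / 2), k, h, H, (fun e => lam e 0).
    split; [lra|]. split; [lra|]. split; [lra|]. split; [exact Vh|]. split; [exact VH|].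
    intros e x He.
    assert (HH0 : forall y, Rabs (H e y) < s0).
    { intros y. apply Rle_lt_trans with k; [now apply (V_bound rho (Z / 2))|lra]. }
    assert (HHn : forall n y, Rabs (sH (s n) e y) < s0).
    { intros n y. apply Rle_lt_trans with k; [|lra]. apply Rle_trans with (kn n); auto.
      destruct (Hs n) as [(_ & Hv & _) _]. now apply (V_bound _ _ _ _ e y Hv). }
    assert (Hzero : forall (u : nat -> R) (l : R), (forall n, Rabs (u n) <= er n) ->
      is_lim_seq u l -> l = 0).
    { intros u l Hu Hl. assert (Hu0 : is_lim_seq u 0).
      { apply (proj2 (is_lim_seq_abs_0 _)). apply (is_lim_seq_le_le (fun _ => 0) _ inc 0).
        - intros n. split; [apply Rabs_pos|]. eapply Rle_trans; [apply Hu|].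
          eapply Rle_trans; [|apply (HLami (n + m0)%nat)]. apply exp_le.
          specialize (HLam1 (n + m0)%nat). lra.
        - apply is_lim_seq_const.
        - apply ex_series_lim_0. eexists; exact HU. }
      apply is_lim_seq_unique in Hl. rewrite (is_lim_seq_unique _ _ Hu0) in Hl.
      now injection Hl. }
    split.
    + apply (Hzero (fun n => error1 w a f (sh (s n)) (sH (s n)) e x)).
      * intros n. destruct (Hs n) as [(_ & _ & _ & _ & _ & _ & Hv & _) _].
        now apply (V_bound _ _ _ _ e x Hv).
      * apply (error1_lim (fun n => sh (s n)) (fun n => sH (s n)) h H e); auto.
    + apply (Hzero (fun n => error2 w g (sh (s n)) (sH (s n)) (sl (s n)) e x)).
      * intros n. destruct (Hs n) as [(_ & _ & _ & _ & _ & _ & _ & Hv) _].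
        now apply (V_bound _ _ _ _ e x Hv).
      * apply (error2_lim (fun n => sh (s n)) (fun n => sH (s n)) (fun n => sl (s n)) h H
          (fun e => lam e 0) e); auto.
Qed.

End Iteration.

(** * Fourier series *)

(* Equations between integrals are stated in the carrier of a module structure. *)
Ltac Req := match goal with |- ?a = ?b => change (@eq R a b) end.

Definition cont (f : R -> R) : Prop := forall x, continuous f x.

Lemma cont_const c : cont (fun _ => c).
Proof. intros x. apply continuous_const. Qed.

Lemma cont_plus f g : cont f -> cont g -> cont (fun x => f x + g x).
Proof. intros Hf Hg x. apply (continuous_plus f g x (Hf x) (Hg x)). Qed.

Lemma cont_minus f g : cont f -> cont g -> cont (fun x => f x - g x).
Proof. intros Hf Hg x. apply (continuous_minus f g x (Hf x) (Hg x)). Qed.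

Lemma cont_mult f g : cont f -> cont g -> cont (fun x => f x * g x).
Proof. intros Hf Hg x. apply (continuous_mult f g x (Hf x) (Hg x)). Qed.

Lemma cont_derive (f df : R -> R) : (forall x, is_derive f x (df x)) -> cont f.
Proof.
  intros H x. apply (ex_derive_continuous f x). exists (df x). apply H.
Qed.

Lemma cont_cos k p : cont (fun x => cos (k * x + p)).
Proof.
  apply (cont_derive _ (fun x => - k * sin (k * x + p))). intros x. auto_derive; auto. ring.
Qed.

Lemma cont_translate f c : cont f -> cont (fun x => f (x + c)).
Proof.
  intros Hf x. apply (continuous_comp (fun x => x + c) f); [|apply Hf].
  apply (cont_derive _ (fun _ => 1)). intros y. auto_derive; auto.
Qed.

Lemma cont_pow f n : cont f -> cont (fun x => f x ^ n).
Proof.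
  intros Hf. induction n as [|n IH]; [exact (cont_const 1)|]. simpl. now apply cont_mult.
Qed.

Lemma cont_RInt f a b : cont f -> ex_RInt f a b.
Proof. intros Hf. apply (ex_RInt_continuous f). auto. Qed.

Lemma RInt_of_derive (f df : R -> R) a b :
  (forall x, is_derive f x (df x)) -> cont df -> RInt df a b = f b - f a.
Proof.
  intros Hf Hc. apply is_RInt_unique. apply (is_RInt_derive f df); auto.
Qed.

Lemma RInt_cont_plus f g a b :
  cont f -> cont g -> RInt (fun x => f x + g x) a b = RInt f a b + RInt g a b.
Proof. intros Hf Hg. apply (RInt_plus f g a b); now apply cont_RInt. Qed.

Lemma RInt_cont_minus f g a b :
  cont f -> cont g -> RInt (fun x => f x - g x) a b = RInt f a b - RInt g a b.
Proof. intros Hf Hg. apply (RInt_minus f g a b); now apply cont_RInt. Qed.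

Lemma RInt_cont_scal c f a b :
  cont f -> RInt (fun x => c * f x) a b = c * RInt f a b.
Proof. intros Hf. apply (RInt_scal f a b c). now apply cont_RInt. Qed.

Lemma RInt_periodic f c :
  cont f -> (forall x, f (x + 2 * PI) = f x) -> RInt f c (c + 2 * PI) = RInt f 0 (2 * PI).
Proof.
  intros Hf Hper.
  assert (E1 := RInt_Chasles f c 0 (c + 2 * PI) (cont_RInt _ _ _ Hf) (cont_RInt _ _ _ Hf)).
  assert (E2 := RInt_Chasles f 0 (2 * PI) (c + 2 * PI) (cont_RInt _ _ _ Hf) (cont_RInt _ _ _ Hf)).
  assert (E3 : RInt f (2 * PI) (c + 2 * PI) = RInt f 0 c).
  { assert (E := RInt_comp_lin f 1 (2 * PI) 0 c (cont_RInt _ _ _ Hf)).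
    rewrite Rmult_0_r, Rmult_1_l, Rplus_0_l in E. rewrite <- E.
    apply RInt_ext. intros x _. unfold scal; simpl; unfold mult; simpl.
    rewrite !Rmult_1_l. apply Hper. }
  assert (E4 := opp_RInt_swap f 0 c (cont_RInt _ _ _ Hf)).
  change (RInt f c 0 + RInt f 0 (c + 2 * PI) = RInt f c (c + 2 * PI)) in E1.
  change (RInt f 0 (2 * PI) + RInt f (2 * PI) (c + 2 * PI) = RInt f 0 (c + 2 * PI)) in E2.
  change (- RInt f 0 c = RInt f c 0) in E4.
  rewrite <- E1, <- E2, E3, <- E4.
  match goal with |- - ?a + (?b + ?a') = _ => generalize a b end. intros; simpl. ring.
Qed.

Lemma cos_period_Z (k : Z) x p : cos (IZR k * (x + 2 * PI) + p) = cos (IZR k * x + p).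
Proof.
  destruct (Z.le_gt_cases 0 k).
  - rewrite <- (Z2Nat.id k) by auto. rewrite <- INR_IZR_INZ. apply cos_period_INR.
  - rewrite <- cos_neg, <- (cos_neg (IZR k * x + p)).
    replace (- (IZR k * (x + 2 * PI) + p)) with (IZR (- k) * (x + 2 * PI) + - p)
      by (rewrite opp_IZR; ring).
    replace (- (IZR k * x + p)) with (IZR (- k) * x + - p) by (rewrite opp_IZR; ring).
    rewrite <- (Z2Nat.id (- k)) by lia. rewrite <- INR_IZR_INZ. apply cos_period_INR.
Qed.

Lemma RInt_cos_Z (k : Z) p :
  RInt (fun x => cos (IZR k * x + p)) 0 (2 * PI) =
  if Z.eq_dec k 0 then 2 * PI * cos p else 0.
Proof.
  destruct (Z.eq_dec k 0) as [->|Hk].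
  - rewrite (RInt_ext _ (fun _ => cos p)).
    + rewrite RInt_const. unfold scal; simpl; unfold mult; simpl. ring.
    + intros x _. f_equal. ring.
  - assert (Hk' : IZR k <> 0) by now apply not_0_IZR.
    rewrite (RInt_of_derive (fun x => / IZR k * cos (IZR k * x + (p - PI / 2)))).
    + rewrite <- (cos_period_Z k 0 (p - PI / 2)), Rplus_0_l. now apply Rminus_diag_eq.
    + intros x.
      replace (cos (IZR k * x + p)) with (/ IZR k * (IZR k * - sin (IZR k * x + (p - PI / 2)))).
      * apply is_derive_Rscal. auto_derive; auto. ring.
      * replace (IZR k * x + (p - PI / 2)) with (IZR k * x + p - PI / 2) by ring.
        rewrite sin_minus, cos_PI2, sin_PI2. field. auto.
    + apply cont_cos.
Qed.

Lemma cos_mul_Z k l p q x :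
  cos (IZR k * x + p) * cos (IZR l * x + q) =
  / 2 * (cos (IZR (k + l) * x + (p + q)) + cos (IZR (k - l) * x + (p - q))).
Proof.
  replace (IZR (k + l) * x + (p + q)) with ((IZR k * x + p) + (IZR l * x + q))
    by (rewrite plus_IZR; ring).
  replace (IZR (k - l) * x + (p - q)) with ((IZR k * x + p) - (IZR l * x + q))
    by (rewrite minus_IZR; ring).
  generalize (IZR k * x + p) (IZR l * x + q). intros A B.
  rewrite cos_plus, cos_minus. field.
Qed.

Lemma RInt_cos_mul k l p q :
  RInt (fun x => cos (IZR k * x + p) * cos (IZR l * x + q)) 0 (2 * PI) =
  / 2 * ((if Z.eq_dec (k + l) 0 then 2 * PI * cos (p + q) else 0) +
         (if Z.eq_dec (k - l) 0 then 2 * PI * cos (p - q) else 0)).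
Proof.
  rewrite (RInt_ext _ (fun x => / 2 * (cos (IZR (k + l) * x + (p + q)) +
    cos (IZR (k - l) * x + (p - q))))).
  - rewrite RInt_cont_scal by (apply cont_plus; apply cont_cos).
    rewrite RInt_cont_plus by apply cont_cos. now rewrite !RInt_cos_Z.
  - intros x _. apply cos_mul_Z.
Qed.

(** A continuous periodic function orthogonal to all trigonometric monomials vanishes at
    [x0]: otherwise its integral against [(1 - cos dl + cos (x - x0)) ^ n], which is zero,
    would grow exponentially with [n]. *)
Lemma fourier_uniqueness_pos (D : R -> R) :
  cont D -> (forall x, D (x + 2 * PI) = D x) ->
  (forall (k : Z) p, RInt (fun x => D x * cos (IZR k * x + p)) 0 (2 * PI) = 0) ->
  forall x0, ~ 0 < D x0.
Proof.
  intros HD Hper Horth x0 Hpos.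
  set (m := D x0) in *.
  assert (Hpi := PI_RGT_0).
  assert (Hc := HD x0). apply continuity_pt_filterlim in Hc.
  destruct (Hc (m / 2) ltac:(lra)) as [r [Hr Hcont]].
  set (dl := Rmin (r / 2) (PI / 2)).
  assert (Hdl : 0 < dl <= PI / 2 /\ dl < r).
  { unfold dl. assert (H1 := Rmin_l (r / 2) (PI / 2)). assert (H2 := Rmin_r (r / 2) (PI / 2)).
    assert (0 < Rmin (r / 2) (PI / 2)) by (apply Rmin_pos; lra). lra. }
  assert (Hnear : forall x, Rabs (x - x0) <= dl -> m / 2 <= D x).
  { intros x Hx. destruct (Req_dec x x0) as [->|Hne]; [fold m; lra|].
    assert (H := Hcont x). unfold R_met, dist in H; simpl in H. unfold R_dist in H.
    assert (Rabs (D x - D x0) < m / 2).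
    { apply H. split; [split; [exact I|congruence]|lra]. }
    apply Rabs_def2 in H0. fold m in H0. lra. }
  set (b := 1 - cos dl).
  set (P := fun x => b + cos (1 * x + - x0)).
  assert (HP : cont P) by (apply cont_plus; [apply cont_const|apply cont_cos]).
  assert (Hint : forall n (k : Z) p,
    RInt (fun x => D x * P x ^ n * cos (IZR k * x + p)) 0 (2 * PI) = 0).
  { induction n as [|n IH]; intros k p.
    - etransitivity; [|apply (Horth k p)]. apply RInt_ext. intros x _. simpl. ring.
    - assert (HDP : cont (fun x => D x * P x ^ n)) by (apply cont_mult; auto; now apply cont_pow).
      rewrite (RInt_ext _ (fun x => b * (D x * P x ^ n * cos (IZR k * x + p)) +
        / 2 * (D x * P x ^ n * cos (IZR (k + 1) * x + (p + - x0)) +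
               D x * P x ^ n * cos (IZR (k - 1) * x + (p - - x0))))).
      + assert (Hk : forall k p, cont (fun x => D x * P x ^ n * cos (IZR k * x + p))).
        { intros. apply cont_mult; auto. apply cont_cos. }
        rewrite RInt_cont_plus.
        * rewrite !RInt_cont_scal by (try apply cont_plus; apply Hk).
          rewrite RInt_cont_plus by apply Hk. rewrite !IH. Req. ring.
        * apply cont_mult; [apply cont_const|apply Hk].
        * apply cont_mult; [apply cont_const|apply cont_plus; apply Hk].
      + intros x _. simpl. rewrite <- Rmult_plus_distr_l.
        replace (/ 2 * (D x * P x ^ n * (cos (IZR (k + 1) * x + (p + - x0)) +
          cos (IZR (k - 1) * x + (p - - x0))))) with
          (D x * P x ^ n * (/ 2 * (cos (IZR (k + 1) * x + (p + - x0)) +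
          cos (IZR (k - 1) * x + (p - - x0))))) by ring.
        rewrite <- cos_mul_Z. unfold P. ring. }
  destruct (continuity_ab_maj (fun x => Rabs (D x)) (x0 - PI) (x0 + PI)) as [xm [Hxm _]]; [lra| |].
  { intros x _. apply continuity_pt_filterlim.
    apply (continuous_comp D Rabs); [apply HD|apply continuous_Rabs]. }
  set (B := Rabs (D xm)) in *.
  set (eta := cos (dl / 2) - cos dl).
  assert (Heta : 0 < eta).
  { unfold eta. assert (cos dl < cos (dl / 2)); [|lra]. apply cos_decreasing_1; lra. }
  assert (Hcosd : 0 <= cos dl) by (apply cos_ge_0; lra).
  assert (Hcos : forall t u, Rabs t <= u -> u <= PI -> cos u <= cos t).
  { intros t u Ht Hu. replace (cos t) with (cos (Rabs t)).
    - apply cos_decr_1; try lra; try apply Rabs_pos. assert (H := Rabs_pos t); lra.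
    - unfold Rabs. destruct Rcase_abs; auto. apply cos_neg. }
  assert (HPx : forall x, P x = b + cos (x - x0)) by (intros x; unfold P; do 2 f_equal; ring).
  set (G := fun n x => D x * P x ^ n + B).
  assert (HG : forall n, cont (G n)).
  { intros n. apply cont_plus; [apply cont_mult; auto; now apply cont_pow|apply cont_const]. }
  assert (HG0 : forall n x, x0 - PI <= x <= x0 + PI -> 0 <= G n x).
  { intros n x Hx. unfold G. rewrite HPx.
    destruct (Rle_dec (Rabs (x - x0)) dl) as [Hin|Hout].
    - assert (H1 := Hnear x Hin). assert (H2 := Hcos _ _ Hin ltac:(lra)).
      assert (0 <= D x * (b + cos (x - x0)) ^ n).
      { apply Rmult_le_pos; [lra|]. apply pow_le. unfold b. lra. }
      assert (0 <= B) by apply Rabs_pos. lra.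
    - assert (Hxa : Rabs (x - x0) <= PI) by (apply Rabs_le; lra).
      assert (H2 : cos (x - x0) <= cos dl).
      { replace (cos (x - x0)) with (cos (Rabs (x - x0))).
        - apply cos_decr_1; lra.
        - unfold Rabs. destruct Rcase_abs; auto. apply cos_neg. }
      assert (H3 := COS_bound (x - x0)). assert (H3' := COS_bound dl).
      assert (H4 : Rabs (b + cos (x - x0)) <= 1) by (apply Rabs_le; unfold b; lra).
      assert (H5 : Rabs (D x * (b + cos (x - x0)) ^ n) <= B).
      { rewrite Rabs_mult, <- RPow_abs. rewrite <- (Rmult_1_r B).
        apply Rmult_le_compat; [apply Rabs_pos|apply pow_le, Rabs_pos|now apply Hxm|].
        rewrite <- (pow1 n). apply pow_incr. split; auto. apply Rabs_pos. }
      apply Rabs_le_between in H5. lra. }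
  assert (Hlow : forall n, dl * (m / 2 * (1 + eta) ^ n) <= 2 * PI * B).
  { intros n.
    assert (Htot : RInt (G n) (x0 - PI) (x0 + PI) = 2 * PI * B).
    { unfold G. rewrite RInt_cont_plus; [|apply cont_mult; auto; now apply cont_pow|apply cont_const].
      rewrite RInt_const. unfold scal; simpl; unfold mult; simpl.
      replace (x0 + PI) with (x0 - PI + 2 * PI) by ring.
      rewrite RInt_periodic.
      - assert (E := Hint n 0%Z 0).
        rewrite (RInt_ext _ (fun x => D x * P x ^ n)) in E.
        + rewrite E. Req. ring.
        + intros x _. rewrite Rmult_0_l, Rplus_0_l, cos_0. Req. ring.
      - apply cont_mult; auto; now apply cont_pow.
      - intros x. rewrite Hper. f_equal. f_equal. unfold P. f_equal.
        apply (cos_period_Z 1). }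
    assert (E1 := RInt_Chasles (G n) (x0 - PI) (x0 - dl / 2) (x0 + PI)
      (cont_RInt _ _ _ (HG n)) (cont_RInt _ _ _ (HG n))).
    assert (E2 := RInt_Chasles (G n) (x0 - dl / 2) (x0 + dl / 2) (x0 + PI)
      (cont_RInt _ _ _ (HG n)) (cont_RInt _ _ _ (HG n))).
    change (RInt (G n) (x0 - PI) (x0 - dl / 2) + RInt (G n) (x0 - dl / 2) (x0 + PI) =
      RInt (G n) (x0 - PI) (x0 + PI)) in E1.
    change (RInt (G n) (x0 - dl / 2) (x0 + dl / 2) + RInt (G n) (x0 + dl / 2) (x0 + PI) =
      RInt (G n) (x0 - dl / 2) (x0 + PI)) in E2.
    assert (H1 : 0 <= RInt (G n) (x0 - PI) (x0 - dl / 2)).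
    { apply RInt_ge_0; [lra|apply cont_RInt, HG|]. intros x Hx. apply HG0. lra. }
    assert (H2 : 0 <= RInt (G n) (x0 + dl / 2) (x0 + PI)).
    { apply RInt_ge_0; [lra|apply cont_RInt, HG|]. intros x Hx. apply HG0. lra. }
    assert (H3 : RInt (fun _ => m / 2 * (1 + eta) ^ n) (x0 - dl / 2) (x0 + dl / 2) <=
      RInt (G n) (x0 - dl / 2) (x0 + dl / 2)).
    { apply RInt_le; [lra|apply cont_RInt, cont_const|apply cont_RInt, HG|].
      intros x Hx. unfold G. rewrite HPx.
      assert (Hxa : Rabs (x - x0) <= dl / 2) by (apply Rabs_le; lra).
      assert (H4 := Hnear x ltac:(lra)). assert (H5 := Hcos _ _ Hxa ltac:(lra)).
      assert (0 <= B) by apply Rabs_pos.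
      assert (m / 2 * (1 + eta) ^ n <= D x * (b + cos (x - x0)) ^ n); [|lra].
      apply Rmult_le_compat; [lra|apply pow_le; lra|exact H4|].
      apply pow_incr. unfold b, eta in *. lra. }
    rewrite RInt_const in H3. unfold scal in H3; simpl in H3; unfold mult in H3; simpl in H3.
    rewrite Htot in E1.
    replace (x0 + dl / 2 - (x0 - dl / 2)) with dl in H3 by field. lra. }
  destruct (Pow_x_infinity (1 + eta) ltac:(rewrite Rabs_pos_eq; lra)
    (2 * PI * B / (dl * (m / 2)) + 1)) as [n Hn].
  specialize (Hn n (le_n _)). specialize (Hlow n).
  rewrite Rabs_pos_eq in Hn by (apply pow_le; lra).
  assert (Hdm : 0 < dl * (m / 2)) by (apply Rmult_lt_0_compat; lra).
  assert ((dl * (m / 2)) * (2 * PI * B / (dl * (m / 2)) + 1) <= (dl * (m / 2)) * (1 + eta) ^ n)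
    by (apply Rmult_le_compat_l; lra).
  replace ((dl * (m / 2)) * (2 * PI * B / (dl * (m / 2)) + 1)) with
    (2 * PI * B + dl * (m / 2)) in H by (field; lra).
  lra.
Qed.

Lemma fourier_uniqueness (D : R -> R) :
  cont D -> (forall x, D (x + 2 * PI) = D x) ->
  (forall (k : Z) p, RInt (fun x => D x * cos (IZR k * x + p)) 0 (2 * PI) = 0) ->
  forall x, D x = 0.
Proof.
  intros HD Hper Horth x.
  assert (H1 := fourier_uniqueness_pos D HD Hper Horth x).
  assert (H2 : ~ 0 < - D x).
  { apply (fourier_uniqueness_pos (fun x => - D x)).
    - intros y. apply (continuous_opp D), HD.
    - intros y. now rewrite Hper.
    - intros k p. rewrite (RInt_ext _ (fun x => -1 * (D x * cos (IZR k * x + p)))).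
      + rewrite RInt_cont_scal by (apply cont_mult; [auto|apply cont_cos]).
        rewrite Horth. Req. ring.
      + intros y _. Req. ring. }
  lra.
Qed.

Definition fcoef (phi : R -> R) (k : nat) (p : R) : R :=
  RInt (fun x => phi x * cos (INR k * x + p)) 0 (2 * PI).

Lemma fcoef_derive (phi dphi : R -> R) k p :
  (forall x, is_derive phi x (dphi x)) -> cont dphi ->
  (forall x, phi (x + 2 * PI) = phi x) ->
  INR k * fcoef phi k p = - fcoef dphi k (p - PI / 2).
Proof.
  intros Hd Hc Hper. unfold fcoef.
  assert (Hphi : cont phi) by now apply (cont_derive phi dphi).
  assert (C1 : cont (fun x => dphi x * cos (INR k * x + (p - PI / 2)))).
  { apply cont_mult; auto. apply cont_cos. }
  assert (C2 : cont (fun x => phi x * cos (INR k * x + p))).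
  { apply cont_mult; auto. apply cont_cos. }
  assert (E : RInt (fun x => dphi x * cos (INR k * x + (p - PI / 2)) +
    INR k * (phi x * cos (INR k * x + p))) 0 (2 * PI) = 0).
  { rewrite (RInt_of_derive (fun x => phi x * cos (INR k * x + (p - PI / 2)))).
    - rewrite <- (Hper 0), <- (cos_period_INR k 0), Rplus_0_l. now apply Rminus_diag_eq.
    - intros x.
      replace (INR k * (phi x * cos (INR k * x + p))) with
        (phi x * (INR k * - sin (INR k * x + (p - PI / 2)))).
      + apply (is_derive_Rmult phi (fun x => cos (INR k * x + (p - PI / 2)))); auto.
        auto_derive; auto. ring.
      + replace (INR k * x + (p - PI / 2)) with (INR k * x + p - PI / 2) by ring.
        rewrite sin_minus, cos_PI2, sin_PI2. ring.
    - apply cont_plus; auto. apply cont_mult; [apply cont_const|auto]. }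
  rewrite RInt_cont_plus, RInt_cont_scal in E; auto.
  - lra.
  - apply cont_mult; [apply cont_const|auto].
Qed.

(** Cauchy estimates for the successive derivatives [ph n] of a periodic function, over the
    one period that the Fourier coefficients involve. *)
Definition analytic_growth (ph : nat -> R -> R) (M r : R) : Prop :=
  (forall n x, is_derive (ph n) x (ph (S n) x)) /\
  (forall n x, ph n (x + 2 * PI) = ph n x) /\
  (forall n x, 0 <= x <= 2 * PI -> Rabs (ph n x) <= M * INR (fact n) * (/ r) ^ n).

Section Decay.
Context (ph : nat -> R -> R) (M r : R) (Hr : 0 < r) (Hph : analytic_growth ph M r).

Lemma growth_cont n : cont (ph n).
Proof. apply (cont_derive (ph n) (ph (S n))). apply Hph. Qed.

Lemma growth_M_ge0 : 0 <= M.
Proof.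
  destruct Hph as (_ & _ & H). assert (Hpi := PI_RGT_0).
  assert (H0 := H 0%nat 0 ltac:(lra)). simpl in H0.
  assert (H1 := Rabs_pos (ph 0%nat 0)). lra.
Qed.

Lemma fcoef_growth n k : forall m p,
  INR k ^ n * Rabs (fcoef (ph m) k p) <= 2 * PI * (M * INR (fact (n + m)) * (/ r) ^ (n + m)).
Proof.
  assert (Hpi := PI_RGT_0). assert (HM := growth_M_ge0).
  induction n as [|n IH]; intros m p.
  - rewrite Rmult_1_l. simpl Nat.add.
    replace (2 * PI) with (2 * PI - 0) at 1 by ring.
    apply (abs_RInt_le_const (fun x => ph m x * cos (INR k * x + p)) 0 (2 * PI)); [lra| |].
    + apply cont_RInt, cont_mult; [apply growth_cont|apply cont_cos].
    + intros t Ht. rewrite Rabs_mult. rewrite <- (Rmult_1_r (M * _ * _)).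
      apply Rmult_le_compat; auto using Rabs_pos; [now apply Hph|].
      apply Rabs_le, COS_bound.
  - replace (INR k ^ S n * Rabs (fcoef (ph m) k p)) with
      (INR k ^ n * Rabs (INR k * fcoef (ph m) k p)).
    + rewrite (fcoef_derive (ph m) (ph (S m))); [|apply Hph|apply growth_cont|apply Hph].
      rewrite Rabs_Ropp. eapply Rle_trans; [apply IH|].
      replace (n + S m)%nat with (S n + m)%nat by lia. lra.
    + rewrite Rabs_mult, (Rabs_pos_eq (INR k)) by apply pos_INR. simpl. ring.
Qed.

(** Summing the bounds of all orders gives the exponential decay without optimising the
    order. *)
Lemma fcoef_decay k p : exp (r / 2 * INR k) * Rabs (fcoef (ph 0%nat) k p) <= 4 * PI * M.
Proof.
  assert (Hpi := PI_RGT_0). assert (HM := growth_M_ge0).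
  set (A := Rabs (fcoef (ph 0%nat) k p)).
  assert (H1 := is_series_Rmult A _ _ (is_series_exp (r / 2 * INR k))).
  assert (H2 := is_series_Rmult (2 * PI * M) _ _ (is_series_geom (/ 2)
    ltac:(rewrite Rabs_pos_eq; lra))).
  rewrite Rmult_comm.
  replace (4 * PI * M) with (2 * PI * M * / (1 - / 2)) by field.
  apply (is_series_le _ _ _ _ H1 H2). intros n. cbv beta.
  assert (H := fcoef_growth n k 0 p). fold A in H. rewrite Nat.add_0_r in H.
  assert (Hf := INR_fact_lt_0 n).
  assert (Hrn : 0 < (r / 2) ^ n) by (apply pow_lt; lra).
  rewrite Rpow_mult_distr.
  replace (A * (/ INR (fact n) * ((r / 2) ^ n * INR k ^ n))) with
    (/ INR (fact n) * (r / 2) ^ n * (INR k ^ n * A)) by ring.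
  replace (2 * PI * M * (/ 2) ^ n) with
    (/ INR (fact n) * (r / 2) ^ n * (2 * PI * (M * INR (fact n) * (/ r) ^ n))).
  - apply Rmult_le_compat_l; auto. apply Rmult_le_pos; [|lra].
    left; now apply Rinv_0_lt_compat.
  - replace ((/ 2) ^ n) with ((r / 2) ^ n * (/ r) ^ n).
    + field. lra.
    + rewrite <- Rpow_mult_distr. f_equal. field. lra.
Qed.

End Decay.

Lemma RInt_cont_sum (T : nat -> R -> R) a b N :
  (forall k, cont (T k)) ->
  cont (fun x => sum_n (fun k => T k x) N) /\
  RInt (fun x => sum_n (fun k => T k x) N) a b = sum_n (fun k => RInt (T k) a b) N.
Proof.
  intros HT. induction N as [|N [IH1 IH2]].
  - split.
    + intros x. apply (continuous_ext (T 0%nat)); [|apply HT]. intros y. now rewrite sum_O.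
    + rewrite sum_O. apply RInt_ext. intros x _. now rewrite sum_O.
  - assert (E : forall x, sum_n (fun k => T k x) (S N) = sum_n (fun k => T k x) N + T (S N) x)
      by (intros x; now rewrite sum_Sn).
    split.
    + intros x. apply (continuous_ext (fun x => sum_n (fun k => T k x) N + T (S N) x)).
      * intros y. now rewrite E.
      * now apply cont_plus.
    + rewrite sum_Sn, <- IH2. etransitivity; [apply RInt_ext; intros x _; apply E|].
      now apply RInt_cont_plus.
Qed.

Lemma RInt_series (T : nat -> R -> R) (S g : R -> R) (B : nat -> R) (Bs a b : R) :
  a <= b -> (forall k, cont (T k)) -> cont S -> cont g -> (forall x, Rabs (g x) <= 1) ->
  (forall k x, Rabs (T k x) <= B k) -> is_series B Bs ->
  (forall x, is_series (fun k => T k x) (S x)) ->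
  is_series (fun k => RInt (fun x => T k x * g x) a b) (RInt (fun x => S x * g x) a b).
Proof.
  intros Hab HT HS Hg Hg1 HB HBs Hser.
  assert (Htail : forall N x, Rabs (sum_n (fun k => T k x) N - S x) <= Bs - sum_n B N).
  { intros N x.
    assert (H1 : is_series (fun k => T (Datatypes.S N + k)%nat x) (S x - sum_n (fun k => T k x) N)).
    { apply (is_series_incr_n (fun k => T k x) (Datatypes.S N)); [lia|].
      apply (is_series_eq _ _ _ _ (Hser x)); auto. simpl.
      assert (E : forall y z : R, y = y - z + z) by (intros; ring). apply E. }
    assert (H2 : is_series (fun k => B (Datatypes.S N + k)%nat) (Bs - sum_n B N)).
    { apply (is_series_incr_n B (Datatypes.S N)); [lia|].
      apply (is_series_eq _ _ _ _ HBs); auto. simpl.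
      assert (E : forall y z : R, y = y - z + z) by (intros; ring). apply E. }
    destruct (is_series_dominated (fun k => T (Datatypes.S N + k)%nat x) _ _ H2
      (fun k => HB _ x)) as [l [Hl Hl2]].
    rewrite Rabs_minus_sym, (is_series_inj _ _ _ H1 Hl). exact Hl2. }
  assert (HTg : forall k, cont (fun x => T k x * g x)) by (intros; now apply cont_mult).
  assert (HSg : cont (fun x => S x * g x)) by now apply cont_mult.
  assert (Hd : forall N, Rabs (sum_n (fun k => RInt (fun x => T k x * g x) a b) N -
    RInt (fun x => S x * g x) a b) <= (b - a) * (Bs - sum_n B N)).
  { intros N. destruct (RInt_cont_sum (fun k x => T k x * g x) a b N HTg) as [C1 E1].
    rewrite <- E1. rewrite <- RInt_cont_minus by auto.
    apply abs_RInt_le_const; auto.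
    - apply cont_RInt. now apply cont_minus.
    - intros t _.
      replace (sum_n (fun k => T k t * g t) N - S t * g t) with
        ((sum_n (fun k => T k t) N - S t) * g t).
      + rewrite Rabs_mult, <- (Rmult_1_r (Bs - _)).
        apply Rmult_le_compat; auto using Rabs_pos.
      + rewrite Rmult_minus_distr_r. f_equal.
        clear. induction N as [|N IH]; [now rewrite !sum_O|].
        rewrite !sum_Sn, <- IH. unfold plus; simpl. ring. }
  assert (Hlim : is_lim_seq (fun N => (b - a) * (Bs - sum_n B N)) ((b - a) * (Bs - Bs))).
  { apply (is_lim_seq_scal_l (fun N => Bs - sum_n B N) (b - a) (Bs - Bs)).
    apply is_lim_seq_minus'; [apply is_lim_seq_const|exact HBs]. }
  replace ((b - a) * (Bs - Bs)) with 0 in Hlim by ring.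
  assert (H0 : is_lim_seq (fun N => sum_n (fun k => RInt (fun x => T k x * g x) a b) N -
    RInt (fun x => S x * g x) a b) 0).
  { apply (proj2 (is_lim_seq_abs_0 _)).
    apply (is_lim_seq_le_le (fun _ => 0) _ _ 0) with (2 := is_lim_seq_const 0) (3 := Hlim).
    intros N. split; [apply Rabs_pos|apply Hd]. }
  assert (H1 := is_lim_seq_plus' _ _ _ _ H0 (is_lim_seq_const (RInt (fun x => S x * g x) a b))).
  rewrite Rplus_0_l in H1.
  refine (is_lim_seq_ext _ (sum_n (fun k => RInt (fun x => T k x * g x) a b)) _ _ H1).
  intros N. simpl. Req. ring.
Qed.

Lemma is_series_single (b : nat -> R) l :
  (forall k, k <> l -> b k = 0) -> is_series b (b l).
Proof.
  intros Hb. apply (is_series_eq _ _ (sum_n b l) _ (is_series_finite b l (fun k Hk => Hb k ltac:(lia))));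
    auto.
  assert (H0 : forall n, (n < l)%nat -> sum_n b n = 0).
  { intros n Hn. rewrite (sum_n_ext_loc b (fun _ => 0)).
    - rewrite sum_n_const. Req. ring.
    - intros k Hk. apply Hb. lia. }
  destruct l as [|l]; [now rewrite sum_O|].
  rewrite sum_Sn, H0 by lia. apply Rplus_0_l.
Qed.

Lemma exp_pow x k : exp x ^ k = exp (x * INR k).
Proof.
  induction k as [|k IH]; [simpl; now rewrite Rmult_0_r, exp_0|].
  rewrite S_INR, Rmult_plus_distr_l, Rmult_1_r, exp_plus, <- IH. simpl. ring.
Qed.

Section Fourier.
Context (ph : nat -> R -> R) (M r : R) (Hr : 0 < r) (Hph : analytic_growth ph M r).

Let phi := ph 0%nat.
Let c (k : nat) : R := match k with O => / (2 * PI) | _ => / PI end.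

Definition fourier_term (k : nat) (x : R) : R :=
  c k * (fcoef phi k 0 * cos (INR k * x + 0) + fcoef phi k (- (PI / 2)) * cos (INR k * x + - (PI / 2))).

Lemma fourier_term_V s sigma k :
  0 <= s -> 0 <= sigma <= r / 4 ->
  V s sigma (8 * M * exp (- (r / 4)) ^ k) (fun _ x => fourier_term k x).
Proof.
  intros Hs Hsig. assert (Hpi := PI_RGT_0).
  assert (Hc : 0 <= c k <= / PI).
  { unfold c. destruct k; split; try (left; apply Rinv_0_lt_compat; lra); [|lra].
    apply Rinv_le_contravar; lra. }
  assert (HM := growth_M_ge0 ph M r Hph).
  assert (Hterm : forall p, V s sigma (4 * PI * M * exp (- (r / 4)) ^ k)
    (fun _ x => fcoef phi k p * cos (INR k * x + p))).
  { intros p. eapply V_le.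
    - apply (V_ext _ _ _ (fun e x => ev (Atom (fcoef phi k p) 0 0 k p) 1 e x)).
      + apply (W_at 1); [apply W_atom; auto; lra|rewrite Rabs_R1; lra].
      + intros e x _. unfold ev; simpl. ring.
    - unfold wt; simpl. rewrite !Rmult_1_l.
      assert (H := fcoef_decay ph M r Hr Hph k p). fold phi in H.
      assert (Hexp : exp (sigma * INR k) <= exp (r / 2 * INR k) * exp (- (r / 4)) ^ k).
      { rewrite exp_pow, <- exp_plus. apply exp_le.
        replace (r / 2 * INR k + - (r / 4) * INR k) with (r / 4 * INR k) by field.
        apply Rmult_le_compat_r; [apply pos_INR|lra]. }
      assert (H0 := Rabs_pos (fcoef phi k p)).
      assert (H1 : 0 < exp (- (r / 4)) ^ k) by apply pow_lt, exp_pos.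
      apply Rle_trans with (Rabs (fcoef phi k p) * (exp (r / 2 * INR k) * exp (- (r / 4)) ^ k)).
      + now apply Rmult_le_compat_l.
      + rewrite <- Rmult_assoc. apply Rmult_le_compat_r; [lra|]. rewrite Rmult_comm. exact H. }
  eapply V_le.
  - eapply (V_scal _ _ _ (c k) (fun _ x => fcoef phi k 0 * cos (INR k * x + 0) +
      fcoef phi k (- (PI / 2)) * cos (INR k * x + - (PI / 2)))).
    eapply V_add; apply Hterm.
  - rewrite Rabs_pos_eq by lra.
    set (E := exp (- (r / 4)) ^ k). assert (H1 : 0 < E) by apply pow_lt, exp_pos.
    clearbody E. apply Rle_trans with (/ PI * (4 * PI * M * E + 4 * PI * M * E)).
    + apply Rmult_le_compat_r; [|lra].
      assert (0 <= 4 * PI * M * E) by (repeat (first [lra|apply Rmult_le_pos])). lra.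
    + right. field. lra.
Qed.

Lemma fourier_sum_V s :
  0 <= s -> exists S, V s (r / 4) (8 * M * / (1 - exp (- (r / 4)))) (fun _ x => S x) /\
    (forall x, is_series (fun k => fourier_term k x) (S x)).
Proof.
  intros Hs.
  assert (He : 0 < exp (- (r / 4)) < 1).
  { split; [apply exp_pos|]. rewrite <- exp_0. apply exp_increasing. lra. }
  assert (Hgeo := is_series_Rmult (8 * M) _ _ (is_series_geom (exp (- (r / 4)))
    ltac:(rewrite Rabs_pos_eq; lra))).
  assert (Hser : forall x, is_series (fun k => fourier_term k x)
    (Series (fun k => fourier_term k x))).
  { intros x. apply Series_correct.
    destruct (is_series_dominated (fun k => fourier_term k x) _ _ Hgeo) as [l [Hl _]].
    - intros k. apply (V_bound s (r / 4) _ _ 0 x (fourier_term_V s (r / 4) k Hs ltac:(lra))).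
      rewrite Rabs_R0. lra.
    - now exists l. }
  exists (fun x => Series (fun k => fourier_term k x)). split; auto.
  eapply (V_sum s (r / 4) _ _ _ (fun k _ x => fourier_term k x) _
    (fun k => fourier_term_V s (r / 4) k Hs ltac:(lra)) Hgeo); [lra|].
  intros e x _. apply Hser.
Qed.

Lemma fourier_term_orthogonality k (l : nat) p :
  RInt (fun x => fourier_term k x * cos (INR l * x + p)) 0 (2 * PI) =
  if Nat.eq_dec k l then fcoef phi l p else 0.
Proof.
  assert (Hpi := PI_RGT_0).
  set (A := fcoef phi k 0). set (B := fcoef phi k (- (PI / 2))).
  assert (E : RInt (fun x => fourier_term k x * cos (INR l * x + p)) 0 (2 * PI) =
    c k * A * RInt (fun x => cos (INR k * x + 0) * cos (INR l * x + p)) 0 (2 * PI) +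
    c k * B * RInt (fun x => cos (INR k * x + - (PI / 2)) * cos (INR l * x + p)) 0 (2 * PI)).
  { assert (C1 : forall q, cont (fun x => cos (INR k * x + q) * cos (INR l * x + p))).
    { intros q. apply cont_mult; apply cont_cos. }
    rewrite <- !RInt_cont_scal, <- RInt_cont_plus by
      (try (apply cont_mult; [apply cont_const|]); apply C1).
    apply RInt_ext. intros x _. unfold fourier_term. fold A B. Req. ring. }
  rewrite E, !INR_IZR_INZ, !RInt_cos_mul.
  destruct (Nat.eq_dec k l) as [->|Hkl].
  - assert (Hphi : cont phi) by apply (growth_cont ph M r Hph).
    assert (Ef : fcoef phi l p = cos p * A - sin p * B).
    { unfold A, B, fcoef.
      assert (C1 : forall q, cont (fun x => phi x * cos (INR l * x + q))).
      { intros q. apply cont_mult; auto. apply cont_cos. }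
      rewrite <- !RInt_cont_scal, <- RInt_cont_minus by
        (try (apply cont_mult; [apply cont_const|]); apply C1).
      apply RInt_ext. intros x _. Req.
      replace (INR l * x + - (PI / 2)) with (INR l * x - PI / 2) by ring.
      rewrite Rplus_0_r, cos_plus, cos_minus, cos_PI2, sin_PI2. ring. }
    rewrite Ef.
    assert (Es : cos (- (PI / 2) - p) = - sin p).
    { rewrite cos_minus, cos_neg, sin_neg, cos_PI2, sin_PI2. ring. }
    assert (Ea : cos (- (PI / 2) + p) = sin p).
    { rewrite cos_plus, cos_neg, sin_neg, cos_PI2, sin_PI2. ring. }
    replace (0 - p) with (- p) by ring. rewrite Es, Ea, cos_neg, Rplus_0_l.
    destruct (Z.eq_dec (Z.of_nat l - Z.of_nat l) 0); [|lia].
    destruct l as [|l].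
    + destruct (Z.eq_dec (Z.of_nat 0 + Z.of_nat 0) 0); [|lia].
      assert (HB0 : B = 0).
      { unfold B, fcoef. rewrite (RInt_ext _ (fun _ => 0)).
        - rewrite RInt_const. apply Rmult_0_r.
        - intros x _. simpl INR. rewrite Rmult_0_l, Rplus_0_l, cos_neg, cos_PI2. Req. ring. }
      rewrite HB0. unfold c. Req. field. lra.
    + destruct (Z.eq_dec (Z.of_nat (S l) + Z.of_nat (S l)) 0); [lia|].
      unfold c. Req. field. lra.
  - destruct (Z.eq_dec (Z.of_nat k + Z.of_nat l) 0); [lia|].
    destruct (Z.eq_dec (Z.of_nat k - Z.of_nat l) 0); [lia|]. Req. ring.
Qed.

(** The sum of the Fourier series has the coefficients of [phi], and uniqueness applies to the
    difference. *)
Lemma fourier_expansion s :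
  0 <= s -> V s (r / 4) (8 * M * / (1 - exp (- (r / 4)))) (fun _ x => phi x).
Proof.
  intros Hs. destruct (fourier_sum_V s Hs) as (S & HS & Hser).
  assert (He0 : Rabs 0 <= s) by (rewrite Rabs_R0; lra).
  assert (HcS : cont S).
  { destruct (V_derive _ _ _ _ (r / 4) HS ltac:(lra)) as (v & _ & Hv).
    apply (cont_derive S (v 0)). intros x. now apply (Hv 0 x). }
  assert (Hphi : cont phi) by apply (growth_cont ph M r Hph).
  assert (Hperp : forall x, phi (x + 2 * PI) = phi x) by apply Hph.
  assert (HperS : forall x, S (x + 2 * PI) = S x) by (intros x; apply (V_periodic _ _ _ _ 0 x HS He0)).
  assert (He : 0 < exp (- (r / 4)) < 1).
  { split; [apply exp_pos|]. rewrite <- exp_0. apply exp_increasing. lra. }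
  assert (Hgeo := is_series_Rmult (8 * M) _ _ (is_series_geom (exp (- (r / 4)))
    ltac:(rewrite Rabs_pos_eq; lra))).
  assert (HSc : forall (l : nat) p, RInt (fun x => S x * cos (INR l * x + p)) 0 (2 * PI) = fcoef phi l p).
  { intros l p.
    assert (Hpi := PI_RGT_0).
    assert (H1 := RInt_series fourier_term S (fun x => cos (INR l * x + p))
      (fun k => 8 * M * exp (- (r / 4)) ^ k) (8 * M * / (1 - exp (- (r / 4)))) 0 (2 * PI)
      ltac:(lra)).
    assert (Hct : forall k, cont (fourier_term k)).
    { intros k. destruct (V_derive _ _ _ _ (r / 4) (fourier_term_V s (r / 4) k Hs ltac:(lra))
        ltac:(lra)) as (v & _ & Hv).
      apply (cont_derive _ (v 0)). intros x. now apply (Hv 0 x). }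
    specialize (H1 Hct HcS (cont_cos _ _)).
    assert (Hcb : forall x, Rabs (cos (INR l * x + p)) <= 1) by (intros; apply Rabs_le, COS_bound).
    specialize (H1 Hcb (fun k x => V_bound s (r / 4) _ _ 0 x
      (fourier_term_V s (r / 4) k Hs ltac:(lra)) He0) Hgeo Hser).
    apply (is_series_inj _ _ _ H1).
    assert (H2 := is_series_single (fun k => RInt (fun x => fourier_term k x * cos (INR l * x + p))
      0 (2 * PI)) l).
    cbv beta in H2. rewrite (fourier_term_orthogonality l) in H2.
    destruct (Nat.eq_dec l l); [|lia]. apply H2.
    intros k Hk. rewrite fourier_term_orthogonality. destruct (Nat.eq_dec k l); [lia|reflexivity]. }
  assert (Horth : forall (l : nat) p,
    RInt (fun x => (phi x - S x) * cos (INR l * x + p)) 0 (2 * PI) = 0).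
  { intros l p.
    rewrite (RInt_ext _ (fun x => phi x * cos (INR l * x + p) - S x * cos (INR l * x + p))).
    - rewrite RInt_cont_minus by (apply cont_mult; auto; apply cont_cos).
      rewrite HSc. apply Rminus_diag_eq. reflexivity.
    - intros x _. Req. ring. }
  assert (Hzero : forall x, phi x - S x = 0).
  { apply (fourier_uniqueness (fun x => phi x - S x)).
    - now apply cont_minus.
    - intros x. now rewrite Hperp, HperS.
    - intros k p. destruct (Z.le_gt_cases 0 k).
      + rewrite <- (Z2Nat.id k) by auto. etransitivity; [|apply (Horth (Z.to_nat k) p)].
        apply RInt_ext. intros x _. now rewrite INR_IZR_INZ.
      + etransitivity; [|apply (Horth (Z.to_nat (- k)) (- p))].
        apply RInt_ext. intros x _. rewrite INR_IZR_INZ, Z2Nat.id, opp_IZR by lia.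
        rewrite <- (cos_neg (IZR k * x + p)). Req. f_equal. f_equal. ring. }
  apply (V_ext _ _ _ _ _ HS). intros e x _. specialize (Hzero x). lra.
Qed.

End Fourier.

(** * From analytic functions to absolutely convergent trigonometric series *)

Definition real_analytic2 (f : R -> R -> R) (x y : R) : Prop :=
  exists (c : nat -> nat -> R) (r : R), 0 < r /\
    forall s z, Rabs s < r -> Rabs z < r ->
      ex_series (fun n => sum_n (fun j => Rabs (c j (n - j)%nat * (s ^ j * z ^ (n - j)))) n) /\
      is_series (fun n => sum_n (fun j => c j (n - j)%nat * (s ^ j * z ^ (n - j))) n)
        (f (x + s) (y + z)).

Lemma diag_col_inv (a : nat -> nat -> R) j l :
  is_series (fun n => diag a n j) l -> is_series (a j) l.
Proof.
  intros H. destruct j as [|j].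
  - apply (is_series_eq _ _ _ _ H); auto. intros n. unfold diag. simpl. now rewrite Nat.sub_0_r.
  - apply (is_series_eq (fun n => diag a (S j + n)%nat (S j)) _ l); auto.
    + apply (is_series_incr_n (fun n => diag a n (S j)) (S j)); [lia|].
      apply (is_series_eq _ _ _ _ H); auto.
      assert (E : sum_n (fun n => diag a n (S j)) (Init.Nat.pred (S j)) = 0).
      { simpl. rewrite (sum_n_ext_loc _ (fun _ => 0)).
        - rewrite sum_n_const. ring.
        - intros n Hn. unfold diag. destruct (Nat.leb_spec (S j) n); [lia|reflexivity]. }
      change (l = (l : R) + sum_n (fun n => diag a n (S j)) (Init.Nat.pred (S j))).
      rewrite E. symmetry. apply Rplus_0_r.
    + intros n. unfold diag. destruct (Nat.leb_spec (S j) (S j + n)); [|lia]. f_equal. lia.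
Qed.

Lemma iterated_of_double_series (a : nat -> nat -> R) (S : R) :
  ex_series (fun n => sum_n (fun j => Rabs (a j (n - j)%nat)) n) ->
  is_series (fun n => sum_n (fun j => a j (n - j)%nat) n) S ->
  exists (A B : nat -> R) (T : R),
    (forall k, is_series (fun j => Rabs (a j k)) (B k)) /\ is_series B T /\
    (forall k, is_series (fun j => a j k) (A k)) /\ is_series A S.
Proof.
  intros [T HT] HS.
  set (N := fun j k => Rabs (a j k)).
  assert (HdN : forall n j, Rabs (diag N n j) <= diag N n j).
  { intros n j. unfold diag, N. destruct Nat.leb; [|rewrite Rabs_R0; lra].
    rewrite Rabs_Rabsolu. lra. }
  assert (Hda : forall n j, Rabs (diag a n j) <= diag N n j).
  { intros n j. unfold diag, N. destruct Nat.leb; [lra|rewrite Rabs_R0; lra]. }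
  destruct (is_series_swap (diag N) (diag N) _ _ T T HdN (diag_row N) HT (diag_row N) HT)
    as [C [HC1 HC2]].
  destruct (is_series_swap (diag a) (diag N) _ _ S T Hda (diag_row N) HT (diag_row a) HS)
    as [D [HD1 HD2]].
  assert (HNN : forall j k, Rabs (N j k) <= N j k).
  { intros j k. unfold N. rewrite Rabs_Rabsolu. lra. }
  assert (HaN : forall j k, Rabs (a j k) <= N j k) by (intros; unfold N; lra).
  assert (HC : forall j, is_series (N j) (C j)) by (intros j; apply diag_col_inv, HC1).
  assert (HD : forall j, is_series (a j) (D j)) by (intros j; apply diag_col_inv, HD1).
  destruct (is_series_swap N N C C T T HNN HC HC2 HC HC2) as [B [HB1 HB2]].
  destruct (is_series_swap a N D C S T HaN HC HC2 HD HD2) as [A [HA1 HA2]].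
  exists A, B, T. auto.
Qed.

Lemma CV_radius_ge (a : nat -> R) r l :
  0 <= r -> is_series (fun n => Rabs (a n) * r ^ n) l -> Rbar_le r (CV_radius a).
Proof.
  intros Hr Hl. apply Rbar_not_lt_le. intros Hlt.
  rewrite <- (Rabs_pos_eq r) in Hlt by auto.
  apply (CV_disk_outside a r Hlt).
  apply ex_series_lim_0. destruct (is_series_dominated (fun n => a n * r ^ n) _ _ Hl) as [l' [H _]].
  - intros n. rewrite Rabs_mult, <- RPow_abs, (Rabs_pos_eq r) by auto. lra.
  - now exists l'.
Qed.

(** The bound [M] is the same for all the orders [m] in the action, so that the Fourier series of
    all the coefficients converge in one strip. *)
Definition local_expansion (f : R -> R -> R) (y x rho M : R) (c : nat -> nat -> R) : Prop :=
  0 < rho /\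
  (forall m, exists N, is_series (fun j => Rabs (c j m) * rho ^ j) N /\ N * rho ^ m <= M) /\
  (forall s z, Rabs s <= rho -> Rabs z <= rho ->
     is_series (fun m => PSeries (fun j => c j m) s * z ^ m) (f (x + s) (y + z))).

Lemma local_expansion_exists f y x :
  real_analytic2 f x y -> exists rho M c, local_expansion f y x rho M c.
Proof.
  intros (c & r & Hr & H).
  set (rho := r / 2). assert (Hrho : 0 < rho < r) by (unfold rho; lra).
  assert (Hin : forall u, Rabs u <= rho -> Rabs u < r) by (intros; lra).
  destruct (H rho rho) as [H1 H2]; try (rewrite Rabs_pos_eq; lra).
  destruct (iterated_of_double_series (fun j k => c j k * (rho ^ j * rho ^ k)) _ H1 H2)
    as (A0 & B & T & HB & HT & _).
  assert (Hp : forall m, 0 < rho ^ m) by (intros; apply pow_lt; lra).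
  assert (HN : forall m, is_series (fun j => Rabs (c j m) * rho ^ j) (/ rho ^ m * B m)).
  { intros m. apply (is_series_eq _ _ _ _ (is_series_Rmult (/ rho ^ m) _ _ (HB m))); auto.
    intros j. cbv beta. rewrite !Rabs_mult, (Rabs_pos_eq (rho ^ j)), (Rabs_pos_eq (rho ^ m))
      by (left; apply Hp). specialize (Hp m). field. lra. }
  exists rho, T, c. split; [apply Hrho|]. split.
  - intros m. exists (/ rho ^ m * B m). split; [apply HN|].
    replace (/ rho ^ m * B m * rho ^ m) with (B m) by (specialize (Hp m); field; lra).
    apply (term_le_series _ _ _ HT). intros k. apply (is_series_ge0 _ _ (HB k)).
    intros; apply Rabs_pos.
  - intros s z Hs Hz.
    destruct (H s z (Hin _ Hs) (Hin _ Hz)) as [H3 H4].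
    destruct (iterated_of_double_series (fun j k => c j k * (s ^ j * z ^ k)) _ H3 H4)
      as (A & _ & _ & _ & _ & HA & HAS).
    apply (is_series_eq _ _ _ _ HAS); auto. intros m.
    apply (is_series_inj _ _ _ (HA m)).
    destruct (is_series_dominated (fun j => c j m * s ^ j) _ _ (HN m)) as [l [Hl _]].
    { intros j. rewrite Rabs_mult, <- RPow_abs. apply Rmult_le_compat_l; [apply Rabs_pos|].
      apply pow_incr. split; auto. apply Rabs_pos. }
    assert (E : PSeries (fun j => c j m) s = l) by (apply is_series_unique; exact Hl).
    rewrite E.
    apply (is_series_eq _ _ _ _ (is_series_Rmult (z ^ m) _ _ Hl)).
    + intros j. ring.
    + ring.
Qed.

(** A binomial coefficient is at most a power of two. *)
Lemma fact_plus_le k n : INR (fact (k + n)) <= INR (fact k) * INR (fact n) * 2 ^ (k + n).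
Proof.
  remember (k + n)%nat as N eqn:E. revert k n E.
  induction N as [|N IH]; intros k n E.
  - replace k with 0%nat by lia. replace n with 0%nat by lia. simpl. lra.
  - assert (H2 : 1 <= 2 ^ N) by (apply pow_R1_Rle; lra).
    assert (Hf : forall m, 1 <= INR (fact m)).
    { intros m. apply (le_INR 1). apply lt_O_fact. }
    destruct k as [|k]; [simpl in E; subst n|destruct n as [|n]].
    + simpl fact at 2. rewrite Rmult_1_l. rewrite <- (Rmult_1_r (INR _)) at 1.
      apply Rmult_le_compat_l; [left; apply INR_fact_lt_0|]. simpl. lra.
    + replace (S k) with (S N) by lia. change (fact 0) with 1%nat. simpl INR at 3.
      rewrite Rmult_1_r. rewrite <- (Rmult_1_r (INR _)) at 1.
      apply Rmult_le_compat_l; [left; apply INR_fact_lt_0|]. simpl. lra.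
    + assert (H1 := IH k (S n) ltac:(lia)). assert (H3 := IH (S k) n ltac:(lia)).
      replace (INR (fact (S N))) with ((INR (S k) + INR (S n)) * INR (fact N)).
      * assert (E1 : INR (fact (S k)) = INR (S k) * INR (fact k))
          by (rewrite <- mult_INR; f_equal; simpl; lia).
        assert (E2 : INR (fact (S n)) = INR (S n) * INR (fact n))
          by (rewrite <- mult_INR; f_equal; simpl; lia).
        rewrite E1 in *. rewrite E2 in *. simpl pow.
        assert (P1 := pos_INR (S k)). assert (P2 := pos_INR (S n)).
        assert (INR (S k) * INR (fact N) <= INR (S k) * (INR (fact k) * (INR (S n) * INR (fact n)) * 2 ^ N))
          by now apply Rmult_le_compat_l.
        assert (INR (S n) * INR (fact N) <= INR (S n) * (INR (S k) * INR (fact k) * INR (fact n) * 2 ^ N))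
          by now apply Rmult_le_compat_l.
        lra.
      * rewrite <- plus_INR, <- mult_INR. f_equal.
        replace (S k + S n)%nat with (S N) by lia. reflexivity.
Qed.

Lemma PSeries_derive_n_bound (a : nat -> R) (rho N s : R) n :
  0 < rho -> is_series (fun j => Rabs (a j) * rho ^ j) N -> Rabs s <= rho / 2 ->
  Rabs (PSeries (PS_derive_n n a) s) <= N * INR (fact n) * (2 / rho) ^ n.
Proof.
  intros Hr HN Hs.
  assert (Hpos : forall j, 0 <= Rabs (a j) * rho ^ j).
  { intros j. apply Rmult_le_pos; [apply Rabs_pos|apply pow_le; lra]. }
  assert (Htail : exists l, is_series (fun k => Rabs (a (k + n)%nat) * rho ^ (k + n)) l /\ l <= N).
  { clear Hs. induction n as [|n [l [Hl Hb]]].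
    - exists N. split; [|lra]. apply (is_series_eq _ _ _ _ HN); auto. intros k. now rewrite Nat.add_0_r.
    - exists (l - Rabs (a n) * rho ^ n). split.
      + apply (is_series_eq (fun k => Rabs (a (S k + n)%nat) * rho ^ (S k + n)) _
          (l - Rabs (a n) * rho ^ n)); auto.
        * apply (is_series_incr_1 (fun k => Rabs (a (k + n)%nat) * rho ^ (k + n))).
          apply (is_series_eq _ _ _ _ Hl); auto. simpl.
          assert (E : forall y z : R, y = y - z + z) by (intros; ring). apply E.
        * intros k. now replace (S k + n)%nat with (k + S n)%nat by lia.
      + specialize (Hpos n). lra. }
  destruct Htail as [l [Hl Hb]].
  destruct (is_series_dominated (fun k => PS_derive_n n a k * s ^ k) _ _
    (is_series_Rmult (INR (fact n) * (2 / rho) ^ n) _ _ Hl)) as [l' [Hl' Hb']].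
  { intros k. unfold PS_derive_n.
    assert (Hk := INR_fact_lt_0 k). assert (Hn := INR_fact_lt_0 n).
    assert (Hc : INR (fact (k + n)) / INR (fact k) <= INR (fact n) * 2 ^ (k + n)).
    { apply Rmult_le_reg_r with (INR (fact k)); auto. unfold Rdiv.
      rewrite Rmult_assoc, Rinv_l, Rmult_1_r by lra.
      assert (H := fact_plus_le k n). lra. }
    rewrite !Rabs_mult, <- RPow_abs.
    assert (Hq : 0 <= INR (fact (k + n)) / INR (fact k)).
    { apply Rle_mult_inv_pos; [left; apply INR_fact_lt_0|auto]. }
    rewrite (Rabs_pos_eq (_ / _)) by exact Hq.
    apply Rle_trans with (INR (fact n) * 2 ^ (k + n) * Rabs (a (k + n)%nat) * (rho / 2) ^ k).
    - apply Rmult_le_compat; [|apply pow_le, Rabs_pos| |].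
      + apply Rmult_le_pos; auto using Rabs_pos.
      + apply Rmult_le_compat_r; auto using Rabs_pos.
      + apply pow_incr. split; auto using Rabs_pos.
    - right. rewrite !pow_add. unfold Rdiv. rewrite !Rpow_mult_distr, !pow_inv.
      field. split; apply pow_nonzero; lra. }
  replace (PSeries (PS_derive_n n a) s) with l' by (symmetry; apply is_series_unique; exact Hl').
  eapply Rle_trans; [exact Hb'|].
  replace (N * INR (fact n) * (2 / rho) ^ n) with (INR (fact n) * (2 / rho) ^ n * N) by ring.
  apply Rmult_le_compat_l; auto. apply Rmult_le_pos; [left; apply INR_fact_lt_0|].
  apply pow_le. left. apply Rdiv_lt_0_compat; lra.
Qed.

(** Defined by derivatives, hence for every angle at once; near each angle it is given by the
    local expansion there ([local_action_coef]). *)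
Definition action_coef (f : R -> R -> R) (y : R) (m : nat) (x : R) : R :=
  Derive_n (fun z => f x (y + z)) m 0 / INR (fact m).

Section LocalExpansion.
Context (f : R -> R -> R) (y x rho M : R) (c : nat -> nat -> R).
Context (H : local_expansion f y x rho M c).

Lemma local_coef_radius m : Rbar_le rho (CV_radius (fun j => c j m)).
Proof.
  destruct H as (Hr & HN & _). destruct (HN m) as (N & HN1 & _).
  apply (CV_radius_ge _ _ N); auto. lra.
Qed.

Lemma local_M_ge0 : 0 <= M.
Proof.
  destruct H as (Hr & HN & _). destruct (HN 0%nat) as (N & HN1 & HN2).
  eapply Rle_trans; [|exact HN2]. apply Rmult_le_pos; [|simpl; lra].
  apply (is_series_ge0 _ _ HN1). intros j. apply Rmult_le_pos; [apply Rabs_pos|apply pow_le; lra].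
Qed.

Lemma local_action_coef m s : Rabs s <= rho -> action_coef f y m (x + s) = PSeries (fun j => c j m) s.
Proof.
  intros Hs. destruct H as (Hr & HN & Hf).
  set (b := fun m => PSeries (fun j => c j m) s).
  assert (Hcv : Rbar_lt 0 (CV_radius b)).
  { apply Rbar_lt_le_trans with (rho / 2); [simpl; lra|].
    apply (CV_radius_ge b (rho / 2) (Series (fun n => Rabs (b n) * (rho / 2) ^ n))); [lra|].
    apply Series_correct.
    destruct (is_series_nonneg_dominated (fun n => Rabs (b n) * (rho / 2) ^ n) _ _
      (is_series_Rmult M _ _ (is_series_geom (/ 2) ltac:(rewrite Rabs_pos_eq; lra)))) as [l [Hl _]].
    - intros n. split; [apply Rmult_le_pos; [apply Rabs_pos|apply pow_le; lra]|].
      destruct (HN n) as (N & HN1 & HN2).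
      assert (Hb : Rabs (b n) <= N).
      { destruct (is_series_dominated (fun j => c j n * s ^ j) _ _ HN1) as [l [Hl Hle]].
        - intros j. rewrite Rabs_mult, <- RPow_abs. apply Rmult_le_compat_l; [apply Rabs_pos|].
          apply pow_incr. split; auto. apply Rabs_pos.
        - unfold b. replace (PSeries _ s) with l; auto. symmetry. apply is_series_unique. exact Hl. }
      unfold Rdiv. rewrite Rpow_mult_distr, <- Rmult_assoc.
      apply Rmult_le_compat_r; [apply pow_le; lra|].
      eapply Rle_trans; [|exact HN2]. apply Rmult_le_compat_r; [apply pow_le; lra|auto].
    - now exists l. }
  unfold action_coef.
  rewrite (Derive_n_ext_loc _ (PSeries b)).
  - rewrite Derive_n_coef by exact Hcv. unfold b. field.
    apply Rgt_not_eq, INR_fact_lt_0.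
  - exists (mkposreal _ Hr). intros z Hz. simpl in Hz.
    assert (Hz' : Rabs z <= rho).
    { change (Rabs (z - 0) < rho) in Hz. rewrite Rminus_0_r in Hz. lra. }
    symmetry. apply is_series_unique. exact (Hf s z Hs Hz').
Qed.

Lemma local_action_coef_derive m n s : Rabs s < rho ->
  ex_derive (Derive_n (action_coef f y m) n) (x + s) /\
  Derive_n (action_coef f y m) n (x + s) = PSeries (PS_derive_n n (fun j => c j m)) s.
Proof.
  intros Hs. assert (Hr := proj1 H).
  set (a := fun j => c j m).
  assert (Hrad : forall u, Rabs u < rho -> Rbar_lt (Rabs u) (CV_radius a)).
  { intros u Hu. eapply Rbar_lt_le_trans; [|apply (local_coef_radius m)]. exact Hu. }
  assert (Hloc : forall u, Rabs u < rho ->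
    locally (x + u) (fun t => action_coef f y m t = PSeries a (t + - x))).
  { intros u Hu. assert (Hd : 0 < rho - Rabs u) by lra.
    exists (mkposreal _ Hd). intros t Ht. change (Rabs (t - (x + u)) < rho - Rabs u) in Ht.
    replace t with (x + (t + - x)) at 1 by ring. apply local_action_coef.
    replace (t + - x) with ((t - (x + u)) + u) by ring.
    eapply Rle_trans; [apply Rabs_triang|]. lra. }
  assert (HD : forall u, Rabs u < rho ->
    Derive_n (action_coef f y m) n (x + u) = PSeries (PS_derive_n n a) u).
  { intros u Hu. rewrite (Derive_n_ext_loc _ _ n _ (Hloc u Hu)), Derive_n_comp_trans.
    replace (x + u + - x) with u by ring. apply Derive_n_PSeries. now apply Hrad. }
  split; [|now apply HD].
  apply (ex_derive_ext_loc (fun t => Derive_n (PSeries a) n (t + - x))).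
  - assert (Hd : 0 < rho - Rabs s) by lra.
    exists (mkposreal _ Hd). intros t Ht. change (Rabs (t - (x + s)) < rho - Rabs s) in Ht.
    assert (Hu : Rabs (t + - x) < rho).
    { replace (t + - x) with ((t - (x + s)) + s) by ring.
      eapply Rle_lt_trans; [apply Rabs_triang|]. lra. }
    rewrite Derive_n_PSeries by now apply Hrad.
    rewrite <- HD by auto. f_equal. ring.
  - assert (Hn := is_derive_n_PSeries (S n) a s (Hrad s Hs)). simpl in Hn.
    eexists. apply (is_derive_translate (Derive_n (PSeries a) n)).
    replace (x + s + - x) with s by ring. exact Hn.
Qed.

Lemma local_action_coef_bound m n s : Rabs s <= rho / 2 ->
  Rabs (Derive_n (action_coef f y m) n (x + s)) <= M * (/ rho) ^ m * INR (fact n) * (2 / rho) ^ n.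
Proof.
  intros Hs. assert (Hr := proj1 H).
  rewrite (proj2 (local_action_coef_derive m n s ltac:(lra))).
  destruct H as (_ & HN & _). destruct (HN m) as (N & HN1 & HN2).
  eapply Rle_trans; [apply (PSeries_derive_n_bound _ rho N); auto|].
  assert (Hp : 0 < rho ^ m) by now apply pow_lt.
  apply Rmult_le_compat_r; [apply pow_le; left; apply Rdiv_lt_0_compat; lra|].
  apply Rmult_le_compat_r; [left; apply INR_fact_lt_0|].
  rewrite pow_inv. apply Rmult_le_reg_r with (rho ^ m); auto.
  rewrite Rmult_assoc, Rinv_l, Rmult_1_r by lra. exact HN2.
Qed.

End LocalExpansion.

Lemma periodic_induction (Q : R -> Prop) :
  (forall x, 0 <= x <= 2 * PI -> Q x) -> (forall x, Q x -> Q (x + 2 * PI)) ->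
  (forall x, Q x -> Q (x - 2 * PI)) -> forall x, Q x.
Proof.
  intros H0 Hp Hm x. assert (Hpi := PI_RGT_0).
  assert (Hn : forall n y, Q y -> Q (y + INR n * (2 * PI)) /\ Q (y - INR n * (2 * PI))).
  { induction n as [|n IH]; intros z Hz.
    - simpl. rewrite Rmult_0_l, Rplus_0_r, Rminus_0_r. auto.
    - rewrite S_INR. destruct (IH z Hz) as [H1 H2].
      replace (z + (INR n + 1) * (2 * PI)) with (z + INR n * (2 * PI) + 2 * PI) by ring.
      replace (z - (INR n + 1) * (2 * PI)) with (z - INR n * (2 * PI) - 2 * PI) by ring. auto. }
  destruct (base_Int_part (x / (2 * PI))) as [H1 H2].
  set (p := Int_part (x / (2 * PI))) in *.
  assert (Hx : x = x / (2 * PI) * (2 * PI)) by (field; lra).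
  assert (Hy : Q (x - IZR p * (2 * PI))) by (apply H0; split; nra).
  destruct (Z.le_gt_cases 0 p).
  - replace x with (x - IZR p * (2 * PI) + INR (Z.to_nat p) * (2 * PI)).
    + now apply Hn.
    + rewrite INR_IZR_INZ, Z2Nat.id by auto. ring.
  - replace x with (x - IZR p * (2 * PI) - INR (Z.to_nat (- p)) * (2 * PI)).
    + now apply Hn.
    + rewrite INR_IZR_INZ, Z2Nat.id, opp_IZR by lia. ring.
Qed.

(** Expansion in powers of the action, each coefficient being expanded in its Fourier series. *)
Lemma V_of_analytic f y rI :
  0 < rI -> (forall x, real_analytic2 f x y) ->
  (forall x z, Rabs z < rI -> f (x + 2 * PI) (y + z) = f x (y + z)) ->
  exists s0 sigma0 C, 0 < s0 < rI /\ 0 < sigma0 /\ V s0 sigma0 C (fun e x => f x (y + e)).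
Proof.
  intros HrI Han Hper. assert (Hpi := PI_RGT_0).
  assert (Hloc : forall x, exists q : R * R, exists c, local_expansion f y x (fst q) (snd q) c).
  { intros x. destruct (local_expansion_exists f y x (Han x)) as (rho & M & c & H).
    exists (rho, M), c. exact H. }
  apply functional_choice in Hloc. destruct Hloc as [q Hq].
  assert (Hdelta : forall x, 0 < Rmin (fst (q x) / 2) (/ (snd (q x) + 1))).
  { intros x. destruct (Hq x) as [c H]. assert (H1 := proj1 H). assert (H2 := local_M_ge0 _ _ _ _ _ _ H).
    apply Rmin_pos; [lra|]. apply Rinv_0_lt_compat. lra. }
  (* uniform constants over one period *)
  destruct (compactness_value_1d 0 (2 * PI) (fun x => mkposreal _ (Hdelta x))) as [[d Hd] Hcomp].
  assert (Hcover : forall x, 0 <= x <= 2 * PI -> exists t rho M c, local_expansion f y t rho M c /\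
    Rabs (x - t) <= rho / 2 /\ 2 * d <= rho /\ M <= / d).
  { intros x Hx. specialize (Hcomp x Hx). apply NNPP in Hcomp.
    destruct Hcomp as (t & _ & H1 & H2). simpl in H1, H2.
    destruct (Hq t) as [c H]. assert (H3 := proj1 H). assert (H4 := local_M_ge0 _ _ _ _ _ _ H).
    assert (H5 := Rmin_l (fst (q t) / 2) (/ (snd (q t) + 1))).
    assert (H6 := Rmin_r (fst (q t) / 2) (/ (snd (q t) + 1))).
    exists t, (fst (q t)), (snd (q t)), c. split; [exact H|]. split; [lra|]. split; [lra|].
    apply Rle_trans with (snd (q t) + 1); [lra|].
    rewrite <- (Rinv_inv (snd (q t) + 1)). apply Rinv_le_contravar; lra. }
  set (ph := fun m n => Derive_n (action_coef f y m) n).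
  assert (Hperc : forall m x, action_coef f y m (x + 2 * PI) = action_coef f y m x).
  { intros m x. unfold action_coef. f_equal. apply Derive_n_ext_loc.
    exists (mkposreal _ HrI). intros z Hz. change (Rabs (z - 0) < rI) in Hz.
    rewrite Rminus_0_r in Hz. now apply Hper. }
  assert (Hgrowth : forall m, analytic_growth (ph m) (/ d * (/ (2 * d)) ^ m) d).
  { intros m. split; [|split].
    - intros n x. destruct (Hq x) as [c H].
      apply (Derive_correct (Derive_n (action_coef f y m) n)).
      replace x with (x + 0) by ring.
      apply (local_action_coef_derive f y x _ _ c H m n 0). rewrite Rabs_R0. apply H.
    - intros n x. unfold ph. rewrite <- Derive_n_comp_trans. apply Derive_n_ext. auto.
    - intros n x Hx. destruct (Hcover x Hx) as (t & rho & M & c & H & H1 & H2 & H3).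
      unfold ph. replace x with (t + (x - t)) by ring.
      assert (HM := local_M_ge0 _ _ _ _ _ _ H).
      eapply Rle_trans; [apply (local_action_coef_bound f y t rho M c H); exact H1|].
      assert (Hir : 0 < / rho <= / (2 * d)).
      { split; [apply Rinv_0_lt_compat; lra|apply Rinv_le_contravar; lra]. }
      assert (Hir2 : 2 / rho <= / d).
      { replace (2 / rho) with (/ (rho / 2)) by (field; lra). apply Rinv_le_contravar; lra. }
      assert (Hir3 : 0 <= 2 / rho) by (left; apply Rdiv_lt_0_compat; lra).
      assert (Hf := INR_fact_lt_0 n).
      apply Rmult_le_compat; [|now apply pow_le| |now apply pow_incr].
      + apply Rmult_le_pos; [apply Rmult_le_pos; [lra|apply pow_le; lra]|lra].
      + apply Rmult_le_compat_r; [lra|].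
        apply Rmult_le_compat; [lra|apply pow_le; lra|lra|apply pow_incr; lra]. }
  set (s0 := Rmin d (rI / 2)).
  assert (Hs0 : 0 < s0) by (apply Rmin_pos; lra).
  assert (Hs0d : s0 <= d) by apply Rmin_l. assert (Hs0I : s0 <= rI / 2) by apply Rmin_r.
  assert (Hser : forall x e, Rabs e <= s0 ->
    is_series (fun m => ph m 0%nat x * e ^ m) (f x (y + e))).
  { intros x. apply (periodic_induction (fun x => forall e, Rabs e <= s0 ->
      is_series (fun m => ph m 0%nat x * e ^ m) (f x (y + e)))); clear x.
    - intros x Hx e He. destruct (Hcover x Hx) as (t & rho & M & c & H & H1 & H2 & H3).
      assert (Hr := proj1 H).
      assert (HS := proj2 (proj2 H) (x - t) e ltac:(lra) ltac:(lra)).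
      replace (t + (x - t)) with x in HS by ring.
      apply (is_series_eq _ _ _ _ HS); auto. intros m. f_equal. unfold ph. simpl.
      replace x with (t + (x - t)) at 2 by ring. symmetry.
      apply (local_action_coef f y t rho M c H). lra.
    - intros x Hx e He. rewrite Hper by lra.
      apply (is_series_eq _ _ _ _ (Hx e He)); auto. intros m. f_equal. symmetry. apply Hperc.
    - intros x Hx e He.
      replace (f (x - 2 * PI) (y + e)) with (f x (y + e)).
      + apply (is_series_eq _ _ _ _ (Hx e He)); auto. intros m. f_equal.
        unfold ph; simpl. rewrite <- (Hperc m (x - 2 * PI)). f_equal. ring.
      + rewrite <- (Hper (x - 2 * PI)) by lra. f_equal. ring. }
  set (K := 8 * / (1 - exp (- (d / 4)))).
  assert (HK : 0 < K).
  { unfold K. apply Rmult_lt_0_compat; [lra|]. apply Rinv_0_lt_compat.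
    assert (exp (- (d / 4)) < exp 0) by (apply exp_increasing; lra). rewrite exp_0 in H. lra. }
  exists s0, (d / 4), (K * / d * / (1 - / 2)). split; [lra|]. split; [lra|].
  assert (Hd2 : 0 < / d) by now apply Rinv_0_lt_compat.
  apply (V_sum s0 (d / 4) (fun m => K * / d * (/ 2) ^ m) (K * / d * / (1 - / 2)) _
    (fun m e x => ph m 0%nat x * e ^ m)).
  - intros m. eapply V_le.
    + eapply (V_mul _ _ _ _ (fun _ x => ph m 0%nat x) (fun e _ => e ^ m)).
      * apply (fourier_expansion (ph m) (/ d * (/ (2 * d)) ^ m) d Hd (Hgrowth m)). lra.
      * apply (W_pow 1 s0 (d / 4) s0 (fun _ e _ => e)). apply W_e; lra.
    + assert (E : (/ (2 * d)) ^ m * s0 ^ m <= (/ 2) ^ m).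
      { rewrite <- Rpow_mult_distr. apply pow_incr. rewrite Rinv_mult.
        assert (/ d * s0 <= 1).
        { apply Rmult_le_reg_l with d; auto. rewrite <- Rmult_assoc, Rinv_r by lra. lra. }
        assert (0 <= / d * s0) by (apply Rmult_le_pos; lra). lra. }
      fold K. replace (8 * (/ d * (/ (2 * d)) ^ m) * / (1 - exp (- (d / 4))) * s0 ^ m) with
        (K * / d * ((/ (2 * d)) ^ m * s0 ^ m)) by (unfold K; ring).
      apply Rmult_le_compat_l; [|exact E]. apply Rmult_le_pos; lra.
  - apply is_series_Rmult, is_series_geom. rewrite Rabs_pos_eq; lra.
  - lra.
  - intros e x He. now apply Hser.
Qed.

(** * Joint analyticity *)

Lemma is_series_sum_n (f : nat -> nat -> R) (F : nat -> R) m :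
  (forall j, is_series (f j) (F j)) ->
  is_series (fun i => sum_n (fun j => f j i) m) (sum_n F m).
Proof.
  intros Hf. induction m as [|m IH].
  - rewrite sum_O. apply (is_series_eq _ _ _ _ (Hf 0%nat)); auto. intros n. now rewrite sum_O.
  - rewrite sum_Sn. apply (is_series_eq _ _ _ _ (is_series_Rplus _ _ _ _ IH (Hf (S m)))); auto.
    intros n. now rewrite sum_Sn.
Qed.

Lemma sum_n_single (v : R) (n m : nat) :
  (n <= m)%nat -> sum_n (fun j => if Nat.eqb n j then v else 0) m = v.
Proof.
  intros Hn. assert (H := is_series_finite (fun j => if Nat.eqb n j then v else 0) m).
  assert (H1 := is_series_single (fun j => if Nat.eqb n j then v else 0) n).
  cbv beta in H1. rewrite Nat.eqb_refl in H1.
  apply (is_series_inj (fun j => if Nat.eqb n j then v else 0)).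
  - apply H. intros k Hk. destruct (Nat.eqb_spec n k); [lia|reflexivity].
  - apply H1. intros k Hk. destruct (Nat.eqb_spec n k); [congruence|reflexivity].
Qed.

Lemma sum_n_zero m : sum_n (fun _ => 0) m = 0.
Proof. rewrite sum_n_const. Req. ring. Qed.

(** The terms of a decomposition are not sorted and bidegrees repeat: a coefficient is the sum of
    all the terms of its bidegree. *)
Lemma double_series_regroup (b : nat -> R) (n l : nat -> nat) (r L : R) :
  0 <= r -> is_series (fun i => Rabs (b i) * (r ^ n i * r ^ l i)) L ->
  exists c : nat -> nat -> R, forall s t u, Rabs s <= r -> Rabs t <= r ->
    is_series (fun i => b i * (s ^ n i * t ^ l i)) u ->
    ex_series (fun m => sum_n (fun j => Rabs (c j (m - j)%nat * (s ^ j * t ^ (m - j)))) m) /\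
    is_series (fun m => sum_n (fun j => c j (m - j)%nat * (s ^ j * t ^ (m - j))) m) u.
Proof.
  intros Hr HL.
  set (sel := fun j k i => if andb (Nat.eqb (n i) j) (Nat.eqb (l i) k) then b i else 0).
  exists (fun j k => Series (sel j k)).
  intros s t u Hs Ht Hu.
  set (term := fun i => b i * (s ^ n i * t ^ l i)).
  set (dom := fun i => Rabs (b i) * (r ^ n i * r ^ l i)).
  assert (Hmon : forall i j, Rabs (s ^ i * t ^ j) <= r ^ i * r ^ j).
  { intros i j. rewrite Rabs_mult, <- !RPow_abs.
    apply Rmult_le_compat; try (apply pow_le, Rabs_pos); apply pow_incr; auto using Rabs_pos. }
  assert (Hmon0 : forall i j, 0 <= r ^ i * r ^ j)
    by (intros; apply Rmult_le_pos; now apply pow_le).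
  assert (Hdom : forall i, Rabs (term i) <= dom i).
  { intros i. unfold term, dom. rewrite Rabs_mult.
    apply Rmult_le_compat_l; [apply Rabs_pos|apply Hmon]. }
  assert (Hsel0 : forall j k i, sel j k i * (s ^ j * t ^ k) =
    if andb (Nat.eqb (n i) j) (Nat.eqb (l i) k) then term i else 0).
  { intros j k i. unfold sel, term.
    destruct (Nat.eqb_spec (n i) j) as [E|]; simpl; [|ring].
    destruct (Nat.eqb_spec (l i) k) as [E'|]; simpl; [|ring]. now rewrite E, E'. }
  assert (Hcoef : forall j k, is_series (fun i => sel j k i * (s ^ j * t ^ k))
    (Series (sel j k) * (s ^ j * t ^ k))).
  { intros j k. destruct (Req_dec (s ^ j * t ^ k) 0) as [E|Hne].
    - rewrite E, Rmult_0_r. apply (is_series_eq _ _ _ _ is_series_zero); auto.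
      intros i. ring.
    - assert (Hex : ex_series (sel j k)).
      { destruct (is_series_dominated (fun i => sel j k i * (s ^ j * t ^ k)) dom L HL) as [v [Hv _]].
        - intros i. rewrite Hsel0. destruct andb; auto. rewrite Rabs_R0.
          apply Rmult_le_pos; [apply Rabs_pos|apply Hmon0].
        - exists (/ (s ^ j * t ^ k) * v).
          apply (is_series_eq _ _ _ _ (is_series_Rmult (/ (s ^ j * t ^ k)) _ _ Hv)); auto.
          intros i. cbv beta. field. split; intros E; apply Hne; rewrite E; ring. }
      apply (is_series_eq _ _ _ _ (is_series_Rmult (s ^ j * t ^ k) _ _ (Series_correct _ Hex))).
      + intros i. ring.
      + ring. }
  set (grp := fun (x : nat -> R) i m => if Nat.eqb (n i + l i) m then x i else 0).
  assert (Hrow : forall x i, is_series (grp x i) (x i)).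
  { intros x i. assert (H := is_series_single (grp x i) (n i + l i)).
    unfold grp in H at 3. rewrite Nat.eqb_refl in H. apply H.
    intros k Hk. unfold grp. destruct (Nat.eqb_spec (n i + l i) k); [congruence|reflexivity]. }
  assert (Hsplit : forall x i m, grp x i m = sum_n (fun j =>
    if andb (Nat.eqb (n i) j) (Nat.eqb (l i) (m - j)) then x i else 0) m).
  { intros x i m. unfold grp.
    destruct (Nat.eqb_spec (n i + l i) m) as [E|E].
    - etransitivity; [symmetry; apply (sum_n_single (x i) (n i) m); lia|].
      apply sum_n_ext_loc. intros j Hj.
      destruct (Nat.eqb_spec (n i) j); simpl; auto.
      destruct (Nat.eqb_spec (l i) (m - j)); [reflexivity|lia].
    - etransitivity; [symmetry; apply (sum_n_zero m)|]. apply sum_n_ext_loc. intros j Hj.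
      destruct (Nat.eqb_spec (n i) j); simpl; auto.
      destruct (Nat.eqb_spec (l i) (m - j)); [lia|reflexivity]. }
  assert (Hgd : forall i m, Rabs (grp term i m) <= grp dom i m).
  { intros i m. unfold grp. destruct Nat.eqb; auto. rewrite Rabs_R0; lra. }
  assert (Hgdd : forall i m, Rabs (grp dom i m) <= grp dom i m).
  { intros i m. unfold grp. destruct Nat.eqb; [|rewrite Rabs_R0; lra].
    rewrite Rabs_pos_eq; [lra|]. eapply Rle_trans; [apply Rabs_pos|apply Hdom]. }
  destruct (is_series_swap (grp term) (grp dom) term dom u L Hgd (Hrow dom) HL (Hrow term) Hu)
    as [C [HC1 HC2]].
  destruct (is_series_swap (grp dom) (grp dom) dom dom L L Hgdd (Hrow dom) HL (Hrow dom) HL)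
    as [D [HD1 HD2]].
  split.
  - apply (ex_series_le (V := R_CompleteNormedModule) _ D); [|now exists L].
    intros m. change (norm ?v) with (Rabs v).
    rewrite Rabs_pos_eq.
    2: { rewrite <- (sum_n_zero m). apply sum_n_m_le. intros; apply Rabs_pos. }
    assert (Hdsel : forall j k, exists v, is_series (fun i =>
      if andb (Nat.eqb (n i) j) (Nat.eqb (l i) k) then dom i else 0) v).
    { intros j k. destruct (is_series_dominated (fun i =>
        if andb (Nat.eqb (n i) j) (Nat.eqb (l i) k) then dom i else 0) dom L HL) as [v [Hv _]].
      - intros i. assert (H0 : 0 <= dom i) by (eapply Rle_trans; [apply Rabs_pos|apply Hdom]).
        destruct andb; [rewrite Rabs_pos_eq; lra|rewrite Rabs_R0; lra].
      - now exists v. }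
    destruct (functional_choice _ (fun j => Hdsel j (m - j)%nat)) as [v Hv].
    apply Rle_trans with (sum_n v m).
    + apply sum_n_m_le. intros j.
      destruct (is_series_dominated (fun i => sel j (m - j)%nat i * (s ^ j * t ^ (m - j))) _ _ (Hv j))
        as [w [Hw1 Hw2]].
      * intros i. rewrite Hsel0. destruct andb; auto. rewrite Rabs_R0; lra.
      * now rewrite (is_series_inj _ _ _ (Hcoef j (m - j)%nat) Hw1).
    + right. apply (is_series_inj (fun i => grp dom i m)); [|apply HD1].
      apply (is_series_eq _ _ _ _ (is_series_sum_n _ v m Hv)); auto.
  - apply (is_series_eq _ _ _ _ HC2); auto. intros m.
    apply (is_series_inj _ _ _ (HC1 m)).
    apply (is_series_eq _ _ _ _ (is_series_sum_n (fun j i => sel j (m - j)%nat i * (s ^ j * t ^ (m - j)))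
      (fun j => Series (sel j (m - j)%nat) * (s ^ j * t ^ (m - j))) m (fun j => Hcoef j (m - j)%nat))); auto.
    intros i. rewrite Hsplit. apply sum_n_ext. intros j. apply Hsel0.
Qed.

(** Composition with the translations [e0 + e] and [x + t] stays in the algebra, so the
    expansion at another point needs no binomial identities. *)
Lemma V_analytic2 rho sigma M u e0 x0 :
  V rho sigma M u -> 0 < sigma -> Rabs e0 < rho -> analytic2_at (K := R_AbsRing) u e0 x0.
Proof.
  intros Hu Hsig He0.
  set (r := Rmin (rho - Rabs e0) sigma).
  assert (Hr : 0 < r) by (apply Rmin_pos; lra).
  assert (Hr1 : r <= rho - Rabs e0) by apply Rmin_l. assert (Hr2 : r <= sigma) by apply Rmin_r.
  assert (HW : W r r 0 (2 * M) (fun t e x => u (e0 + e) (x + t))).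
  { apply (W_comp r r 0 rho sigma M u r (Rabs e0 + r) (fun t _ _ => t) (fun _ e _ => e0 + e)); try lra.
    - exact Hu.
    - apply W_t; lra.
    - apply (W_add _ _ _ _ _ (fun _ _ _ => e0)); [apply W_const; lra|apply W_e; lra]. }
  destruct HW as (_ & _ & _ & s & L & HL & _ & Hs).
  set (b := fun i => amp (s i) * cos (INR (freq (s i)) * x0 + phase (s i))).
  assert (HLr : 0 <= r) by lra.
  destruct (is_series_nonneg_dominated (fun i => Rabs (b i) * (r ^ edeg (s i) * r ^ tdeg (s i))) _ _ HL)
    as [L' [HL' _]].
  { intros i. assert (H1 := pow_le r (edeg (s i)) HLr). assert (H2 := pow_le r (tdeg (s i)) HLr).
    split; [apply Rmult_le_pos; [apply Rabs_pos|now apply Rmult_le_pos]|].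
    unfold wt, b. rewrite Rmult_0_l, exp_0, Rmult_1_r, Rabs_mult.
    rewrite (Rmult_comm (r ^ tdeg (s i))).
    apply Rmult_le_compat_r; [now apply Rmult_le_pos|].
    rewrite <- (Rmult_1_r (Rabs (amp (s i)))) at 2.
    apply Rmult_le_compat_l; [apply Rabs_pos|]. apply Rabs_le, COS_bound. }
  destruct (double_series_regroup b (fun i => edeg (s i)) (fun i => tdeg (s i)) r L' HLr HL') as [c Hc].
  exists c, r. split; [exact Hr|].
  intros e x He Hx.
  change (Rabs (e - e0) < r) in He. change (Rabs (x - x0) < r) in Hx.
  assert (Hser := Hs (x - x0) (e - e0) x0 ltac:(lra) ltac:(lra)).
  assert (Ed : forall y z : R, z + (y - z) = y) by (intros; ring).
  rewrite (Ed e e0), (Ed x x0) in Hser.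
  destruct (Hc (e - e0) (x - x0) (u e x) ltac:(lra) ltac:(lra)) as [H1 H2].
  { apply (is_series_eq _ _ _ _ Hser); auto. intros i. unfold ev, b. ring. }
  split.
  - eapply ex_series_ext; [|exact H1]. intros m. apply sum_n_ext. intros j. cbv beta.
    reflexivity.
  - eapply is_series_ext; [|exact H2]. intros m. apply sum_n_ext. intros j. cbv beta.
    reflexivity.
Qed.

(** * Real traces of complex analytic functions *)

Lemma is_series_Re (u : nat -> C) (l : C) :
  is_series (V := AbsRing_NormedModule C_AbsRing) u l ->
  is_series (fun n => Re (u n)) (Re l).
Proof.
  intros H. apply is_series_Reals. intros eps Heps.
  assert (HP : locally (l : AbsRing_NormedModule C_AbsRing) (fun z => Cmod (Cminus z l) < eps)).
  { exists (mkposreal _ Heps). intros z Hz. exact Hz. }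
  destruct (H _ HP) as [N HN]. exists N. intros n Hn. specialize (HN n Hn).
  rewrite <- sum_n_Reals.
  assert (E : sum_n (fun k => Re (u k)) n =
    Re (sum_n (G := AbsRing_NormedModule C_AbsRing) u n)).
  { clear. induction n as [|n IH]; [now rewrite !sum_O|]. rewrite !sum_Sn, IH. reflexivity. }
  rewrite E. unfold R_dist.
  eapply Rle_lt_trans; [|exact HN].
  replace (Re (sum_n (G := AbsRing_NormedModule C_AbsRing) u n) - Re l) with
    (Re (Cminus (sum_n (G := AbsRing_NormedModule C_AbsRing) u n) l)) by reflexivity.
  apply re_le_Cmod.
Qed.

Lemma pow_n_RtoC (x : R) n : pow_n (K := C_AbsRing) (RtoC x) n = RtoC (x ^ n).
Proof.
  induction n as [|n IH]; [reflexivity|]. simpl. rewrite IH.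
  symmetry. apply RtoC_mult.
Qed.

Lemma minus_RtoC (x y : R) : minus (G := C_AbsRing) (RtoC x) (RtoC y) = RtoC (x - y).
Proof. symmetry. apply RtoC_minus. Qed.

Lemma Re_mult_RtoC (c : C) (x : R) : Re (Cmult c (RtoC x)) = Re c * x.
Proof. destruct c as [c1 c2]. unfold Re, Cmult, RtoC; simpl. ring. Qed.

Lemma real_analytic2_of_complex (fc : C -> C -> C) (f : R -> R -> R) x y rI :
  0 < rI -> analytic2_at (K := C_AbsRing) fc (RtoC x) (RtoC y) ->
  (forall s z, Rabs z < rI -> fc (RtoC (x + s)) (RtoC (y + z)) = RtoC (f (x + s) (y + z))) ->
  real_analytic2 f x y.
Proof.
  intros HrI (c & r & Hr & H) Hf.
  exists (fun j k => Re (c j k)), (Rmin r rI). split; [now apply Rmin_pos|].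
  intros s z Hs Hz.
  assert (H1 := Rmin_l r rI). assert (H2 := Rmin_r r rI).
  assert (Es : minus (G := C_AbsRing) (RtoC (x + s)) (RtoC x) = RtoC s).
  { rewrite minus_RtoC. f_equal. ring. }
  assert (Ez : minus (G := C_AbsRing) (RtoC (y + z)) (RtoC y) = RtoC z).
  { rewrite minus_RtoC. f_equal. ring. }
  destruct (H (RtoC (x + s)) (RtoC (y + z))) as [D1 D2].
  { rewrite Es. change (Cmod (RtoC s) < r). rewrite Cmod_R. lra. }
  { rewrite Ez. change (Cmod (RtoC z) < r). rewrite Cmod_R. lra. }
  rewrite Es, Ez in D1, D2. rewrite Hf in D2 by lra.
  assert (Eu : forall j k, mult (K := C_AbsRing) (c j k)
    (mult (pow_n (RtoC s) j) (pow_n (RtoC z) k)) = Cmult (c j k) (RtoC (s ^ j * z ^ k))).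
  { intros j k. rewrite !pow_n_RtoC. change (Cmult (c j k) (Cmult (RtoC (s ^ j)) (RtoC (z ^ k))) =
      Cmult (c j k) (RtoC (s ^ j * z ^ k))). now rewrite RtoC_mult. }
  split.
  - apply (ex_series_le (V := R_CompleteNormedModule) _ _) with (2 := D1).
    intros n. change (norm ?v) with (Rabs v).
    rewrite Rabs_pos_eq.
    2: { rewrite <- (sum_n_zero n). apply sum_n_m_le. intros; apply Rabs_pos. }
    apply sum_n_m_le. intros j. rewrite Eu.
    change (Rabs (Re (c j (n - j)%nat) * (s ^ j * z ^ (n - j))) <=
      Cmod (Cmult (c j (n - j)%nat) (RtoC (s ^ j * z ^ (n - j))))).
    rewrite <- Re_mult_RtoC. apply re_le_Cmod.
  - apply (is_series_eq _ _ _ _ (is_series_Re _ _ D2)); [|reflexivity].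
    intros n.
    assert (E : forall u : nat -> C, Re (sum_n (G := C_AbsRing) u n) = sum_n (fun j => Re (u j)) n).
    { clear. intros u. induction n as [|n IH]; [now rewrite !sum_O|]. rewrite !sum_Sn, <- IH. reflexivity. }
    etransitivity; [apply E|]. apply sum_n_ext. intros j. rewrite Eu. apply Re_mult_RtoC.
Qed.

Lemma V_of_complex_analytic (ac : C -> C) (a : R -> R) y rI sigma :
  0 < rI -> 0 <= sigma -> analytic_at (K := C_AbsRing) ac (RtoC y) ->
  (forall z, Rabs z < rI -> ac (RtoC (y + z)) = RtoC (a (y + z))) ->
  exists s0 C, 0 < s0 /\ V s0 sigma C (fun e _ => a (y + e)).
Proof.
  intros HrI Hsig (c & r & Hr & H) Ha.
  set (b := fun n => Re (c n)).
  set (q := Rmin r rI / 2).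
  assert (Hq : 0 < q /\ q < r /\ q < rI).
  { unfold q. assert (0 < Rmin r rI) by now apply Rmin_pos.
    assert (H1 := Rmin_l r rI). assert (H2 := Rmin_r r rI). lra. }
  assert (Hser : forall z, Rabs z <= q -> is_series (fun n => b n * z ^ n) (a (y + z))).
  { intros z Hz.
    assert (Ez : minus (G := C_AbsRing) (RtoC (y + z)) (RtoC y) = RtoC z).
    { rewrite minus_RtoC. f_equal. ring. }
    assert (D := H (RtoC (y + z))). rewrite Ez in D.
    assert (Hlt : Cmod (RtoC z) < r) by (rewrite Cmod_R; lra).
    specialize (D Hlt). rewrite Ha in D by lra.
    apply (is_series_eq _ _ _ _ (is_series_Re _ _ D)); [|reflexivity]. intros n.
    rewrite pow_n_RtoC.
    change (Re (Cmult (RtoC (z ^ n)) (c n)) = b n * z ^ n).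
    rewrite Cmult_comm. apply Re_mult_RtoC. }
  (* convergence at [q] gives absolute convergence at [q / 2] *)
  assert (Hq0 := Hser q ltac:(rewrite Rabs_pos_eq; lra)).
  assert (Hcv : Rbar_lt (Rabs (q / 2)) (CV_radius b)).
  { apply Rbar_lt_le_trans with q; [simpl; rewrite Rabs_pos_eq; lra|].
    apply Rbar_not_lt_le. intros Hlt. rewrite <- (Rabs_pos_eq q) in Hlt by lra.
    apply (CV_disk_outside b q Hlt). apply ex_series_lim_0. eexists; exact Hq0. }
  destruct (CV_disk_inside b (q / 2) Hcv) as [C HC].
  exists (q / 2), C. split; [lra|].
  apply (V_sum (q / 2) sigma (fun n => Rabs (b n * (q / 2) ^ n)) C C (fun n e _ => b n * e ^ n)).
  - intros n. rewrite Rabs_mult, <- RPow_abs, (Rabs_pos_eq (q / 2)) by lra.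
    apply (V_scal _ _ _ (b n) (fun e _ => e ^ n)).
    apply (W_pow 1 (q / 2) sigma (q / 2) (fun _ e _ => e)). apply W_e; lra.
  - exact HC.
  - lra.
  - intros e _ He. apply Hser. lra.
Qed.

Lemma V_at_angle rho sigma M u x0 :
  V rho sigma M u -> V rho sigma M (fun e _ => u e x0).
Proof.
  intros (Ht & Hr & Hs & s & l & Hl & HlM & Hu).
  destruct (atoms_map 1 rho sigma 1 rho sigma 1
    (fun a => Atom (amp a * cos (INR (freq a) * x0 + phase a)) (tdeg a) (edeg a) 0 0) s l)
    as [v [Hv1 Hv2]]; auto.
  - intros i. unfold wt; simpl. rewrite Rmult_0_r, exp_0, Rmult_1_l, Rmult_1_r, Rabs_mult, !pow1, !Rmult_1_l.
    set (a := s i).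
    assert (H1 : Rabs (cos (INR (freq a) * x0 + phase a)) <= 1) by (apply Rabs_le, COS_bound).
    assert (H2 : 1 <= exp (sigma * INR (freq a))) by (apply exp_ge1, Rmult_le_pos; auto using pos_INR).
    assert (H3 := pow_le rho (edeg a) Hr). assert (H4 := Rabs_pos (amp a)).
    apply Rle_trans with (Rabs (amp a) * 1 * rho ^ edeg a).
    + apply Rmult_le_compat_r; auto. apply Rmult_le_compat_l; auto.
    + rewrite Rmult_1_r. apply Rmult_le_compat_l; auto.
      rewrite <- (Rmult_1_r (rho ^ edeg a)) at 1. apply Rmult_le_compat_l; auto.
  - apply (W_ext _ _ _ _ v).
    + apply (W_le _ _ _ _ _ _ Hv1). lra.
    + intros t e x H1 H2. apply (is_series_inj _ _ _ (Hv2 t e x H1 H2)).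
      apply (is_series_eq _ _ _ _ (Hu t e x0 H1 H2)); auto.
      intros i. unfold ev; simpl. rewrite Rmult_0_l, Rplus_0_r, cos_0. ring.
Qed.

(** A function of the action alone may be differentiated along the angle [0]. *)
Lemma C1_data_action s0 sigma0 C a Fe Fx :
  C1_data s0 sigma0 C (fun e _ => a e) Fe Fx ->
  C1_data s0 sigma0 C (fun e _ => a e) (fun e _ => Fe e 0) (fun _ _ => 0).
Proof.
  intros (H1 & H2 & H3 & H4).
  destruct (V_pos _ _ _ _ H1) as (Hs & Hsig & HC).
  split; [exact H1|]. split; [now apply V_at_angle|]. split.
  - apply (V_le _ _ (Rabs 0)); [now apply V_const|rewrite Rabs_R0; lra].
  - intros X Y t X' Y' HX HY Hlt.
    assert (D := H4 (fun _ => 0) Y t 0 Y' (is_derive_Rconst 0 t) HY Hlt). cbv beta in D.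
    rewrite Rmult_0_r in D. now rewrite Rmult_0_l.
Qed.

(** * The flux *)

Lemma RInt_translate f c :
  cont f -> (forall x, f (x + 2 * PI) = f x) ->
  RInt (fun x => f (x + c)) 0 (2 * PI) = RInt f 0 (2 * PI).
Proof.
  intros Hf Hper. rewrite <- (RInt_periodic f c Hf Hper).
  assert (E := RInt_comp_lin f 1 c 0 (2 * PI) (cont_RInt _ _ _ Hf)).
  rewrite Rmult_0_r, Rmult_1_l, Rplus_0_l, (Rplus_comm (2 * PI)) in E. rewrite <- E.
  apply RInt_ext. intros x _. unfold scal; simpl; unfold mult; simpl. now rewrite !Rmult_1_l.
Qed.

(** By periodicity the integral of the action over the rotated copy is the one over the curve,
    and the translation contributes [- lam] times the length [2 * PI] of the circle. *)
Lemma zero_flux_counterterm (I : R -> Prop) (T : R * R -> R * R) (h v dh dv : R -> R) om lam :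
  zero_flux I T ->
  (forall t, is_derive h t (dh t)) -> (forall t, is_derive v t (dv t)) -> cont dh -> cont dv ->
  (forall t, h (t + 2 * PI) = h t) -> (forall t, v (t + 2 * PI) = v t) ->
  (forall t, dh (t + 2 * PI) = dh t) -> (forall t, I (v t)) ->
  (forall t, T (t + h t, v t) = (t + om + h (t + om), v (t + om) - lam)) ->
  lam = 0.
Proof.
  intros Hflux Hh Hv Cdh Cdv Ph Pv Pdh HI HT.
  set (u := fun t => t + h t).
  assert (Hu : forall t, is_derive u t (1 + dh t)).
  { intros t. apply is_derive_Rplus; [apply is_derive_Rid|apply Hh]. }
  assert (Cu : cont (fun t => 1 + dh t)) by (apply cont_plus; [apply cont_const|auto]).
  assert (Cv : cont v) by now apply (cont_derive v dv).
  assert (HC1 : forall p dp, (forall t, is_derive p t (dp t)) -> cont dp -> C1 p).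
  { intros p dp Hp Cp t. split; [exists (dp t); apply Hp|].
    apply (continuous_ext dp); [|apply Cp]. intros y. symmetry. apply is_derive_unique, Hp. }
  assert (F := Hflux u v (HC1 u _ Hu Cu) (HC1 v dv Hv Cdv)).
  assert (Pu : forall t, u (t + 2 * PI) = u t + 2 * PI) by (intros t; unfold u; rewrite Ph; ring).
  specialize (F Pu Pv HI).
  set (G := fun t => v t * (1 + dh t)).
  assert (CG : cont G) by now apply cont_mult.
  assert (E : forall t, snd (T (u t, v t)) * Derive (fun s => fst (T (u s, v s))) t - v t * Derive u t =
    G (t + om) - G t - lam * (1 + dh (t + om))).
  { intros t. rewrite (is_derive_unique _ _ _ (Hu t)).
    assert (D : Derive (fun s => fst (T (u s, v s))) t = 1 + dh (t + om)).
    { apply is_derive_unique. apply (is_derive_ext (fun s => u (s + om))).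
      - intros s. unfold u. rewrite HT. reflexivity.
      - apply is_derive_translate, Hu. }
    rewrite D. unfold u at 1. rewrite HT. simpl. unfold G. ring. }
  rewrite (RInt_ext _ _ _ _ (fun t _ => E t)) in F.
  assert (CGo : cont (fun t => G (t + om))) by now apply cont_translate.
  assert (Cuo : cont (fun t => 1 + dh (t + om))) by now apply (cont_translate (fun t => 1 + dh t)).
  rewrite RInt_cont_minus in F;
    [|now apply cont_minus|apply cont_mult; [apply cont_const|exact Cuo]].
  rewrite RInt_cont_minus, RInt_cont_scal in F; auto.
  rewrite RInt_translate in F; auto.
  2: { intros t. unfold G. now rewrite Pv, Pdh. }
  rewrite (RInt_of_derive (fun t => u (t + om)) (fun t => 1 + dh (t + om))) in F; [| |exact Cuo].
  2: { intros t. apply is_derive_translate, Hu. }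
  replace (2 * PI + om) with (om + 2 * PI) in F by ring. rewrite Pu, Rplus_0_l in F.
  assert (Hpi := PI_RGT_0).
  assert (F' : lam * (2 * PI) = 0) by lra.
  apply Rmult_integral in F'. destruct F' as [F'|F']; [exact F'|lra].
Qed.

(** * The theorem *)

Lemma open_interval_open alpha beta y :
  open_interval alpha beta y ->
  exists r, 0 < r /\ forall z, Rabs z < r -> open_interval alpha beta (y + z).
Proof.
  intros [H1 H2].
  assert (Hl : exists r, 0 < r /\ forall z, - r < z -> Rbar_lt alpha (y + z)).
  { destruct alpha as [al| |]; simpl in *.
    - exists (y - al). split; [lra|]. intros; lra.
    - contradiction.
    - exists 1. split; [lra|auto]. }
  assert (Hu : exists r, 0 < r /\ forall z, z < r -> Rbar_lt (y + z) beta).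
  { destruct beta as [be| |]; simpl in *.
    - exists (be - y). split; [lra|]. intros; lra.
    - exists 1. split; [lra|auto].
    - contradiction. }
  destruct Hl as [r1 [Hr1 Hl]]. destruct Hu as [r2 [Hr2 Hu]].
  exists (Rmin r1 r2). split; [now apply Rmin_pos|].
  intros z Hz. apply Rabs_def2 in Hz.
  assert (H3 := Rmin_l r1 r2). assert (H4 := Rmin_r r1 r2).
  split; [apply Hl|apply Hu]; lra.
Qed.

Lemma area_preserving_det (I : R -> Prop) (a : R -> R) (f g : R -> R -> R) y0 s0 sigma0 C
    (ae : R -> R) (fe fx ge gx : R -> R -> R) eps :
  area_preserving I (twist_map a f g eps) ->
  (forall e, Rabs e < s0 -> I (y0 + e)) ->
  C1_data s0 sigma0 C (fun e _ => a (y0 + e)) (fun e _ => ae e) (fun _ _ => 0) ->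
  C1_data s0 sigma0 C (fun e x => f x (y0 + e)) fe fx ->
  C1_data s0 sigma0 C (fun e x => g x (y0 + e)) ge gx ->
  forall e x, Rabs e < s0 ->
  (1 + eps * fx e x) * (1 + eps * ge e x) - (ae e + eps * fe e x) * (eps * gx e x) = 1.
Proof.
  intros Harea HI (_ & _ & _ & Cha) (_ & _ & _ & Chf) (_ & _ & _ & Chg) e x He.
  assert (E := Harea x (y0 + e) (HI e He)). unfold twist_map in E; simpl in E.
  assert (Dx : forall (F Fe Fx : R -> R -> R), chain_rule s0 (fun e x => F x (y0 + e)) Fe Fx ->
    is_derive (fun t => F t (y0 + e)) x (Fx e x)).
  { intros F Fe Fx Ch.
    assert (D := Ch (fun t => t) (fun _ => e) x 1 0 (is_derive_Rid x) (is_derive_Rconst e x) He).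
    cbv beta in D. rewrite Rmult_0_r, Rmult_1_r, Rplus_0_l in D. exact D. }
  assert (Dy : forall (F Fe Fx : R -> R -> R), chain_rule s0 (fun e x => F x (y0 + e)) Fe Fx ->
    is_derive (fun t => F x t) (y0 + e) (Fe e x)).
  { intros F Fe Fx Ch.
    assert (HY : is_derive (fun t => t - y0) (y0 + e) 1) by (auto_derive; auto).
    assert (Ee : y0 + e - y0 = e) by ring.
    assert (D := Ch (fun _ => x) (fun t => t - y0) (y0 + e) 0 1 (is_derive_Rconst x _) HY).
    cbv beta in D. rewrite Ee, Rmult_0_r, Rmult_1_r, Rplus_0_r in D.
    apply (is_derive_ext (fun t => F x (y0 + (t - y0)))); [|now apply D].
    intros t. cbv beta. now rewrite Rplus_minus. }
  assert (D1 : Derive (fun t => t + a (y0 + e) + eps * f t (y0 + e)) x = 1 + eps * fx e x).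
  { apply is_derive_unique.
    apply is_derive_Rplus; [|apply is_derive_Rscal; now apply (Dx f fe)].
    replace 1 with (1 + 0) by ring. apply is_derive_Rplus; [apply is_derive_Rid|apply is_derive_Rconst]. }
  assert (D2 : Derive (fun t => t + eps * g x t) (y0 + e) = 1 + eps * ge e x).
  { apply is_derive_unique.
    apply is_derive_Rplus; [apply is_derive_Rid|apply is_derive_Rscal; now apply (Dy g ge gx)]. }
  assert (D3 : Derive (fun t => x + a t + eps * f x t) (y0 + e) = ae e + eps * fe e x).
  { apply is_derive_unique.
    apply is_derive_Rplus; [|apply is_derive_Rscal; now apply (Dy f fe fx)].
    replace (ae e) with (0 + ae e) by ring. apply is_derive_Rplus; [apply is_derive_Rconst|].
    apply (Dy (fun _ => a) (fun e _ => ae e) (fun _ _ => 0)). exact Cha. }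
  assert (D4 : Derive (fun t => y0 + e + eps * g t (y0 + e)) x = eps * gx e x).
  { apply is_derive_unique. replace (eps * gx e x) with (0 + eps * gx e x) by ring.
    apply is_derive_Rplus; [apply is_derive_Rconst|apply is_derive_Rscal; now apply (Dx g ge)]. }
  rewrite D1, D2, D3, D4 in E. exact E.
Qed.

Lemma C1_data_common s1 sigma1 C1 F1 Fe1 Fx1 s2 sigma2 C2 F2 Fe2 Fx2 s3 sigma3 C3 F3 Fe3 Fx3 rI :
  C1_data s1 sigma1 C1 F1 Fe1 Fx1 -> C1_data s2 sigma2 C2 F2 Fe2 Fx2 ->
  C1_data s3 sigma3 C3 F3 Fe3 Fx3 ->
  0 < s1 -> 0 < s2 -> 0 < s3 -> 0 < sigma1 -> 0 < sigma2 -> 0 < sigma3 -> 0 < rI ->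
  exists s sigma C, 0 < s <= rI /\ 0 < sigma /\ 1 <= C /\
    C1_data s sigma C F1 Fe1 Fx1 /\ C1_data s sigma C F2 Fe2 Fx2 /\ C1_data s sigma C F3 Fe3 Fx3.
Proof.
  intros H1 H2 H3 P1 P2 P3 Q1 Q2 Q3 HrI.
  destruct (exists_below (s1 :: s2 :: s3 :: rI :: nil)) as (s & Hs & Hs1 & Hs2 & Hs3 & Hs4 & _);
    [repeat constructor; auto|].
  destruct (exists_below (sigma1 :: sigma2 :: sigma3 :: nil)) as (sg & Hg & Hg1 & Hg2 & Hg3 & _);
    [repeat constructor; auto|].
  assert (B1 := proj2 (proj2 (V_pos _ _ _ _ (proj1 H1)))).
  assert (B2 := proj2 (proj2 (V_pos _ _ _ _ (proj1 H2)))).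
  assert (B3 := proj2 (proj2 (V_pos _ _ _ _ (proj1 H3)))).
  exists s, sg, (1 + C1 + C2 + C3).
  split; [lra|]. split; [lra|]. split; [lra|].
  split; [|split]; (eapply C1_data_weaken; [eassumption|lra|lra|lra]).
Qed.

Theorem theorem1p1
    (a : R -> R) (f g : R -> R -> R)
    (alpha beta : Rbar) (xi0 : R) (A : C -> Prop)
    (hxi0 : 0 < xi0)
    (hA : complex_neighbourhood A (open_interval alpha beta))
    (ha : extends_analytically A (open_interval alpha beta) a)
    (hf : extends_analytically2 xi0 A (open_interval alpha beta) f)
    (hg : extends_analytically2 xi0 A (open_interval alpha beta) g)
    (hfper : forall x y, open_interval alpha beta y -> f (x + 2 * PI) y = f x y)
    (hgper : forall x y, open_interval alpha beta y -> g (x + 2 * PI) y = g x y)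
    (htwist : forall y, open_interval alpha beta y -> 0 < Derive a y)
    (hsympl : exists eps1 : R, 0 < eps1 /\
       forall eps : R, Rabs eps < eps1 ->
         exact_symplectic (open_interval alpha beta) (twist_map a f g eps))
    (w y0 : R)
    (hy0 : open_interval alpha beta y0)
    (hw : 2 * PI * w = a y0)
    (hbryuno : bryuno w) :
  exists eps0 : R, 0 < eps0 /\
    exists h H : R -> R -> R,
      (forall eps : R, Rabs eps < eps0 ->
         invariant_curve (open_interval alpha beta) (twist_map a f g eps) y0 w
           (h eps) (H eps)) /\
      (forall eps psi : R, Rabs eps < eps0 ->
         analytic2_at (K := R_AbsRing) h eps psi /\
         analytic2_at (K := R_AbsRing) H eps psi).
Proof.
  destruct hsympl as (eps1 & Heps1 & Hsympl).
  destruct (open_interval_open _ _ _ hy0) as (rI & HrI & HI).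
  assert (HAy : A (RtoC y0)) by (apply locally_singleton, hA, hy0).
  assert (HV : forall F : R -> R -> R, extends_analytically2 xi0 A (open_interval alpha beta) F ->
    (forall x y, open_interval alpha beta y -> F (x + 2 * PI) y = F x y) ->
    exists s sigma C Fe Fx, 0 < s /\ 0 < sigma /\
      C1_data s sigma C (fun e x => F x (y0 + e)) Fe Fx).
  { intros F (Fc & HFan & _ & HFr) Hper.
    destruct (V_of_analytic F y0 rI HrI) as (s & sigma & C & Hs & Hsigma & HV).
    - intros x. apply (real_analytic2_of_complex Fc F x y0 rI HrI).
      + apply HFan; auto. unfold strip. simpl. rewrite Rabs_R0. lra.
      + intros u z Hz. apply HFr. now apply HI.
    - intros x z Hz. apply Hper. now apply HI.
    - destruct (V_C1_data s sigma C _ HV) as (s1 & sigma1 & C1 & Fe & Fx & H1 & H2 & H3);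
        [lra|lra|].
      exists s1, sigma1, C1, Fe, Fx. repeat (split; [lra|]). exact H3. }
  assert (HVa : exists s sigma C ae, 0 < s /\ 0 < sigma /\
      C1_data s sigma C (fun e _ => a (y0 + e)) (fun e _ => ae e) (fun _ _ => 0)).
  { destruct ha as (ac & Hac & Har).
    destruct (V_of_complex_analytic ac a y0 rI 1 HrI) as (s & C & Hs & HV1); [lra|now apply Hac| |].
    - intros z Hz. apply Har. now apply HI.
    - destruct (V_C1_data s 1 C _ HV1) as (s1 & sigma1 & C1 & Fe & Fx & H1 & H2 & H3);
        [lra|lra|].
      exists s1, sigma1, C1, (fun e => Fe e 0). split; [lra|]. split; [lra|].
      apply (C1_data_action _ _ _ (fun e => a (y0 + e)) Fe Fx H3). }
  destruct (HV f hf hfper) as (sf & sigf & Cf & fe & fx & Hsf & Hsigf & Df').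
  destruct (HV g hg hgper) as (sg & sigg & Cg & ge & gx & Hsg & Hsigg & Dg').
  destruct HVa as (sa & siga & Ca & ae & Hsa & Hsiga & Da').
  destruct (C1_data_common _ _ _ _ _ _ _ _ _ _ _ _ _ _ _ _ _ _ rI Da' Df' Dg')
    as (s0 & sigma0 & C & Hs0 & Hsigma0 & HC & Da & Df & Dg); auto.
  clear Da' Df' Dg'.
  assert (HIs : forall e, Rabs e < s0 -> open_interval alpha beta (y0 + e)).
  { intros e He. apply HI. lra. }
  assert (Hae : ae 0 = Derive a y0).
  { symmetry. apply is_derive_unique.
    apply (is_derive_ext (fun t => a (y0 + (t - y0)))).
    - intros t. cbv beta. now rewrite Rplus_minus.
    - destruct Da as (_ & _ & _ & Ch).
      assert (HY : is_derive (fun t => t - y0) y0 1) by (auto_derive; auto).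
      assert (D := Ch (fun _ => 0) (fun t => t - y0) y0 0 1 (is_derive_Rconst 0 _) HY).
      cbv beta in D. rewrite Rminus_diag, Rmult_0_r, Rmult_1_r, Rplus_0_r in D.
      apply D. rewrite Rabs_R0. lra. }
  destruct (translated_curve w s0 sigma0 C (fun e => a (y0 + e)) ae
    (fun e x => f x (y0 + e)) fe fx (fun e x => g x (y0 + e)) ge gx)
    with (eps1 := eps1) as (rho & sigma & k & h & H & lam & Hrho & Hsigma & Hk & Vh & VH & Hinv); auto.
  { lra. }
  { rewrite Hae. now apply htwist. }
  { now rewrite Rplus_0_r. }
  { intros eps e x Heps He.
    apply (area_preserving_det (open_interval alpha beta) a f g y0 s0 sigma0 C ae fe fx ge gx eps);
      auto. now apply Hsympl. }
  assert (HIH : forall eps x, Rabs eps <= rho -> open_interval alpha beta (y0 + H eps x)).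
  { intros eps x Heps. apply HIs. apply Rle_lt_trans with k; [|lra].
    now apply (V_bound rho sigma). }
  exists rho. split; [lra|]. exists h, H. split.
  - intros eps Heps.
    assert (Heps' : Rabs eps <= rho) by lra.
    assert (Ph : forall x, h eps (x + 2 * PI) = h eps x)
      by (intros; now apply (V_periodic rho sigma k)).
    assert (PH : forall x, H eps (x + 2 * PI) = H eps x)
      by (intros; now apply (V_periodic rho sigma k)).
    assert (Hmap : forall x, twist_map a f g eps (x + h eps x, y0 + H eps x) =
      (x + 2 * PI * w + h eps (x + 2 * PI * w), y0 + H eps (x + 2 * PI * w) - lam eps)).
    { intros x. destruct (Hinv eps x Heps') as [E1 E2]. unfold error1 in E1. unfold error2 in E2.
      unfold twist_map; simpl. f_equal; lra. }
    assert (Hlam : lam eps = 0).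
    { destruct (V_derive _ _ _ _ (sigma / 2) Vh ltac:(lra)) as (dh & Vdh & Hdh).
      destruct (V_derive _ _ _ _ (sigma / 2) VH ltac:(lra)) as (dH & VdH & HdH).
      destruct (V_derive _ _ _ _ (sigma / 4) Vdh ltac:(lra)) as (ddh & _ & Hddh).
      destruct (V_derive _ _ _ _ (sigma / 4) VdH ltac:(lra)) as (ddH & _ & HddH).
      apply (zero_flux_counterterm (open_interval alpha beta) (twist_map a f g eps)
        (h eps) (fun t => y0 + H eps t) (dh eps) (dH eps) (2 * PI * w)); auto.
      - apply Hsympl. lra.
      - intros t. replace (dH eps t) with (0 + dH eps t) by ring.
        apply is_derive_Rplus; [apply is_derive_Rconst|auto].
      - apply (cont_derive _ (ddh eps)). auto.
      - apply (cont_derive _ (ddH eps)). auto.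
      - intros t. now rewrite PH.
      - intros t. apply (V_periodic rho (sigma - sigma / 2) _ _ _ _ Vdh Heps'). }
    split; [exact Ph|]. split; [exact PH|]. split; [intros x; now apply HIH|].
    intros x. rewrite Hmap, Hlam, Rminus_0_r. reflexivity.
  - intros eps psi Heps. split; eapply V_analytic2; eauto.
Qed.
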